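(* Let $\Lambda$ denote the von Mangoldt function and $[t]$ the integral part of a real number $t$. For every $\varepsilon>0$, $$\sum_{n\le x} \Lambda\Big(\Big[\frac{x}{n}\Big]\Big) = x\sum_{d\ge 1}\frac{\Lambda(d)}{d(d+1)} + O_{\varepsilon}\big(x^{9/19+\varepsilon}\big)\qquad (x\to\infty),$$ where the implied constant depends only on $\varepsilon$. *)

(* Defs.v *)
From mathcomp Require Import all_boot all_order all_algebra.
From mathcomp Require Import all_classical all_reals all_analysis.
From mathcomp Require Import ring.
Import Order.TTheory GRing.Theory Num.Theory.
Import numFieldNormedType.Exports.

Set Implicit Arguments.
Unset Strict Implicit.
Unset Printing Implicit Defensive.

Local Open Scope classical_set_scope.
Local Open Scope ring_scope.

(* [primes n] lists the distinct prime divisors of [n] (empty for n = 0, 1), so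
   the first branch is taken exactly when n = p ^ k with p prime and k >= 1; see
   [vonMangoldtX] and [vonMangoldt0]. *)
Definition vonMangoldt (R : realType) (n : nat) : R :=
  if primes n is [:: p] then ln (p%:R : R) else 0.

Lemma vonMangoldtX (R : realType) (p k : nat) :
  prime p -> (0 < k)%N -> vonMangoldt R (p ^ k) = ln (p%:R : R).
Proof.
by move=> p_pr k_gt0; rewrite /vonMangoldt primesX // primes_prime.
Qed.

Lemma vonMangoldt0 (R : realType) (n : nat) :
  (forall p k : nat, prime p -> (0 < k)%N -> n <> (p ^ k)%N) ->
  vonMangoldt R n = 0.
Proof.
move=> nX; rewrite /vonMangoldt; case En: (primes n) => [|p [|q s]] //.
have : p \in primes n by rewrite En mem_head.
rewrite mem_primes => /and3P[p_pr n_gt0 p_n].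
case: (nX p (logn p n)) => //; first by rewrite logn_gt0 En mem_head.
by rewrite {1}[n]prod_prime_decomp // prime_decompE En big_seq1.
Qed.

Lemma vonMangoldt_ge0 (R : realType) (n : nat) : 0 <= vonMangoldt R n.
Proof.
rewrite /vonMangoldt; case En: (primes n) => [|p [|q s]] //.
have : p \in primes n by rewrite En mem_head.
by rewrite mem_primes => /and3P[/prime_gt0 p_gt0 _ _]; rewrite ln_ge0 // ler1n.
Qed.

Lemma vonMangoldt_le_ln (R : realType) (n : nat) :
  (0 < n)%N -> vonMangoldt R n <= ln (n%:R : R).
Proof.
move=> n_gt0; have lnn_ge0 : 0 <= ln (n%:R : R) by rewrite ln_ge0 // ler1n.
rewrite /vonMangoldt; case En: (primes n) => [|p [|q s]] //.
have : p \in primes n by rewrite En mem_head.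
rewrite mem_primes => /and3P[/prime_gt0 p_gt0 _ p_n].
by rewrite ler_ln ?posrE ?ltr0n // ler_nat dvdn_leq.
Qed.

Lemma vonMangoldt_series_cvg (R : realType) :
  cvgn (fun N : nat =>
    \sum_(1 <= d < N) vonMangoldt R d / (d%:R * (d%:R + 1))).
Proof.
pose a d : R := vonMangoldt R d / (d%:R * (d%:R + 1)).
pose s d : R := Num.sqrt d%:R.
have a_ge0 d : 0 <= a d.
  by rewrite divr_ge0 ?vonMangoldt_ge0 // mulr_ge0 // addr_ge0.
have a_le d : (0 < d)%N -> a d <= - 4 * ((s d.+1)^-1 - (s d)^-1).
  move=> d_gt0.
  have u_gt0 : 0 < s d by rewrite sqrtr_gt0 ltr0n.
  have v_gt0 : 0 < s d.+1 by rewrite sqrtr_gt0 ltr0n.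
  have u2 : d%:R = s d ^+ 2 by rewrite sqr_sqrtr.
  have v2 : d%:R + 1 = s d.+1 ^+ 2 by rewrite sqr_sqrtr // -natr1.
  have uv : s d <= s d.+1 by rewrite ler_wsqrtr // ler_nat.
  have L : vonMangoldt R d <= 2 * s d.
    apply: (le_trans (vonMangoldt_le_ln R d_gt0)).
    rewrite u2 lnXn // -[_ *+ _]mulr_natl; apply: ler_wpM2l => //.
    exact/ltW/ln_sublinear.
  rewrite /a v2 u2; move: (s d) (s d.+1) u_gt0 v_gt0 uv L v2 u2 => u v u0 v0 uv L v2 u2.
  have -> : - 4 * (v^-1 - u^-1) = 4 * (u * v * (v - u)) / (u ^+ 2 * v ^+ 2).
    by field; rewrite !gt_eqF.
  apply: ler_wpM2r; first by rewrite invr_ge0 mulr_ge0 // exprn_ge0 // ltW.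
  apply: (le_trans L).
  have e : (v - u) * (v + u) = 1 by rewrite -subr_sqr -v2 -u2 addrAC subrr add0r.
  have -> : 2 * u = 2 * u * ((v - u) * (v + u)) by rewrite e mulr1.
  rewrite -subr_ge0.
  have -> : 4 * (u * v * (v - u)) - 2 * u * ((v - u) * (v + u))
          = 2 * u * (v - u) ^+ 2 by ring.
  by rewrite mulr_ge0 ?sqr_ge0 // mulr_ge0 // ltW.
apply: nondecreasing_is_cvgn.
  apply/nondecreasing_seqP => -[|n]; first by rewrite !big_geq.
  by rewrite [leRHS]big_nat_recr //= lerDl a_ge0.
exists 4 => _ [N _ <-].
case: N => [|N]; first by rewrite big_geq.
apply: (@le_trans _ _ (\sum_(1 <= d < N.+1) - 4 * ((s d.+1)^-1 - (s d)^-1))).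
  by rewrite !big_nat; apply: ler_sum => d /andP[d_gt0 _]; apply: a_le.
rewrite -mulr_sumr telescope_sumr // /s sqrtr1 invr1 mulNr -mulrN opprB.
by rewrite ler_piMr // lerBlDr lerDl invr_ge0 sqrtr_ge0.
Qed.

(* Main.v *)
(* Grouping the n with [x/n] = d turns the sum into
     sum_d Lambda(d) ([x/d] - [x/(d+1)]),
   so with L = x^(1/19) everything reduces to showing, for P = 2^i between L^9 and L^10 and for
   dl = 0, 1, that sum_(P <= d < 2P) Lambda(d) psi(x/(d+dl)) << L^9 log^6 x, where psi is the
   sawtooth.  Replacing psi by trigonometric polynomials of degree about P/L^9 leaves the sums
   sum_d Lambda(d) cos(2 pi h x/(d+dl) + ph), to which Vaughan's identity with U = V = L^2 is
   applied.  The linear (type I) sums have outer variable at most L^4 and are handled by van der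
   Corput's second-derivative test alone.  In the bilinear (type II) sums with MN = P, N <= 2M and
   h ~ H, Cauchy-Schwarz is applied over the long variable m ~ M after grouping the pairs (h,n)
   into about HN/L^2 cells according to the size of h/n.  Pairs with h/n = h'/n' are few and are
   bounded trivially; for the others the second-derivative test applies to the phase
   x (h/n - h'/n')/m.  Averaging over h as well as n is what makes the whole range
   L^2 << N << sqrt P admissible, hence the exponent 9/19.  Everything is done with cosines with
   a free phase ph, so no complex numbers occur. *)
Require Import Defs.
From mathcomp Require Import all_boot all_order all_algebra.
From mathcomp Require Import all_classical all_reals all_analysis.
From mathcomp Require Import ring lra zify.
Import Order.TTheory GRing.Theory Num.Theory.
Import numFieldNormedType.Exports.

Set Implicit Arguments.
Unset Strict Implicit.
Unset Printing Implicit Defensive.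

Local Open Scope classical_set_scope.
Local Open Scope ring_scope.

(** * Kuzmin-Landau and the second-difference test *)

(** The exponents come from one balance. Values of [[x/n]] beyond [L^10] and those below [L^9] cost
    about [L^9] trivially, so [L^9] is the target for every block. In a bilinear sum with [K] cells
    and cosine sums of size [E = sqrt (x L^2 / (M N^2))], Cauchy-Schwarz bounds the square, up to
    logarithms, by [M^2 K H N + M E (H N)^2]. With [K = H N / L^2] the first part is
    [H^2 P^2 / L^2], which reaches [H^2 L^18] at [P = L^10]; the second is at most [H^2 L^18] when
    [P N <= L^15]. Both are tight at [P = L^10], [N = L^5], and this fixes the number 19. Having at
    least one cell for [H = 1] forces [N >= L^2], hence the cut-off in Vaughan's identity; the
    linear sums then have up to [L^4] outer values at a cost of [L^5] each, again [L^9]. The shift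
    [dl = 1] is the technical obstacle: [x h / (m n + 1)] is not a multiple of [1 / m], so close
    ratios must be compared through slightly different shifts of [m], and this needs [M] to exceed
    [H] by a constant factor. *)

(* The real [v] is a free lower bound for the weights, so that they may change sign. *)
Lemma abel_ineq (R : realType) (w f : nat -> R) (b : nat) (G W : R) (a : nat) (v : R) :
  0 <= G -> v <= W ->
  (forall n, (a <= n < b)%N -> v <= w n <= W) ->
  (forall n, (a <= n)%N -> (n.+1 < b)%N -> w n <= w n.+1) ->
  (forall c, (a <= c <= b)%N -> `|\sum_(c <= n < b) f n| <= G) ->
  `|\sum_(a <= n < b) w n * f n - v * \sum_(a <= n < b) f n| <= (W - v) * G.
Proof.
move=> G_ge0; move Ek : (b - a)%N => k; elim: k a v Ek => [|k IH] a v Ek vW wW w_mono fG.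
  have ba : (b <= a)%N by rewrite -subn_eq0 Ek.
  by rewrite !big_geq // mulr0 subrr normr0 mulr_ge0 ?subr_ge0.
have ab : (a < b)%N by rewrite -subn_gt0 Ek.
have /andP[vwa waW] := wW a ltac:(by rewrite leqnn).
have H : `|\sum_(a.+1 <= n < b) w n * f n - w a * \sum_(a.+1 <= n < b) f n|
    <= (W - w a) * G.
  apply: IH => //.
  - by rewrite subnS Ek.
  - move=> n /andP[an nb]; have /andP[_ ->] : v <= w n <= W by apply: wW; rewrite nb ltnW.
    rewrite andbT; elim: n an nb => // n IHn; rewrite ltnS leq_eqVlt => /predU1P[<- nb|an nb].
      exact: w_mono.
    by rewrite (le_trans (IHn an (ltnW nb))) // w_mono // ltnW.
  - by move=> n an; apply: w_mono; rewrite ltnW.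
  - by move=> c /andP[ac cb]; apply: fG; rewrite cb ltnW.
have Sa : \sum_(a <= n < b) f n = f a + \sum_(a.+1 <= n < b) f n by rewrite big_ltn.
have faG := fG a ltac:(by rewrite leqnn ltnW).
rewrite big_ltn //.
have -> : w a * f a + \sum_(a.+1 <= n < b) w n * f n - v * \sum_(a <= n < b) f n =
  (w a - v) * \sum_(a <= n < b) f n +
  (\sum_(a.+1 <= n < b) w n * f n - w a * \sum_(a.+1 <= n < b) f n).
  by rewrite Sa; ring.
rewrite (le_trans (ler_normD _ _)) // normrM ger0_norm ?subr_ge0 //.
have : (w a - v) * `|\sum_(a <= n < b) f n| <= (w a - v) * G.
  by rewrite ler_wpM2l // subr_ge0.
by move: H; lra.
Qed.

Lemma cosD2pi_int (R : realType) (t : R) (k : int) : cos (t + (2 * pi) * k%:~R) = cos t.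
Proof.
have H (n : nat) s : cos (s + (2 * pi) * n%:R : R) = cos s.
  have -> : s + 2 * pi * n%:R = s + (pi *+ 2) *+ n.
    by rewrite mulr_natr mulr_natl.
  exact: (periodicn (@cosD2pi R)).
case: k => n; first exact: H.
rewrite NegzE mulrNz mulrN; have := H n.+1 (t - 2 * pi * n.+1%:R).
by rewrite subrK.
Qed.

Lemma sinD2pi_int (R : realType) (t : R) (k : int) : sin (t + (2 * pi) * k%:~R) = sin t.
Proof. by rewrite -!cosBpihalf addrAC cosD2pi_int. Qed.

(** Jordan's inequality with a weaker constant. In [sin y = 2 sin (y/2) cos (y/2)] both [cos (y/2)]
    and, by the mean value theorem, [sin (y/2) / (y/2)] are at least [cos (pi/4)], whose square is
    1/2. *)
Lemma sin_ge_half (R : realType) (y : R) : 0 <= y <= pi / 2 -> y / 2 <= sin y.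
Proof.
move=> /andP[y0 y1].
have z0 : 0 <= y / 2 by lra.
have pi0 := pi_gt0 R.
have cos_lb (z : R) : 0 <= z -> z <= y / 2 -> cos (pi / 4) <= cos z.
  move=> z0' z1'; rewrite le_eqVlt; apply/orP; have [->|zn] := eqVneq z (pi / 4); first by left.
  right; rewrite ltr_cos ?in_itv /=; [|lra|lra].
  by rewrite lt_neqAle zn /=; lra.
have sin_lb : cos (pi / 4) * (y / 2) <= sin (y / 2).
  have [->|yn] := eqVneq y 0; first by rewrite mul0r mulr0 sin0.
  have ygt : 0 < y / 2 by rewrite divr_gt0 // lt_neqAle eq_sym yn.
  have [c /[!in_itv]/= /andP[c0 c1]] := @MVT R (@sin R) (@cos R) _ _ ygt
     (fun x _ => is_derive_sin x) (continuous_subspaceT (@continuous_sin R)).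
  rewrite sin0 !subr0 => ->; apply: ler_wpM2r => //; apply: cos_lb; exact: ltW.
have c4 : cos (pi / 4) ^+ 2 = 1 / 2 :> R.
  have := @cos_mulr2n R (pi / 4); have -> : (pi / 4) *+ 2 = pi / 2 :> R.
    by rewrite -mulr_natl; field.
  rewrite cos_pihalf; lra.
have c40 : 0 <= cos (pi / 4) :> R by apply: cos_ge0_pihalf; lra.
have -> : y = (y / 2) *+ 2 by rewrite -mulr_natl; field.
rewrite sin_mulr2n; have := cos_lb _ z0 (lexx _).
move: (cos (y/2)) (sin (y/2)) sin_lb => u v h1 h2.
have : cos (pi / 4) * (cos (pi / 4) * (y / 2)) <= u * v.
  by apply: ler_pM => //; rewrite mulr_ge0.
rewrite mulrA -expr2 c4; lra.
Qed.

(** The source of cancellation in Kuzmin-Landau: the increments of the sine telescope, and the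
    cotangents of the half differences become Abel weights. *)
Lemma cos_addE (R : realType) (x y : R) : sin ((y - x) / 2) != 0 ->
  cos x + cos y = cos ((y - x) / 2) / sin ((y - x) / 2) * (sin y - sin x).
Proof.
move=> s0; pose m := (x + y) / 2; pose h := (y - x) / 2.
have -> : x = m - h by rewrite /m /h; field.
have -> : y = m + h by rewrite /m /h; field.
have -> : (m + h - (m - h)) / 2 = h by field.
by rewrite cosB cosD sinB sinD; field.
Qed.

(** The weights [w n], minus the cotangents of half the increments of [th], grow with these
    increments and are at most [4 / d] in size, while partial sums of the sine increments are at
    most 2. So [abel_ineq] gives [16 / d], and removing its term in [v] costs [8 / d]. The sum of
    [cos (th n) + cos (th n.+1)] is twice the wanted sum up to a boundary term of size 2, whence
    [12 / d + 1]. *)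
Lemma kuzmin_landau (R : realType) (th : nat -> R) (a b : nat) (d : R) :
  0 < d ->
  (forall n, (a <= n < b)%N -> d <= th n.+1 - th n <= 2 * pi - d) ->
  (forall n, (a <= n)%N -> (n.+1 < b)%N -> th n.+1 - th n <= th n.+2 - th n.+1) ->
  `|\sum_(a <= n < b) cos (th n)| <= 12 / d + 1.
Proof.
move=> d0 gd g_mono; have d12 : 0 < 12 / d by rewrite divr_gt0.
have [ba|ab] := leqP b a; first by rewrite big_geq // normr0; lra.
have pi0 := pi_gt0 R.
pose y n := (th n.+1 - th n) / 2.
have yd n : (a <= n < b)%N -> d / 2 <= y n <= pi - d / 2.
  by move=> /gd /andP[h1 h2]; rewrite /y; lra.
have siny n : (a <= n < b)%N -> d / 4 <= sin (y n).
  move=> /yd /andP[y1 y2]; have [yp|yp] := leP (y n) (pi / 2).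
    by apply: le_trans (sin_ge_half _); lra.
  have -> : sin (y n) = sin (pi - y n) by rewrite sinB sinpi cospi; ring.
  by apply: le_trans (sin_ge_half _); lra.
pose w n := - (cos (y n) / sin (y n)).
have w_bd n : (a <= n < b)%N -> - (4 / d) <= w n <= 4 / d.
  move=> /siny sy; have s0 : 0 < sin (y n) by apply: lt_le_trans sy; lra.
  rewrite -ler_norml /w normrN normrM normfV (ger0_norm (ltW s0)).
  rewrite ler_pdivrMr //; apply: le_trans (cos_max _) _.
  by rewrite mulrAC ler_pdivlMr //; lra.
have w_mono n : (a <= n)%N -> (n.+1 < b)%N -> w n <= w n.+1.
  move=> an nb.
  have i1 : (a <= n < b)%N by rewrite an ltnW.
  have i2 : (a <= n.+1 < b)%N by rewrite nb ltnW.
  have s1 : 0 < sin (y n) by apply: lt_le_trans (siny _ i1); lra.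
  have s2 : 0 < sin (y n.+1) by apply: lt_le_trans (siny _ i2); lra.
  rewrite -subr_ge0 /w.
  have -> : - (cos (y n.+1) / sin (y n.+1)) - - (cos (y n) / sin (y n))
    = sin (y n.+1 - y n) / (sin (y n.+1) * sin (y n)).
    by rewrite sinB; field; rewrite !gt_eqF.
  rewrite divr_ge0 ?mulr_ge0 ?(ltW s1) ?(ltW s2) //; apply: sin_ge0_pi.
  have := yd _ i1; have := yd _ i2; have := g_mono _ an nb; rewrite /y; lra.
pose f n := sin (th n.+1) - sin (th n).
have f_sum c : (a <= c <= b)%N -> `|\sum_(c <= n < b) f n| <= 2.
  move=> /andP[ac cb]; rewrite telescope_sumr //.
  have := sin_max (th b); have := sin_max (th c); rewrite !ler_norml; lra.
have D4 : - (4 / d) <= 4 / d by lra.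
have := abel_ineq (ltac:(lra) : 0 <= 2 :> R) D4 w_bd w_mono f_sum.
have -> : \sum_(a <= n < b) w n * f n = - \sum_(a <= n < b) (cos (th n) + cos (th n.+1)).
  rewrite -sumrN; apply: eq_big_nat => n i.
  rewrite cos_addE; last by rewrite gt_eqF //; apply: lt_le_trans (siny _ i); lra.
  by rewrite /w /f mulNr.
have -> : \sum_(a <= n < b) (cos (th n) + cos (th n.+1)) =
  2 * (\sum_(a <= n < b) cos (th n)) + (cos (th b) - cos (th a)).
  have <- := telescope_sumr (fun n => cos (th n)) (ltnW ab).
  rewrite mulr_sumr -big_split /=; apply: eq_bigr => n _; ring.
have := f_sum a ltac:(by rewrite leqnn ltnW).
have := cos_max (th b); have := cos_max (th a).
move: (\sum_(a <= n < b) f n) (\sum_(a <= n < b) cos (th n)) => F S.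
have F4 : `|F| <= 2 -> `|4 / d * F| <= 8 / d.
  move=> hF; rewrite normrM ger0_norm ?divr_ge0 ?(ltW d0) //; have : 0 < 4 / d by rewrite divr_gt0.
  by move=> h; have := ler_wpM2l (ltW h) hF; lra.
rewrite mulNr opprK => c1 c2 /F4; move: c1 c2; rewrite !ler_norml; lra.
Qed.

Lemma mono_split (R : realType) (g : nat -> R) (t : R) (b a : nat) : (a <= b)%N ->
  (forall n, (a <= n)%N -> (n.+1 < b)%N -> g n <= g n.+1) ->
  exists c, [/\ (a <= c <= b)%N, (forall n, (a <= n < c)%N -> g n < t)
    & (forall n, (c <= n < b)%N -> t <= g n)].
Proof.
move Ek : (b - a)%N => k; elim: k a Ek => [|k IH] a Ek ab g_mono.
  have /eqP ba : a == b by rewrite eqn_leq ab -subn_eq0 Ek /=.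
  by exists a; split; [rewrite leqnn ab | move=> n; lia | move=> n; lia].
have {}ab : (a < b)%N by rewrite -subn_gt0 Ek.
have [ga|ga] := ltP (g a) t; last first.
  exists a; split; [by rewrite leqnn ltnW | by move=> n; lia | move=> n].
  elim: n => [|n IHn]; first by rewrite leqn0 => /andP[/eqP a0 _]; rewrite -a0.
  move=> /andP[]; rewrite leq_eqVlt => /predU1P[<- //|]; rewrite ltnS => an nb.
  by apply: le_trans (g_mono _ an nb); apply: IHn; rewrite an ltnW.
have [||c [/andP[ac cb] c1 c2]] := IH a.+1 _ ab _; first by rewrite subnS Ek.
  by move=> n an; apply: g_mono; apply: ltnW.
exists c; split => //; first by rewrite cb ltnW.
by move=> n /andP[]; rewrite leq_eqVlt => /predU1P[<- //|an nc]; apply: c1; rewrite an.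
Qed.

Lemma growth_ge (R : realType) (g : nat -> R) (lam : R) (a b : nat) :
  (forall n, (a <= n)%N -> (n.+1 < b)%N -> lam <= g n.+1 - g n) ->
  forall n, (a <= n < b)%N -> g a + lam * (n - a)%:R <= g n.
Proof.
move=> H; elim=> [|n IH].
  by rewrite leqn0 => /andP[/eqP -> _]; rewrite subnn mulr0 addr0.
move=> /andP[]; rewrite leq_eqVlt => /predU1P[<- _|an nb].
  by rewrite subnn mulr0 addr0.
have := H n an nb; have := IH ltac:(by rewrite -ltnS an ltnW).
by rewrite subSn // -natr1; lra.
Qed.

Lemma growth_le (R : realType) (g : nat -> R) (mu : R) (a b : nat) :
  (forall n, (a <= n)%N -> (n.+1 < b)%N -> g n.+1 - g n <= mu) ->
  forall n, (a <= n < b)%N -> g n <= g a + mu * (n - a)%:R.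
Proof.
move=> H n nab; have Hm m : (a <= m)%N -> (m.+1 < b)%N -> - mu <= - g m.+1 - - g m.
  by move=> am mb; have := H m am mb; lra.
by have := growth_ge (g := fun n => - g n) Hm nab; lra.
Qed.

Lemma growth_length (R : realType) (g : nat -> R) (lam s d : R) (a b : nat) :
  0 < lam -> 0 <= d ->
  (forall n, (a <= n)%N -> (n.+1 < b)%N -> lam <= g n.+1 - g n) ->
  (forall n, (a <= n < b)%N -> s <= g n <= s + d) ->
  (b - a)%:R <= d / lam + 1.
Proof.
move=> lam0 d0 Hg Hs; have dl : 0 <= d / lam by rewrite divr_ge0 // ltW.
have [ba|ab] := leqP b a; first by rewrite (eqP ba); lra.
have ib : (a <= b.-1 < b)%N by lia.
have := growth_ge Hg ib; have := Hs _ ib; have := Hs a ltac:(by rewrite leqnn).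
have -> : (b - a)%N = (b.-1 - a).+1 by lia.
rewrite -natr1 lerD2r ler_pdivlMr // mulrC; lra.
Qed.

Lemma norm_sum_cos (R : realType) (th : nat -> R) (a b : nat) :
  `|\sum_(a <= n < b) cos (th n)| <= (b - a)%:R.
Proof.
rewrite (le_trans (ler_norm_sum _ _ _)) //.
rewrite (le_trans (ler_sum _ (fun n _ => cos_max (th n)))) //.
by rewrite sumr_const_nat.
Qed.

(** Increments within [d = sqrt lam] of an end of the period are rare, because they grow by at least
    [lam] per step: at most [1 / d + 1] indices at each end. Kuzmin-Landau gives [12 / d + 1] on the
    stretch between. *)
Lemma second_difference_period (R : realType) (th : nat -> R) (lam : R) (k : int) (a b : nat) :
  0 < lam ->
  (forall n, (a <= n)%N -> (n.+1 < b)%N ->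
    lam <= (th n.+2 - th n.+1) - (th n.+1 - th n)) ->
  (forall n, (a <= n < b)%N ->
    2 * pi * k%:~R <= th n.+1 - th n <= 2 * pi * k%:~R + 2 * pi) ->
  `|\sum_(a <= n < b) cos (th n)| <= 14 / Num.sqrt lam + 3.
Proof.
move=> lam0 Hlam Hk; set d := Num.sqrt lam.
have d0 : 0 < d by rewrite sqrtr_gt0.
have lamE : lam = d ^+ 2 by rewrite sqr_sqrtr // ltW.
have dE : d / lam = d^-1 by rewrite [X in _ / X]lamE expr2 invfM mulVKf // gt_eqF.
have [ba|ab] := leqP b a.
  by rewrite big_geq // normr0 addr_ge0 // divr_ge0 // ltW.
pose g n := th n.+1 - th n; pose s : R := 2 * pi * k%:~R.
have mono i j : (a <= i)%N -> (j <= b)%N ->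
    forall n, (i <= n)%N -> (n.+1 < j)%N -> g n <= g n.+1.
  move=> ai jb n im nj; have := Hlam n (leq_trans ai im) (leq_trans nj jb); rewrite /g; lra.
have [c1 [/andP[ac1 c1b] c1l c1r]] := mono_split (s + d) (ltnW ab) (mono _ _ (leqnn a) (leqnn b)).
have [c2 [/andP[c12 c2b] c2l c2r]] :=
  mono_split (s + 2 * pi - d) c1b (mono _ _ ac1 (leqnn b)).
rewrite (big_cat_nat ac1 c1b) (big_cat_nat c12 c2b) /=.
have B1 : (c1 - a)%:R <= d / lam + 1.
  apply: (@growth_length _ g lam s) => //; first exact: ltW.
    by move=> n an nc; apply: Hlam => //; apply: leq_trans nc c1b.
  move=> n /andP[an nc]; have := c1l n ltac:(by rewrite an).
  by have := Hk n ltac:(by rewrite an (leq_trans nc c1b)); rewrite /g /s; lra.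
have B3 : (b - c2)%:R <= d / lam + 1.
  apply: (@growth_length _ g lam (s + 2 * pi - d)) => //; first exact: ltW.
    by move=> n cn nb; apply: Hlam => //; apply: leq_trans (leq_trans ac1 c12) cn.
  move=> n /andP[cn nb]; have := c2r n ltac:(by rewrite cn).
  have := Hk n ltac:(by rewrite nb (leq_trans (leq_trans ac1 c12) cn)); rewrite /g /s; lra.
have B2 : `|\sum_(c1 <= n < c2) cos (th n)| <= 12 / d + 1.
  (* Subtracting [2 pi k n] from the phase changes no cosine and moves the increments into
     [[d, 2 pi - d]]. *)
  have -> : \sum_(c1 <= n < c2) cos (th n) =
      \sum_(c1 <= n < c2) cos (th n - s * n%:R).
    apply: eq_bigr => n _; rewrite -(cosD2pi_int (th n - s * n%:R) (k * n%:Z)).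
    by rewrite /s intrM; congr cos; ring.
  apply: kuzmin_landau => // n.
    move=> /andP[cn nc]; have := c1r n ltac:(by rewrite cn (leq_trans nc c2b)).
    have := c2l n ltac:(by rewrite cn); rewrite /g -natr1; lra.
  move=> cn nc; have := mono _ _ (leqnn a) (leqnn b) n (leq_trans ac1 cn) (leq_trans nc c2b).
  by rewrite /g -!natr1; lra.
have := norm_sum_cos th a c1; have := norm_sum_cos th c2 b.
rewrite dE in B1 B3.
move: B1 B2 B3.
have := ler_normD (\sum_(a <= n < c1) cos (th n))
  (\sum_(c1 <= n < c2) cos (th n) + \sum_(c2 <= n < b) cos (th n)).
have := ler_normD (\sum_(c1 <= n < c2) cos (th n)) (\sum_(c2 <= n < b) cos (th n)).
lra.
Qed.

(* Van der Corput's second-derivative test, with second differences instead of derivatives. *)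
Lemma second_difference_test (R : realType) (th : nat -> R) (lam mu : R) (a b : nat) :
  0 < lam -> lam <= mu ->
  (forall n, (a <= n)%N -> (n.+1 < b)%N ->
    lam <= (th n.+2 - th n.+1) - (th n.+1 - th n) <= mu) ->
  `|\sum_(a <= n < b) cos (th n)| <= ((b - a)%:R * mu + 2) * (14 / Num.sqrt lam + 3).
Proof.
move=> lam0 lamu H; pose g n := th n.+1 - th n; set B := _ + 3.
have B0 : 0 < B.
  by rewrite addr_gt0 // divr_gt0 // sqrtr_gt0.
have tp : 4 <= 2 * pi :> R by have := pi_ge2 R; lra.
have [ba|ab] := leqP b a; first by rewrite (eqP ba) mul0r add0r big_geq // normr0 mulr_ge0 // ltW.
have main j : forall (a b : nat) (k : int), (a <= b)%N ->
    (forall n, (a <= n)%N -> (n.+1 < b)%N ->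
      lam <= (th n.+2 - th n.+1) - (th n.+1 - th n)) ->
    (forall n, (a <= n < b)%N ->
      2 * pi * k%:~R <= g n <= 2 * pi * k%:~R + 2 * pi * j.+1%:R) ->
    `|\sum_(a <= n < b) cos (th n)| <= j.+1%:R * B.
  elim: j => [|j IH] {ab H}a {}b k ab Hl Hk.
    by rewrite mul1r; apply: (second_difference_period (k := k)) => // n /Hk; rewrite mulr1.
  have Hm n : (a <= n)%N -> (n.+1 < b)%N -> g n <= g n.+1.
    by move=> an nb; have := Hl n an nb; rewrite /g; lra.
  have [c [/andP[ac cb] cl cr]] := mono_split (2 * pi * k%:~R + 2 * pi * j.+1%:R) ab Hm.
  rewrite (big_cat_nat ac cb) /= (le_trans (ler_normD _ _)) //.
  rewrite -[j.+2%:R]natr1 mulrDl mul1r lerD //.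
    apply: (IH _ _ k) => // n an; first by move=> nc; apply: Hl => //; apply: leq_trans cb.
    have /andP[a1 a2] := an; have := Hk n ltac:(by rewrite a1 (leq_trans a2 cb)).
    by have := cl n an; lra.
  apply: (second_difference_period (k := k + j.+1%:Z)) => //.
    by move=> n cn; apply: Hl; apply: leq_trans cn.
  move=> n /andP[cn nb]; have := cr n ltac:(by rewrite cn).
  have := Hk n ltac:(by rewrite nb (leq_trans ac cn)).
  rewrite /g intrD -[j.+2%:R]natr1 /=; lra.
pose k := Num.floor (g a / (2 * pi)).
have k1 : 2 * pi * k%:~R <= g a.
  by rewrite mulrC -ler_pdivlMr ?floor_le //; lra.
have k2 : g a <= 2 * pi * k%:~R + 2 * pi.
  have : g a / (2 * pi) < (k + 1)%:~R by rewrite floorD1_gt.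
  by rewrite ltr_pdivrMr; [rewrite intrD /=; lra | lra].
have mu0 : 0 <= mu by lra.
have bam : 0 <= (b - a)%:R * mu by rewrite mulr_ge0.
(* Over the whole range the increments vary by at most [(b - a) mu], which is [q] periods. As [g a]
   may lie anywhere in its own period, [truncn q + 2] periods cover them. *)
pose q := (b - a)%:R * mu / (2 * pi).
have q0 : 0 <= q by rewrite divr_ge0 //; lra.
have qE : (b - a)%:R * mu = 2 * pi * q by rewrite /q [RHS]mulrC divfK // gt_eqF //; lra.
have qle : q <= (b - a)%:R * mu by rewrite qE; have := ler_wpM2r q0 tp; lra.
have /andP[t1 t2] := truncn_itv q0.
have Hl n : (a <= n)%N -> (n.+1 < b)%N ->
    lam <= (th n.+2 - th n.+1) - (th n.+1 - th n) by move=> an /(H n an)/andP[].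
have Hu n : (a <= n)%N -> (n.+1 < b)%N -> g n.+1 - g n <= mu.
  by move=> an /(H n an)/andP[].
have := main (Num.truncn q).+1 a b k (ltnW ab) Hl.
have wW : (Num.truncn q).+2%:R * B <= ((b - a)%:R * mu + 2) * B.
  by apply: ler_wpM2r; [exact: ltW | rewrite -!natr1; lra].
move=> HH; apply: le_trans wW; apply: HH => n nab.
have an : (a <= n)%N by have /andP[] := nab.
apply/andP; split.
  have := growth_ge (g := g) Hl nab.
  by have : 0 <= lam * (n - a)%:R; [rewrite mulr_ge0 // ltW | lra].
have h1 := growth_le Hu nab.
have h2 : mu * (n - a)%:R <= 2 * pi * q.
  have nb : (n <= b)%N by case/andP: nab => _ /ltnW.
  by rewrite -qE mulrC; apply: ler_wpM2r => //; rewrite ler_nat; apply: leq_sub2r.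
have : 2 * pi * q <= 2 * pi * (Num.truncn q).+1%:R by apply: ler_wpM2l; [lra | exact: ltW].
rewrite -[(Num.truncn q).+2%:R]natr1; lra.
Qed.

(** * Trigonometric approximation of the sawtooth *)

Lemma ler_of_derive_ge0 (R : realType) (f df : R -> R) (a b : R) : a <= b ->
  (forall x, a <= x <= b -> is_derive x 1 f (df x)) ->
  (forall x, a <= x <= b -> 0 <= df x) -> f a <= f b.
Proof.
move=> ab fdf df0; have Hd (x : R) : x \in `]a, b[ -> is_derive x 1 f (df x).
  by rewrite in_itv /= => /andP[x1 x2]; apply: fdf; rewrite !ltW.
have Hc : {within `[a, b]%classic, continuous f}.
  apply: derivable_within_continuous => x; rewrite in_itv /= => xab.
  by have [] := fdf x xab.
have [c] := MVT_segment ab Hd Hc.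
by rewrite in_itv /= => cab E; rewrite -subr_ge0 E mulr_ge0 ?df0 // subr_ge0.
Qed.

Lemma dirichlet_kernel (R : realType) (s : R) (H : nat) :
  sin s * (1 + 2 * \sum_(1 <= h < H.+1) cos (2 * h%:R * s)) = sin ((2 * H%:R + 1) * s).
Proof.
elim: H => [|H IH]; first by rewrite big_geq // !mulr0 addr0 add0r mul1r mulr1.
rewrite big_nat_recr //= [2 * _]mulrDr addrA mulrDr IH.
rewrite -[H.+1%:R]natr1; set u := 2 * (H%:R + 1) * s.
have -> : (2 * H%:R + 1) * s = u - s by rewrite /u; ring.
have -> : (2 * (H%:R + 1) + 1) * s = u + s by rewrite /u; ring.
by rewrite sinB sinD; ring.
Qed.

Lemma is_derive_sin_sum (R : realType) (H : nat) (s : R) :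
  is_derive s 1 (fun s : R => \sum_(1 <= h < H.+1) sin (2 * h%:R * s) / h%:R)
    (2 * \sum_(1 <= h < H.+1) cos (2 * h%:R * s)).
Proof.
elim: H => [|H IH].
  under eq_fun do rewrite big_geq //.
  by rewrite big_geq // mulr0; apply: is_derive_cst.
under eq_fun do rewrite big_nat_recr //=.
rewrite big_nat_recr //= mulrDr.
apply: is_deriveD.
have -> : (fun x : R => sin (2 * H.+1%:R * x) / H.+1%:R) =
   (H.+1%:R^-1 : R) \*: (@sin R \o ( *%R (2 * H.+1%:R))).
  by apply/funext => x /=; rewrite mulrC.
have D : is_derive s 1 ( *%R (2 * H.+1%:R)) (2 * H.+1%:R : R).
  by have := is_deriveZ (2 * H.+1%:R : R) (is_derive_id s (1 : R)); rewrite scaler1.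
apply: is_derive_eq.
have : H.+1%:R != 0 :> R by rewrite pnatr_eq0.
by rewrite /GRing.scale /=; move: H.+1%:R => u u0; field.
Qed.

(** For [c = 2 H + 1] the first term cancels the Dirichlet kernel. For [sg] equal to 1 or -1 what
    remains has a constant sign as long as [cos s >= 0]. *)
Lemma is_derive_corrector (R : realType) (c sg s : R) : c != 0 -> sin s != 0 ->
  is_derive s 1 (fun s : R => (cos (c * s) + sg) / (c * sin s))
    (- (sin (c * s) / sin s) - (cos (c * s) + sg) * cos s / (c * sin s ^+ 2)).
Proof.
move=> c0 s0.
have D : is_derive s 1 ( *%R c) c.
  by have := is_deriveZ c (is_derive_id s (1 : R)); rewrite scaler1.
have E1 : is_derive s 1 (fun s : R => cos (c * s) + sg) (- sin (c * s) * c).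
  have -> : (fun s : R => cos (c * s) + sg) = (@cos R \o *%R c) \+ cst sg by [].
  by apply: is_derive_eq; rewrite addr0 /GRing.scale /= mulrC.
have E2 : is_derive s 1 (fun s : R => (c * sin s)^-1) (- (c * sin s) ^- 2 *: (c *: cos s)).
  apply: (@is_deriveV R (c \*: (@sin R)) s); first by rewrite mulf_neq0.
have -> : (fun s : R => (cos (c * s) + sg) / (c * sin s)) =
  (fun s => cos (c * s) + sg) * (fun s => (c * sin s)^-1) by [].
apply: is_derive_eq.
by rewrite /GRing.scale /=; field; rewrite c0 s0.
Qed.

(* The derivative of the left side is a Dirichlet kernel.  Adding
   [(cos ((2H+1)s) ± 1) / ((2H+1) sin s)] makes it monotone. *)
Lemma sawtooth_partial_sum (R : realType) (H : nat) (s : R) : 0 < s <= pi / 2 ->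
  `|s - pi / 2 + \sum_(1 <= h < H.+1) sin (2 * h%:R * s) / h%:R|
    <= 2 / ((2 * H%:R + 1) * sin s).
Proof.
move=> /andP[s0 s1]; pose c : R := 2 * H%:R + 1.
have c0 : 0 < c by rewrite ltr_wpDl // mulr_ge0.
pose S (s : R) := s - pi / 2 + \sum_(1 <= h < H.+1) sin (2 * h%:R * s) / h%:R.
pose F sg (s : R) := (cos (c * s) + sg) / (c * sin s).
have pi0 := pi_gt0 R.
have sin0 x : s <= x <= pi / 2 -> 0 < sin x.
  by move=> /andP[x1 x2]; apply: sin_gt0_pi; lra.
have cos0 x : s <= x <= pi / 2 -> 0 <= cos x.
  by move=> /andP[x1 x2]; apply: cos_ge0_pihalf; lra.
have HD sg x : s <= x <= pi / 2 ->
    is_derive x 1 (fun x => S x + F sg x) (- ((cos (c * x) + sg) * cos x / (c * sin x ^+ 2))).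
  move=> xs; have sx := sin0 _ xs.
  have D1 : is_derive x 1 S (1 + 2 * \sum_(1 <= h < H.+1) cos (2 * h%:R * x)).
    apply: is_deriveD; last exact: is_derive_sin_sum.
    by have := is_deriveB (is_derive_id x (1 : R)) (is_derive_cst (pi / 2 : R) x 1); rewrite subr0.
  have D2 : is_derive x 1 (F sg) _ := is_derive_corrector sg (lt0r_neq0 c0) (lt0r_neq0 sx).
  have := is_deriveD D1 D2; congr is_derive.
  have := dirichlet_kernel x H; rewrite -/c => <-.
  by rewrite mulrAC divff ?gt_eqF // mul1r; ring.
have Shalf : S (pi / 2) = 0.
  rewrite /S subrr add0r big1_seq // => h _.
  have -> : 2 * h%:R * (pi / 2) = 0 + pi *+ h :> R.
    by rewrite add0r -mulr_natl; field.
  by rewrite (alternatingn (@sinDpi R)) trigo.sin0 mulr0 mul0r.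
have Fhalf sg : F sg (pi / 2) = sg / c.
  rewrite /F sin_pihalf mulr1.
  have -> : c * (pi / 2) = pi / 2 + pi *+ H.
    by rewrite /c -mulr_natl; field.
  by rewrite (alternatingn (@cosDpi R)) cos_pihalf mulr0 add0r.
have half_in : s <= s <= pi / 2 by rewrite lexx.
have ss := sin0 _ half_in.
(* [S + F (-1)] increases on [[s, pi/2]] to [- 1 / c], and [S + F 1] decreases to [1 / c]. So [S s]
   lies between [- F 1 s] and [- F (-1) s], both at most [2 / (c sin s)] in size. *)
have up : S s + F (-1) s <= 0.
  have : S s + F (-1) s <= S (pi / 2) + F (-1) (pi / 2).
    apply: (ler_of_derive_ge0 s1 (HD (-1))) => x xs.
    rewrite oppr_ge0 mulr_le0_ge0 //.
      by rewrite mulr_le0_ge0 ?cos0 // subr_le0 cos_le1.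
    by rewrite invr_ge0 mulr_ge0 ?exprn_ge0 // ltW // sin0.
  rewrite Shalf Fhalf; have : 0 < c^-1 by rewrite invr_gt0.
  by move=> ? /le_trans; apply; lra.
have lo : 0 <= S s + F 1 s.
  have : - (S s + F 1 s) <= - (S (pi / 2) + F 1 (pi / 2)).
    apply: (@ler_of_derive_ge0 _ (fun s => - (S s + F 1 s))
      (fun x => (cos (c * x) + 1) * cos x / (c * sin x ^+ 2)) s (pi / 2) s1) => x xs.
      by have := is_deriveN (HD 1 x xs); rewrite opprK.
    rewrite divr_ge0 // mulr_ge0 ?cos0 //.
    - by have := cos_geN1 (c * x); lra.
    - by rewrite exprn_ge0 // ltW // sin0.
  rewrite Shalf Fhalf; have : 0 < c^-1 by rewrite invr_gt0.
  lra.
have cs0 : 0 < (c * sin s)^-1 by rewrite invr_gt0 mulr_gt0.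
rewrite -/(S s) -/c; move: up lo; rewrite /F.
have := ler_wpM2r (ltW cs0) (cos_le1 (c * s)).
have := ler_wpM2r (ltW cs0) (cos_geN1 (c * s)).
rewrite ler_norml; move: ((c * sin s)^-1) (cos (c * s)) => u v; lra.
Qed.

Lemma sin_le_id (R : realType) (z : R) : 0 <= z -> sin z <= z.
Proof.
move=> z0; have := @ler_of_derive_ge0 R (fun z => z - sin z) (fun z => 1 - cos z) 0 z z0.
rewrite sin0 subr0 subr_ge0; apply => x _; by rewrite subr_ge0 cos_le1.
Qed.

Lemma cos_ge_half (R : realType) (y : R) : 0 <= y <= 1 -> 1 / 2 <= cos y.
Proof.
move=> /andP[y0 y1]; have -> : y = (y / 2) *+ 2 by rewrite -mulr_natl; field.
have z0 : 0 <= y / 2 by lra.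
have s1 := sin_le_id z0.
have s0 : 0 <= sin (y / 2) by apply: sin_ge0_pi; have := pi_ge2 R; lra.
rewrite cos_mulr2n cos2sin2.
have : sin (y / 2) ^+ 2 <= (1 / 2) ^+ 2 by rewrite ler_sqr ?nnegrE; lra.
move: (sin (y / 2) ^+ 2) => u; lra.
Qed.

Lemma pi_le4 (R : realType) : pi <= 4 :> R.
Proof. by have := pihalf_lt2 R; lra. Qed.

Section Sawtooth.
Variable R : realType.
Implicit Types (t v : R) (H K : nat).

(** [truncn] is 0 on negative reals, so this is the usual sawtooth for [t >= 0], where all later
    arguments lie. *)
Definition saw t : R := t - (Num.truncn t)%:R - 1 / 2.

(** The squared modulus of a geometric sum of [K] terms, that is [K] times the Fejér kernel, written
    with real squares. *)
Definition fejer K t : R :=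
  (\sum_(0 <= k < K) cos (2 * pi * k%:R * t)) ^+ 2 +
  (\sum_(0 <= k < K) sin (2 * pi * k%:R * t)) ^+ 2.

(** A majorant for the truncation error of the Fourier series. A single Fejér kernel of order at
    least 2 has zeros in [(0, 1)] and cannot dominate that error; with all orders up to [H] present,
    each [K] below [1 / (2 pi t)] contributes at least 1/4. *)
Definition fejer_mean H t : R := \sum_(1 <= K < H.+1) fejer K t / K%:R ^+ 2.

(** With [v - 1/2] in place of [saw v] this is odd under [v -> 1 - v], end points included, which
    halves the range to be treated. *)
Definition saw_error H v : R :=
  v - 1 / 2 + \sum_(1 <= h < H.+1) sin (2 * pi * h%:R * v) / (pi * h%:R).

Lemma fejer_ge0 K t : 0 <= fejer K t.
Proof. by rewrite addr_ge0 // sqr_ge0. Qed.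

Lemma fejer_lower K t : 0 <= t -> 2 * pi * K%:R * t <= 1 -> K%:R ^+ 2 / 4 <= fejer K t.
Proof.
move=> t0 Kt; have := pi_gt0 R => pi0.
have : (K%:R / 2) ^+ 2 <= (\sum_(0 <= k < K) cos (2 * pi * k%:R * t)) ^+ 2.
  rewrite ler_sqr ?nnegrE ?divr_ge0 //.
    have -> : K%:R / 2 = \sum_(0 <= k < K) (1 / 2 : R).
      by rewrite sumr_const_nat subn0 -[RHS]mulr_natr mul1r mulrC.
    rewrite !big_nat; apply: ler_sum => k /andP[_ kK]; apply: cos_ge_half.
    rewrite !mulr_ge0 ?(ltW pi0) //=; apply: le_trans Kt.
    rewrite ler_wpM2r // ler_wpM2l ?mulr_ge0 ?(ltW pi0) // ler_nat; exact: ltnW.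
  rewrite big_nat; apply: sumr_ge0 => k /andP[_ kK].
  apply: le_trans (cos_ge_half _); first lra.
  rewrite !mulr_ge0 ?(ltW pi0) //=; apply: le_trans Kt.
  rewrite ler_wpM2r // ler_wpM2l ?mulr_ge0 ?(ltW pi0) // ler_nat; exact: ltnW.
rewrite /fejer; have := sqr_ge0 (\sum_(0 <= k < K) sin (2 * pi * k%:R * t)).
by move: (_ ^+ 2) => u u0; rewrite exprMn; lra.
Qed.

Lemma fejer_mean_lower H q t : 0 <= t -> (q <= H)%N -> 2 * pi * q%:R * t <= 1 ->
  q%:R / 4 <= fejer_mean H t.
Proof.
move=> t0 qH qt; have pi0 := pi_gt0 R.
rewrite /fejer_mean (big_cat_nat (n := q.+1)) //=.
have -> : q%:R / 4 = \sum_(1 <= K < q.+1) (1 / 4 : R) + 0.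
  by rewrite sumr_const_nat subn1 addr0 -[RHS]mulr_natr mul1r mulrC.
apply: lerD; last by apply: sumr_ge0 => K _; rewrite divr_ge0 ?fejer_ge0 // exprn_ge0.
rewrite !big_nat; apply: ler_sum => K /andP[K1 Kq].
rewrite ler_pdivlMr ?exprn_gt0 ?ltr0n //.
apply: le_trans (fejer_lower t0 _); first lra.
apply: le_trans qt; rewrite ler_wpM2r // ler_wpM2l ?mulr_ge0 ?(ltW pi0) //.
by rewrite ler_nat -ltnS.
Qed.

(** The error behaves like [min 1 (1 / (H v))]. Below [1 / (2 pi H)] the series is bounded term by
    term with [sin z <= z], and every order of the majorant contributes. Above,
    [sawtooth_partial_sum] gives [1 / (2 H v)], and the majorant has to supply [1 / v]. *)
Lemma saw_error_half H v : (0 < H)%N -> 0 <= v <= 1 / 2 ->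
  `|saw_error H v| <= 32 / H%:R * fejer_mean H v.
Proof.
move=> H0 /andP[v0 v1]; have pi0 := pi_gt0 R; have pi2 := pi_ge2 R; have pi4 := pi_le4 R.
have HR0 : 0 < H%:R :> R by rewrite ltr0n.
have [small|large] := leP (2 * pi * H%:R * v) 1.
  have G := fejer_mean_lower v0 (leqnn H) small.
  have E : `|saw_error H v| <= 1 / 2 + 2 * H%:R * v.
    rewrite (le_trans (ler_normD _ _)) // lerD //; first by rewrite ler_norml; lra.
    rewrite (le_trans (ler_norm_sum _ _ _)) //.
    have -> : 2 * H%:R * v = \sum_(1 <= h < H.+1) (2 * v).
      by rewrite sumr_const_nat subn1 -[RHS]mulr_natr /=; ring.
    rewrite !big_nat; apply: ler_sum => h /andP[h1 hH].
    have h0 : 0 < h%:R :> R by rewrite ltr0n.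
    have hv : 2 * pi * h%:R * v <= 1.
      apply: le_trans small; rewrite ler_wpM2r // ler_wpM2l ?mulr_ge0 ?(ltW pi0) //.
      by rewrite ler_nat -ltnS.
    have x0 : 0 <= 2 * pi * h%:R * v by rewrite !mulr_ge0 // ltW.
    rewrite ger0_norm; last first.
      by rewrite divr_ge0 ?mulr_ge0 ?(ltW pi0) // sin_ge0_pi //; lra.
    rewrite ler_pdivrMr ?mulr_gt0 // (le_trans (sin_le_id x0)) //.
    by rewrite le_eqVlt; apply/orP; left; apply/eqP; ring.
  have Hv : 2 * H%:R * v <= 1 / 2.
    have : 2 * (2 * H%:R * v) <= pi * (2 * H%:R * v) by rewrite ler_wpM2r // !mulr_ge0.
    lra.
  apply: le_trans E _; have -> : 32 / H%:R * fejer_mean H v = 8 * (fejer_mean H v * 4 / H%:R).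
    by field; rewrite gt_eqF.
  have : 1 <= fejer_mean H v * 4 / H%:R by rewrite ler_pdivlMr //; lra.
  lra.
have vgt : 0 < v.
  rewrite lt_neqAle v0 andbT; apply/eqP => v00; move: large; rewrite -v00 mulr0; lra.
have E : `|saw_error H v| <= 1 / (2 * H%:R * v).
  have s_in : 0 < pi * v <= pi / 2.
    by rewrite mulr_gt0 //=; have := ler_wpM2l (ltW pi0) v1; lra.
  have := sawtooth_partial_sum H s_in.
  have -> : pi * v - pi / 2 + \sum_(1 <= h < H.+1) sin (2 * h%:R * (pi * v)) / h%:R =
     pi * saw_error H v.
    rewrite /saw_error mulrDr mulr_sumr; congr (_ + _); first by field.
    rewrite !big_nat; apply: eq_bigr => h /andP[h1 _].
    have -> : 2 * h%:R * (pi * v) = 2 * pi * h%:R * v by ring.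
    have h0 : h%:R != 0 :> R by rewrite pnatr_eq0 -lt0n.
    by move: (pi : R) pi0 (sin _) => p p0 u; field; rewrite h0 gt_eqF.
  rewrite normrM gtr0_norm //.
  have s1 : pi * v / 2 <= sin (pi * v) by apply: sin_ge_half; case/andP: s_in => /ltW -> ->.
  have s0 : 0 < pi * v / 2 by rewrite divr_gt0 // mulr_gt0.
  have u1 : 2 / ((2 * H%:R + 1) * sin (pi * v)) <= 2 / (H%:R * (pi * v)).
    have ss0 := lt_le_trans s0 s1.
    have c0 : 0 < 2 * H%:R + 1 :> R by rewrite ltr_wpDl ?mulr_ge0.
    rewrite ler_wpM2l // lef_pV2 ?posrE ?mulr_gt0 //.
    have -> : H%:R * (pi * v) = (2 * H%:R) * (pi * v / 2) by field.
    by apply: ler_pM; rewrite ?lerDl // ?(ltW s0) // mulr_ge0.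
  move=> /le_trans /(_ u1); rewrite -ler_pdivlMl // => /le_trans; apply.
  have -> : pi^-1 * (2 / (H%:R * (pi * v))) = 2 / (pi * pi) / (H%:R * v).
    by move: (pi : R) pi0 => p p0; field; rewrite !gt_eqF.
  have -> : 1 / (2 * H%:R * v) = (1 / 2) / (H%:R * v) by field; rewrite !gt_eqF.
  apply: ler_wpM2r; first by rewrite invr_ge0 mulr_ge0 // ltW.
  rewrite ler_pdivrMr ?mulr_gt0 //; have : 2 * 2 <= pi * pi :> R by apply: ler_pM.
  lra.
have G : 1 / v <= 64 * fejer_mean H v.
  (* Beyond [1 / (2 pi)] the order [K = 1] suffices, since its Fejér square is 1. *)
  have [v2|v2] := leP (2 * pi * v) 1; last first.
    have G1 : 1 <= fejer_mean H v.
      rewrite /fejer_mean big_ltn // /fejer !big_nat1 !mulr0 mul0r cos0 sin0.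
      rewrite expr0n /= addr0 expr1n divr1 lerDl.
      by apply: sumr_ge0 => K _; rewrite divr_ge0 ?fejer_ge0 // exprn_ge0.
    rewrite ler_pdivrMr //.
    have : pi * v <= 4 * v by rewrite ler_wpM2r.
    have : v <= fejer_mean H v * v by rewrite ler_peMl.
    lra.
  (* The orders up to [q = truncn z] contribute [q / 4]; with [z <= q + 1 <= 2 q] and [pi <= 4] this
     makes the factor 64. *)
  pose z := 1 / (2 * pi * v).
  have pv0 : 0 < 2 * pi * v by rewrite !mulr_gt0.
  have z1 : 1 <= z by rewrite /z ler_pdivlMr // mul1r.
  have z0 : 0 <= z by lra.
  have /andP[q1 q2] := truncn_itv z0; set q := Num.truncn z in q1 q2 *.
  have qH : (q <= H)%N.
    rewrite -(ler_nat R); apply: le_trans q1 _; rewrite /z ler_pdivrMr //; lra.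
  have qv : 2 * pi * q%:R * v <= 1.
    have : q%:R * (2 * pi * v) <= z * (2 * pi * v) by rewrite ler_wpM2r // ltW.
    by rewrite /z divfK ?gt_eqF //; lra.
  have := fejer_mean_lower v0 qH qv.
  have q1' : 1 <= q%:R :> R by rewrite ler1n truncn_gt0.
  have -> : 1 / v = 2 * pi * z by rewrite /z; move: (pi : R) pi0 => p p0; field; rewrite !gt_eqF.
  have : pi * z <= 4 * z by rewrite ler_wpM2r.
  by rewrite -natr1 in q2; lra.
apply: le_trans E _.
have -> : 1 / (2 * H%:R * v) = (1 / v) * (1 / (2 * H%:R)) by field; rewrite !gt_eqF.
have -> : 32 / H%:R * fejer_mean H v = (64 * fejer_mean H v) * (1 / (2 * H%:R)).
  by field; rewrite !gt_eqF.
by apply: ler_wpM2r => //; rewrite divr_ge0 // mulr_ge0.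
Qed.

End Sawtooth.

Section SawtoothSum.
Variable R : realType.
Implicit Types (t v : R) (H K : nat).

Lemma trig_shift (z : nat) (h : nat) (v : R) :
  (sin (2 * pi * h%:R * (v + z%:R)) = sin (2 * pi * h%:R * v)) *
  (cos (2 * pi * h%:R * (v + z%:R)) = cos (2 * pi * h%:R * v)).
Proof.
have -> : 2 * pi * h%:R * (v + z%:R) = 2 * pi * h%:R * v + 2 * pi * ((h * z)%N : int)%:~R.
  by rewrite -pmulrn natrM; ring.
by rewrite sinD2pi_int cosD2pi_int.
Qed.

Lemma trig_reflect (h : nat) (v : R) :
  (sin (2 * pi * h%:R * (1 - v)) = - sin (2 * pi * h%:R * v)) *
  (cos (2 * pi * h%:R * (1 - v)) = cos (2 * pi * h%:R * v)).
Proof. by rewrite [1 - v]addrC !(trig_shift 1) mulrN sinN cosN. Qed.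

(** By periodicity only the fractional part [v] matters, and [v > 1/2] is reflected to [1 - v],
    where the error changes sign and the Fejér mean does not change. *)
Lemma saw_fourier H t : (0 < H)%N -> 0 <= t ->
  `|saw t + \sum_(1 <= h < H.+1) sin (2 * pi * h%:R * t) / (pi * h%:R)|
    <= 32 / H%:R * fejer_mean H t.
Proof.
move=> H0 t0; have /andP[] := truncn_itv t0; rewrite /saw; set z := Num.truncn t => z1 z2.
pose v := t - z%:R; have tE : t = v + z%:R by rewrite /v subrK.
have v0 : 0 <= v by rewrite subr_ge0.
have v1 : v <= 1 by move: z2; rewrite -natr1 /v; lra.
have -> : t - z%:R - 1 / 2 + \sum_(1 <= h < H.+1) sin (2 * pi * h%:R * t) / (pi * h%:R) =
    saw_error H v.
  rewrite /saw_error -/v; congr (_ + _); apply: eq_bigr => h _.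
  by rewrite {1}tE trig_shift.
have -> : fejer_mean H t = fejer_mean H v.
  apply: eq_bigr => K _; rewrite /fejer; congr ((_ ^+ 2 + _ ^+ 2) / _);
    by apply: eq_bigr => k _; rewrite {1}tE trig_shift.
have [vh|vh] := leP v (1 / 2); first by apply: saw_error_half; rewrite ?v0.
have w_in : 0 <= 1 - v <= 1 / 2 by lra.
have := saw_error_half H0 w_in.
have -> : saw_error H (1 - v) = - saw_error H v.
  rewrite /saw_error [RHS]opprD -sumrN; congr (_ + _); first lra.
  by apply: eq_bigr => h _; rewrite trig_reflect mulNr.
have -> : fejer_mean H (1 - v) = fejer_mean H v.
  apply: eq_bigr => K _; rewrite /fejer; congr ((_ + _) / _).
    by congr (_ ^+ 2); apply: eq_bigr => k _; rewrite trig_reflect.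
  by rewrite -sqrrN -sumrN; congr (_ ^+ 2); apply: eq_bigr => k _; rewrite trig_reflect opprK.
by rewrite normrN.
Qed.

Definition harmonic_sum (n : nat) : R := \sum_(1 <= k < n) k%:R^-1.

(** In truncated subtraction [k - l + (l - k)] is the distance of [k] and [l], a form used again for
    close pairs. Distance 0 occurs once, every other distance at most twice. *)
Lemma sum_sub_le (c : nat -> R) (k K H : nat) : (forall j, 0 <= c j) ->
  (k < K)%N -> (K <= H.+1)%N ->
  \sum_(0 <= l < K) c (k - l + (l - k))%N <= c 0%N + 2 * \sum_(1 <= j < H.+1) c j.
Proof.
move=> c0 kK KH; have trunc n : (n <= H.+1)%N ->
    \sum_(1 <= j < n) c j <= \sum_(1 <= j < H.+1) c j.
  move=> nH; have [n1|n1] := ltnP n 1; first by rewrite big_geq ?sumr_ge0 // ltnW.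
  by rewrite [leRHS](big_cat_nat n1 nH) /= lerDl sumr_ge0.
rewrite (big_cat_nat (leq0n k) (ltnW kK)) /= [X in _ + X]big_ltn // subnn addnn /=.
have -> : \sum_(0 <= l < k) c (k - l + (l - k))%N = \sum_(1 <= j < k.+1) c j.
  rewrite big_nat_rev [RHS]big_add1 /= add0n.
  rewrite !big_nat; apply: eq_bigr => l lk; congr c; lia.
have -> : \sum_(k.+1 <= l < K) c (k - l + (l - k))%N = \sum_(1 <= j < K - k) c j.
  have -> : k.+1 = (1 + k)%N by rewrite add1n.
  rewrite big_addn.
  rewrite !big_nat; apply: eq_bigr => l lk; congr c; lia.
have := trunc k.+1 ltac:(lia); have := trunc (K - k)%N ltac:(lia).
rewrite /= ; lra.
Qed.

Lemma sqr_sum_trig (K : nat) (u : nat -> R) :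
  (\sum_(0 <= k < K) cos (u k)) ^+ 2 + (\sum_(0 <= k < K) sin (u k)) ^+ 2 =
  \sum_(0 <= k < K) \sum_(0 <= l < K) cos (u k - u l).
Proof.
rewrite !expr2 !big_distrl /= -big_split /=; apply: eq_bigr => k _.
rewrite !big_distrr /= -big_split /=; apply: eq_bigr => l _.
by rewrite cosB.
Qed.

(** Squaring out the Fejér kernels gives cosine sums whose frequencies are the distances [|k - l|],
    and summing over the orders [K] gives the harmonic factor. The remaining factor [1 / H] is
    relaxed to [1 / h], so that sine and cosine sums take the same shape and can both be grouped
    dyadically in [h]. *)
Lemma saw_weighted_sum (H a b : nat) (w y : nat -> R) : (0 < H)%N ->
  (forall d, 0 <= w d) -> (forall d, 0 <= y d) ->
  `|\sum_(a <= d < b) w d * saw (y d)| <=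
    \sum_(1 <= h < H.+1) `|\sum_(a <= d < b) w d * sin (2 * pi * h%:R * y d)| / h%:R
    + 32 * harmonic_sum H.+1 * ((\sum_(a <= d < b) w d) / H%:R +
       2 * \sum_(1 <= h < H.+1) `|\sum_(a <= d < b) w d * cos (2 * pi * h%:R * y d)| / h%:R).
Proof.
move=> H0 w0 y0; have HR0 : 0 < H%:R :> R by rewrite ltr0n.
have pi2 := pi_ge2 R; have pi0 := pi_gt0 R.
pose C h := `|\sum_(a <= d < b) w d * cos (2 * pi * h%:R * y d)|.
pose S h := \sum_(a <= d < b) w d * sin (2 * pi * h%:R * y d).
have C0 j : 0 <= C j by rewrite normr_ge0.
have CW : C 0%N = \sum_(a <= d < b) w d.
  rewrite /C ger0_norm; last first.
    by apply: sumr_ge0 => d _; rewrite mulr0 mul0r cos0 mulr1.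
  by apply: eq_bigr => d _; rewrite mulr0 mul0r cos0 mulr1.
have fejC K : (1 <= K < H.+1)%N -> \sum_(a <= d < b) w d * fejer K (y d) <=
    K%:R * (C 0%N + 2 * \sum_(1 <= j < H.+1) C j).
  move=> /andP[K1 KH].
  have -> : \sum_(a <= d < b) w d * fejer K (y d) =
     \sum_(0 <= k < K) \sum_(0 <= l < K) \sum_(a <= d < b)
        w d * cos (2 * pi * (k - l + (l - k))%N%:R * y d).
    under [RHS]eq_bigr do rewrite exchange_big /=.
    rewrite [RHS]exchange_big /=; apply: eq_bigr => d _.
    rewrite /fejer sqr_sum_trig mulr_sumr.
    apply: eq_bigr => k _; rewrite mulr_sumr; apply: eq_bigr => l _; congr (_ * _).
    have [kl|lk] := leqP k l.
      rewrite -(cosN (_ - _)); congr cos.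
      have -> : (k - l + (l - k))%N = (l - k)%N by lia.
      by rewrite natrB //; ring.
    have -> : (k - l + (l - k))%N = (k - l)%N by lia.
    by rewrite natrB 1?ltnW //; congr cos; ring.
  have -> : K%:R * (C 0%N + 2 * \sum_(1 <= j < H.+1) C j) =
      \sum_(0 <= k < K) (C 0%N + 2 * \sum_(1 <= j < H.+1) C j).
    by rewrite sumr_const_nat subn0 mulr_natl.
  rewrite [leLHS]big_nat [leRHS]big_nat; apply: ler_sum => k /andP[_ kK].
  apply: (le_trans _ (sum_sub_le C0 kK (ltnW KH))); apply: ler_sum => l _.
  exact: ler_norm.
have main : `|\sum_(a <= d < b) w d * saw (y d) + \sum_(1 <= h < H.+1) S h / (pi * h%:R)|
   <= \sum_(a <= d < b) w d * (32 / H%:R * fejer_mean H (y d)).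
  have -> : \sum_(1 <= h < H.+1) S h / (pi * h%:R) = \sum_(a <= d < b) w d *
      \sum_(1 <= h < H.+1) sin (2 * pi * h%:R * y d) / (pi * h%:R).
    under [RHS]eq_bigr do rewrite mulr_sumr.
    rewrite exchange_big /=; apply: eq_bigr => h _; rewrite /S mulr_suml.
    by apply: eq_bigr => d _; rewrite mulrA.
  rewrite -big_split /= (le_trans (ler_norm_sum _ _ _)) //; apply: ler_sum => d _.
  by rewrite -mulrDr normrM ger0_norm // ler_wpM2l // saw_fourier.
have E2 : \sum_(a <= d < b) w d * (32 / H%:R * fejer_mean H (y d)) <=
    32 * harmonic_sum H.+1 * ((\sum_(a <= d < b) w d) / H%:R +
       2 * \sum_(1 <= h < H.+1) C h / h%:R).
  have -> : \sum_(a <= d < b) w d * (32 / H%:R * fejer_mean H (y d)) =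
     32 / H%:R * \sum_(1 <= K < H.+1) (\sum_(a <= d < b) w d * fejer K (y d)) / K%:R ^+ 2.
    rewrite mulr_sumr; under [RHS]eq_bigr do rewrite mulrA mulr_sumr mulr_suml.
    rewrite exchange_big /=; apply: eq_bigr => d _; rewrite /fejer_mean !mulr_sumr.
    by apply: eq_bigr => K _; ring.
  have -> : 32 * harmonic_sum H.+1 * ((\sum_(a <= d < b) w d) / H%:R +
       2 * \sum_(1 <= h < H.+1) C h / h%:R) =
     32 / H%:R * \sum_(1 <= K < H.+1) K%:R^-1 * ((\sum_(a <= d < b) w d) +
       2 * \sum_(1 <= h < H.+1) C h / h%:R * H%:R).
    rewrite -!mulr_suml -/(harmonic_sum _); field; exact: lt0r_neq0.
  apply: ler_wpM2l; first by rewrite divr_ge0 // ltW.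
  rewrite [leLHS]big_nat [leRHS]big_nat; apply: ler_sum => K KH; have /andP[K1 _] := KH.
  have KR0 : 0 < K%:R :> R by rewrite ltr0n.
  rewrite ler_pdivrMr ?exprn_gt0 //.
  have -> : forall z : R, K%:R^-1 * z * K%:R ^+ 2 = K%:R * z.
    by move=> z; field; exact: lt0r_neq0.
  apply: le_trans (fejC _ KH) _; rewrite CW ler_wpM2l ?(ltW KR0) // lerD2l ler_wpM2l //.
  rewrite !big_nat; apply: ler_sum => j /andP[j1 jH].
  have j0 : 0 < j%:R :> R by rewrite ltr0n.
  by rewrite mulrAC ler_pdivlMr // ler_wpM2l // ler_nat.
have E1 : `|\sum_(1 <= h < H.+1) S h / (pi * h%:R)| <= \sum_(1 <= h < H.+1) `|S h| / h%:R.
  rewrite (le_trans (ler_norm_sum _ _ _)) // !big_nat; apply: ler_sum => h /andP[h1 _].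
  have h0 : 0 < h%:R :> R by rewrite ltr0n.
  rewrite normrM ler_wpM2l // ger0_norm ?invr_ge0 ?mulr_ge0 ?(ltW pi0) //.
  by rewrite lef_pV2 ?posrE ?mulr_gt0 // ler_peMl //; lra.
move: (le_trans main E2) E1; rewrite -/C.
move: (\sum_(a <= d < b) w d * saw (y d)) (\sum_(1 <= h < H.+1) S h / _) => p q h1 h2.
have := ler_normD (p + q) (- q); rewrite addrK normrN.
by move: h1 h2; rewrite -/(S _); lra.
Qed.

End SawtoothSum.

(** * Möbius function and Vaughan's identity *)

Section Moebius.
Variable R : realType.

(** [primes 0] is empty, so the value at 0 is 1; all sums with this coefficient start at a positive
    index. *)
Definition moebius (n : nat) : R := \prod_(p <- primes n) (if logn p n == 1%N then -1 else 0).

Lemma moebius_abs n : `|moebius n| <= 1.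
Proof.
rewrite /moebius; elim/big_rec: _ => [|p y _ IH]; first by rewrite normr1.
by rewrite normrM; case: ifP => _; rewrite ?normrN ?normr1 ?normr0 ?mul1r ?mul0r.
Qed.

Lemma moebiusM_prime p n : prime p -> (0 < n)%N ->
  moebius (p * n) = if (p %| n)%N then 0 else - moebius n.
Proof.
move=> pp n0; have p0 := prime_gt0 pp.
have ppn : p \in primes (p * n) by rewrite mem_primes pp muln_gt0 p0 n0 dvdn_mulr.
have lp : logn p (p * n) = (logn p n).+1 by rewrite lognM // logn_prime // eqxx.
rewrite /moebius (bigD1_seq p) ?primes_uniq //= lp eqSS.
case: ifPn => [l0|l0]; last first.
  by rewrite mul0r; case: ifPn => // pn; move: l0; rewrite lognE pp n0 (negPf pn).
have pn : ~~ (p %| n)%N by move: l0; rewrite lognE pp n0 /=; case: (p %| n)%N.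
rewrite (negPf pn) mulN1r; congr (- _).
have perm : perm_eq [seq q <- primes (p * n) | q != p] (primes n).
  apply: uniq_perm; rewrite ?filter_uniq ?primes_uniq // => q.
  rewrite mem_filter !mem_primes muln_gt0 p0 n0 /=.
  case: (boolP (prime q)) => //= [pq|_]; last by rewrite andbF.
  rewrite Euclid_dvdM // dvdn_prime2 //; case: eqVneq => //= ->.
  by rewrite (negPf pn).
rewrite -big_filter (perm_big _ perm) /=; apply: eq_big_seq => q.
rewrite mem_primes => /and3P[pq _ qn].
by rewrite lognM // logn_prime //; case: (eqVneq q p) => // E; case/negP: pn; move: qn; rewrite E.
Qed.

(** Let [p] be the least prime factor and [n = p * n']. The divisors of [n'] prime to [p] cancel
    against their multiples by [p]; multiplying by [p] a number already divisible by [p] gives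
    Möbius value 0. *)
Lemma sum_moebius n : (0 < n)%N ->
  \sum_(1 <= m < n.+1 | (m %| n)%N) moebius m = (n == 1%N)%:R.
Proof.
move=> n0; have [n1|n1] := eqVneq n 1%N.
  rewrite n1 big_mkcond big_nat1 /= /moebius /= big_nil //.
have n2 : (1 < n)%N by rewrite ltn_neqAle eq_sym n1.
pose p := pdiv n; have pp : prime p by apply: pdiv_prime.
have pn : (p %| n)%N by apply: pdiv_dvd.
have p0 := prime_gt0 pp.
pose n' := (n %/ p)%N; have nE : n = (p * n')%N by rewrite mulnC divnK.
have n'0 : (0 < n')%N by rewrite divn_gt0 // dvdn_leq.
rewrite (bigID (fun m => (p %| m)%N)) /=.
have -> : \sum_(1 <= m < n.+1 | (m %| n)%N && (p %| m)%N) moebius m =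
   \sum_(1 <= m < n'.+1 | (m %| n')%N) moebius (p * m).
  rewrite [LHS]big_nat_cond [RHS]big_nat_cond.
  rewrite -[LHS]big_filter -[RHS]big_filter -(big_map (muln p) xpredT moebius) /=.
  apply: perm_big; apply: uniq_perm; rewrite ?filter_uniq ?iota_uniq //.
    rewrite map_inj_uniq ?filter_uniq ?iota_uniq // => i j /eqP.
    by rewrite eqn_pmul2l // => /eqP.
  move=> m; rewrite mem_filter mem_index_iota; apply/idP/mapP.
    move=> /andP[/andP[/andP[m1 mn] /andP[dmn /dvdnP[k mk]]] _].
    exists k; last by rewrite mulnC.
    rewrite mem_filter mem_index_iota.
    have k0 : (0 < k)%N by move: m1; rewrite mk muln_gt0 => /andP[].
    have dk : (k %| n')%N by move: dmn; rewrite nE mk mulnC dvdn_pmul2l.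
    by rewrite k0 dk ltnS (dvdn_leq n'0 dk).
  move=> [k]; rewrite mem_filter mem_index_iota => /andP[/andP[/andP[k1 kn] dk] _ ->].
  have dd : (p * k %| n)%N by rewrite nE dvdn_pmul2l.
  have pk : (0 < p * k)%N by rewrite muln_gt0 p0.
  by rewrite pk dd dvdn_mulr // ltnS (dvdn_leq n0 dd).
have -> : \sum_(1 <= m < n.+1 | (m %| n)%N && ~~ (p %| m)%N) moebius m =
   \sum_(1 <= m < n'.+1 | (m %| n')%N && ~~ (p %| m)%N) moebius m.
  rewrite (big_cat_nat (n := n'.+1)) //=; last by rewrite ltnS leq_div.
  rewrite [X in _ + X]big_nat_cond [X in _ + X]big1 ?addr0; last first.
    move=> m /andP[/andP[nm mn] /andP[dm pm]]; exfalso.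
    have : (m %| n')%N by move: dm; rewrite nE Gauss_dvdr // coprime_sym prime_coprime.
    by move=> /(dvdn_leq n'0); rewrite leqNgt nm.
  apply: eq_bigl => m; apply: andb_id2r => pm.
  by rewrite nE Gauss_dvdr // coprime_sym prime_coprime.
rewrite (bigID (fun m => (p %| m)%N)) /= [X in X + _ + _]big_nat_cond big1 ?add0r.
  rewrite -big_split /= big_nat_cond big1 // => m /andP[/andP[m1 _] /andP[_ pm]].
  by rewrite moebiusM_prime // (negPf pm) addNr.
by move=> m /andP[/andP[m1 _] /andP[_ pm]]; rewrite moebiusM_prime // pm.
Qed.

(* Passing from [n] to [p * n] adds exactly one prime power to the divisors of [n]. *)
Lemma sum_vonMangoldt n : (0 < n)%N ->
  \sum_(1 <= c < n.+1 | (c %| n)%N) vonMangoldt R c = ln n%:R.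
Proof.
elim/ltn_ind: n => n IH n0; have [n1|n1] := eqVneq n 1%N.
  by rewrite n1 big_mkcond big_nat1 /= /vonMangoldt ln1.
have n2 : (1 < n)%N by rewrite ltn_neqAle eq_sym n1.
pose p := pdiv n; have pp : prime p by apply: pdiv_prime.
have pn : (p %| n)%N by apply: pdiv_dvd.
have p0 := prime_gt0 pp.
pose n' := (n %/ p)%N; have nE : n = (p * n')%N by rewrite mulnC divnK.
have n'0 : (0 < n')%N by rewrite divn_gt0 // dvdn_leq.
have n'n : (n' < n)%N by rewrite ltn_Pdiv // prime_gt1.
pose q := (p ^ logn p n)%N.
have l0 : (0 < logn p n)%N by rewrite logn_gt0 mem_primes pp n0.
have q_n : (q %| n)%N by apply: pfactor_dvdnn.
have q_n' : ~~ (q %| n')%N.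
  by rewrite pfactor_dvdn // nE lognM // logn_prime // eqxx addSn add0n ltnn.
have q0 : (0 < q)%N by rewrite expn_gt0 p0.
rewrite (bigID (fun c => (c %| n')%N)) /=.
have -> : \sum_(1 <= c < n.+1 | (c %| n)%N && (c %| n')%N) vonMangoldt R c = ln n'%:R.
  rewrite -IH // (big_cat_nat (n := n'.+1)) //=; last exact: ltnW.
  rewrite [X in _ + X]big_nat_cond [X in _ + X]big1 ?addr0; last first.
    by move=> m /andP[/andP[nm _] /andP[_ /(dvdn_leq n'0)]]; rewrite leqNgt nm.
  apply: eq_bigl => m; case: (boolP (m %| n')%N); rewrite ?andbF // => dm.
  by rewrite nE dvdn_mull.
rewrite -[X in _ + X]big_filter (bigD1_seq q) ?filter_uniq ?iota_uniq //=; last first.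
  by rewrite mem_filter q_n q_n' mem_index_iota q0 ltnS dvdn_leq.
rewrite [X in _ + (_ + X)]big1_seq ?addr0.
  rewrite /q vonMangoldtX // nE natrM lnM ?posrE ?ltr0n //.
  by rewrite addrC.
move=> c /andP[cq]; rewrite mem_filter => /andP[/andP[cdn cdn'] _].
apply: vonMangoldt0 => r k rp k0 cE.
have rE : r = p.
  apply/eqP; apply: contraR cdn' => rp'.
  move: cdn; rewrite nE cE Gauss_dvdr // coprimeXl // prime_coprime //.
  by rewrite dvdn_prime2.
move: cdn cdn' cq; rewrite cE rE /q !pfactor_dvdn // nE lognM // logn_prime // eqxx add1n.
rewrite -ltnNge => k1 k2; have -> : k = (logn p n').+1 by apply/eqP; rewrite eqn_leq k1 k2.
by rewrite eqxx.
Qed.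

End Moebius.

Section Vaughan.
Variable R : realType.

(** Because [F] vanishes from [Z] on, all variables of a convolution can run up to the common bound
    [Z], and no range has to be divided when variables are multiplied. *)
Lemma sum_multiples (Z m : nat) (F : nat -> R) : (0 < m)%N ->
  (forall n, (Z <= n)%N -> F n = 0) ->
  \sum_(1 <= j < Z) F (m * j)%N = \sum_(1 <= n < Z | (m %| n)%N) F n.
Proof.
move=> m0 FZ; rewrite [LHS](bigID (fun j => (m * j < Z)%N)) /= [X in _ + X]big1 ?addr0; last first.
  by move=> j; rewrite -leqNgt => /FZ.
rewrite -[LHS]big_filter -[RHS]big_filter -(big_map (muln m) xpredT F) /=.
apply: perm_big; apply: uniq_perm; rewrite ?filter_uniq ?iota_uniq //.
  rewrite map_inj_uniq ?filter_uniq ?iota_uniq // => i j /eqP.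
  by rewrite eqn_pmul2l // => /eqP.
move=> n; rewrite mem_filter mem_index_iota; apply/mapP/idP.
  move=> [k]; rewrite mem_filter mem_index_iota => /andP[mk /andP[k1 _]] ->.
  by rewrite dvdn_mulr // muln_gt0 m0 k1.
move=> /andP[/dvdnP[k nE] /andP[n1 nZ]]; exists k; last by rewrite mulnC.
rewrite mem_filter mem_index_iota mulnC -nE nZ /=; move: n1; rewrite nE muln_gt0 => /andP[-> _] /=.
by apply: leq_ltn_trans nZ; rewrite nE leq_pmulr.
Qed.

Lemma sum_divisors (Z : nat) (G : nat -> nat -> R) :
  (forall m n, (Z <= n)%N -> G m n = 0) ->
  \sum_(1 <= m < Z) \sum_(1 <= j < Z) G m (m * j)%N =
  \sum_(1 <= n < Z) \sum_(1 <= m < n.+1 | (m %| n)%N) G m n.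
Proof.
move=> GZ; transitivity (\sum_(1 <= m < Z) \sum_(1 <= n < Z | (m %| n)%N) G m n).
  rewrite big_nat [RHS]big_nat; apply: eq_bigr => m /andP[m1 _].
  exact: (sum_multiples (F := G m) m1 (GZ m)).
under eq_bigr do rewrite big_mkcond /=.
rewrite exchange_big /= big_nat [RHS]big_nat; apply: eq_bigr => n /andP[n1 nZ].
rewrite -big_mkcond /= (big_cat_nat (n := n.+1)) //=.
rewrite [X in _ + X]big_nat_cond [X in _ + X]big1 ?addr0 // => m /andP[/andP[nm _] /(dvdn_leq n1)].
by rewrite leqNgt nm.
Qed.

(** The Dirichlet convolution of 1 with the part of Lambda beyond [V]: one of the two coefficients
    of the bilinear term in Vaughan's identity. *)
Definition vonMangoldt_tail (V k : nat) : R :=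
  \sum_(1 <= c < k.+1 | (c %| k)%N) (if (V < c)%N then vonMangoldt R c else 0).

Lemma vonMangoldt_tail_small V k : (k <= V)%N -> vonMangoldt_tail V k = 0.
Proof.
move=> kV; rewrite /vonMangoldt_tail big_nat_cond big1 // => c /andP[/andP[_ ck] _].
by case: ifP => // Vc; exfalso; lia.
Qed.

Lemma vonMangoldt_tail_bound V k : (0 < k)%N -> 0 <= vonMangoldt_tail V k <= ln k%:R.
Proof.
move=> k0; apply/andP; split.
  by apply: sumr_ge0 => c _; case: ifP => // _; apply: vonMangoldt_ge0.
rewrite -sum_vonMangoldt //; apply: ler_sum => c _.
by case: ifP => // _; apply: vonMangoldt_ge0.
Qed.

Lemma vonMangoldt_tailE V k : (0 < k)%N -> vonMangoldt_tail V k =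
  ln k%:R - \sum_(1 <= c < k.+1 | (c %| k)%N) (if (c <= V)%N then vonMangoldt R c else 0).
Proof.
move=> k0; rewrite -sum_vonMangoldt // -sumrB; apply: eq_bigr => c _.
by rewrite ltnNge; case: (c <= V)%N; rewrite /= ?subrr ?subr0.
Qed.

Variables (Z V : nat) (F : nat -> R).
Hypothesis FZ : forall n, (Z <= n)%N -> F n = 0.
Hypothesis FV : forall n, (n <= V)%N -> F n = 0.

Let FZm m n : (0 < m)%N -> (Z <= n)%N -> F (m * n)%N = 0.
Proof. by move=> m0 Zn; apply: FZ; apply: leq_trans Zn _; rewrite leq_pmull. Qed.

Let sum_conv (g : nat -> R) m : (0 < m)%N ->
  \sum_(1 <= k < Z) (\sum_(1 <= c < k.+1 | (c %| k)%N) g c) * F (m * k)%N =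
  \sum_(1 <= c < Z) g c * \sum_(1 <= j < Z) F (m * c * j)%N.
Proof.
move=> m0; transitivity (\sum_(1 <= c < Z) \sum_(1 <= j < Z) g c * F (m * (c * j))%N); last first.
  by apply: eq_bigr => c _; rewrite mulr_sumr; apply: eq_bigr => j _; rewrite mulnA.
rewrite (@sum_divisors Z (fun c k => g c * F (m * k)%N)); last first.
  by move=> c n Zn; rewrite FZm ?mulr0.
by apply: eq_bigr => k _; rewrite mulr_suml.
Qed.

(** [F] vanishes up to [V], so Lambda can be cut to arguments above [V]. Convolving with the Möbius
    function and with 1 changes nothing, and grouping the 1 with the cut Lambda produces the
    tail. *)
Lemma vonMangoldt_convolution :
  \sum_(1 <= d < Z) vonMangoldt R d * F d =
  \sum_(1 <= m < Z) \sum_(1 <= k < Z) moebius R m * vonMangoldt_tail V k * F (m * k)%N.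
Proof.
pose g c := if (V < c)%N then vonMangoldt R c else 0.
have -> : \sum_(1 <= m < Z) \sum_(1 <= k < Z) moebius R m * vonMangoldt_tail V k * F (m * k)%N =
  \sum_(1 <= m < Z) \sum_(1 <= c < Z) \sum_(1 <= j < Z) moebius R m * g c * F (c * (m * j))%N.
  rewrite big_nat [RHS]big_nat; apply: eq_bigr => m /andP[m1 _].
  under eq_bigr do rewrite -mulrA.
  rewrite -mulr_sumr (sum_conv g) // mulr_sumr; apply: eq_bigr => c _.
  rewrite mulrA mulr_sumr; apply: eq_bigr => j _; congr (_ * F _); lia.
rewrite exchange_big /= big_nat [RHS]big_nat; apply: eq_bigr => c /andP[c1 cZ].
transitivity (g c * F c).
  rewrite /g; case: ltnP => // cV; rewrite FV //; ring.
rewrite (@sum_divisors Z (fun m n => moebius R m * g c * F (c * n)%N)); last first.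
  by move=> m n Zn; rewrite FZm ?mulr0.
rewrite (big_cat_nat (n := 2)) //=; last by apply: leq_ltn_trans cZ.
rewrite big_nat1 [X in _ + X]big_nat [X in _ + X]big1 ?addr0.
  under eq_bigr do rewrite -mulrA.
  by rewrite -mulr_suml sum_moebius // mul1r muln1.
move=> n /andP[n2 _]; under eq_bigr do rewrite -mulrA.
by rewrite -mulr_suml sum_moebius ?(ltnW n2) // gtn_eqF // mul0r.
Qed.

(** For [m <= U] the tail is replaced by [ln] minus the convolution of 1 with Lambda up to [V],
    which leaves smooth inner sums. The usual fourth term, over [d <= V], is absent because [F]
    vanishes there. *)
Lemma vaughan U : (U < Z)%N -> (V < Z)%N ->
  \sum_(1 <= d < Z) vonMangoldt R d * F d =
    \sum_(1 <= m < U.+1) moebius R m * \sum_(1 <= k < Z) ln k%:R * F (m * k)%N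
  - \sum_(1 <= m < U.+1) \sum_(1 <= c < V.+1)
      moebius R m * vonMangoldt R c * \sum_(1 <= j < Z) F (m * c * j)%N
  + \sum_(U.+1 <= m < Z) \sum_(1 <= k < Z) moebius R m * vonMangoldt_tail V k * F (m * k)%N.
Proof.
move=> UZ VZ; rewrite vonMangoldt_convolution (big_cat_nat (n := U.+1)) //=; congr (_ + _).
rewrite -sumrB big_nat [RHS]big_nat; apply: eq_bigr => m /andP[m1 _].
pose g c := if (c <= V)%N then vonMangoldt R c else 0.
have -> : \sum_(1 <= c < V.+1) moebius R m * vonMangoldt R c * \sum_(1 <= j < Z) F (m * c * j)%N =
  moebius R m * \sum_(1 <= c < Z) g c * \sum_(1 <= j < Z) F (m * c * j)%N.
  rewrite mulr_sumr [RHS](big_cat_nat (n := V.+1)) //=.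
  rewrite [X in _ + X]big_nat [X in _ + X]big1 ?addr0.
    rewrite big_nat [RHS]big_nat; apply: eq_bigr => c /andP[_ cV].
    by rewrite /g -ltnS cV mulrA.
  by move=> c /andP[Vc _]; rewrite /g leqNgt Vc mul0r mulr0.
rewrite -sum_conv // -mulrBr -sumrB mulr_sumr big_nat [RHS]big_nat.
apply: eq_bigr => k /andP[k1 _]; rewrite vonMangoldt_tailE // -/(g _); ring.
Qed.

End Vaughan.

(** * Counting and Cauchy-Schwarz over cells *)

Lemma harmonic_sum_le (R : realType) (n : nat) : (0 < n)%N -> harmonic_sum R n.+1 <= 1 + ln n%:R.
Proof.
case: n => // n _; elim: n => [|n IH]; first by rewrite /harmonic_sum big_nat1 invr1 ln1 addr0.
rewrite /harmonic_sum big_nat_recr //= -/(harmonic_sum R n.+2).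
have n0 : 0 < n.+1%:R :> R by rewrite ltr0n.
have n1 : 0 < n.+2%:R :> R by rewrite ltr0n.
have := @le_ln1Dx R (- n.+2%:R^-1).
have -> : 1 + - n.+2%:R^-1 = n.+1%:R / n.+2%:R :> R.
  by rewrite -[n.+1%:R](addrK 1) natr1; field; rewrite gt_eqF.
rewrite ltrN2 invf_lt1 // ltr1n => /(_ isT).
rewrite ln_div ?posrE //; move: IH; rewrite /harmonic_sum.
move: (n.+2%:R^-1) (ln _) (ln _) (\sum_(1 <= k < n.+2) _) => p q r s; lra.
Qed.

Lemma cauchy_schwarz_nat (R : realType) (m n : nat) (a b : nat -> R) :
  (\sum_(m <= i < n) a i * b i) ^+ 2 <= (\sum_(m <= i < n) a i ^+ 2) * (\sum_(m <= i < n) b i ^+ 2).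
Proof.
have : 0 <= \sum_(m <= i < n) \sum_(m <= j < n) (a i * b j - a j * b i) ^+ 2.
  by apply: sumr_ge0 => i _; apply: sumr_ge0 => j _; apply: sqr_ge0.
have -> : \sum_(m <= i < n) \sum_(m <= j < n) (a i * b j - a j * b i) ^+ 2 =
  (\sum_(m <= i < n) a i ^+ 2) * (\sum_(m <= j < n) b j ^+ 2) +
  (\sum_(m <= i < n) b i ^+ 2) * (\sum_(m <= j < n) a j ^+ 2) -
  2 * ((\sum_(m <= i < n) a i * b i) * (\sum_(m <= j < n) a j * b j)).
  rewrite !big_distrl /= mulr_sumr -big_split -sumrB /=; apply: eq_bigr => i _.
  rewrite !mulr_sumr -big_split -sumrB /=; apply: eq_bigr => j _; ring.
by rewrite expr2; lra.
Qed.

Lemma sqr_sum_le_card (R : realType) (K : nat) (b : 'I_K -> R) :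
  (\sum_k b k) ^+ 2 <= K%:R * \sum_k b k ^+ 2.
Proof.
have : 0 <= \sum_(i < K) \sum_(j < K) (b i - b j) ^+ 2.
  by apply: sumr_ge0 => i _; apply: sumr_ge0 => j _; apply: sqr_ge0.
have -> : \sum_(i < K) \sum_(j < K) (b i - b j) ^+ 2 =
  \sum_(i < K) \sum_(j < K) b i ^+ 2 + \sum_(i < K) \sum_(j < K) b j ^+ 2 -
  2 * \sum_(i < K) \sum_(j < K) b i * b j.
  rewrite mulr_sumr -big_split -sumrB /=; apply: eq_bigr => i _.
  rewrite mulr_sumr -big_split -sumrB /=; apply: eq_bigr => j _; ring.
have E : \sum_(i < K) \sum_(j < K) b j ^+ 2 = K%:R * \sum_(j < K) b j ^+ 2.
  by rewrite sumr_const card_ord mulr_natl.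
have -> : \sum_(i < K) \sum_(j < K) b i ^+ 2 = K%:R * \sum_(j < K) b j ^+ 2.
  by rewrite exchange_big.
have -> : \sum_(i < K) \sum_(j < K) b i * b j = (\sum_i b i) * (\sum_j b j).
  by rewrite big_distrl /=; apply: eq_bigr => i _; rewrite mulr_sumr.
by rewrite E expr2; lra.
Qed.

(* Cauchy-Schwarz over [m], with the inner index set cut into [K] cells, so that only pairs
   of indices in a common cell survive. *)
Lemma cauchy_cells (R : realType) (I : finType) (K : nat) (kap : I -> 'I_K) (M1 M2 : nat)
    (a : nat -> R) (be : I -> nat -> R) (th : I -> nat -> R) :
  (\sum_(M1 <= m < M2) a m * \sum_p be p m * cos (th p m)) ^+ 2 <=
  (\sum_(M1 <= m < M2) a m ^+ 2) * (K%:R *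
    \sum_p \sum_(q | kap p == kap q)
      `|\sum_(M1 <= m < M2) be p m * be q m * cos (th p m - th q m)|).
Proof.
apply: le_trans (cauchy_schwarz_nat _ _ _ _) _.
apply: ler_wpM2l; first by apply: sumr_ge0 => m _; apply: sqr_ge0.
have cell m : (\sum_p be p m * cos (th p m)) ^+ 2 <=
    K%:R * \sum_p \sum_(q | kap p == kap q) be p m * be q m * cos (th p m - th q m).
  rewrite (partition_big kap xpredT) //=; apply: le_trans (sqr_sum_le_card _) _.
  apply: ler_wpM2l => //.
  rewrite [leRHS](partition_big kap xpredT) //=; apply: ler_sum => k _.
  set c := \sum_(i | kap i == k) _; pose s := \sum_(i | kap i == k) be i m * sin (th i m).
  (* Adding the square of the sine sum does the work of a complex modulus: [c^2 + s^2] expands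
     exactly into cosines of phase differences. *)
  apply: le_trans (_ : c ^+ 2 + s ^+ 2 <= _); first by rewrite lerDl sqr_ge0.
  rewrite le_eqVlt; apply/orP; left; apply/eqP.
  rewrite !expr2 /c /s !big_distrl /= -big_split /=; apply: eq_bigr => p /eqP pk.
  rewrite !mulr_sumr -big_split /= pk; apply: eq_big => [q|q _]; first by rewrite eq_sym.
  by rewrite cosB; ring.
apply: le_trans (ler_sum _ (fun m _ => cell m)) _.
rewrite -mulr_sumr ler_wpM2l // exchange_big /=; apply: ler_sum => p _.
rewrite exchange_big /=; apply: ler_sum => q _; exact: ler_norm.
Qed.

Section Counting.
Variable R : realType.

Lemma count_multiples (d X : nat) : (0 < d)%N ->
  \sum_(1 <= n < X) (d %| n)%N%:R <= X%:R / d%:R :> R.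
Proof.
move=> d0; pose F n : R := (n < X)%N%:R.
have -> : \sum_(1 <= n < X) (d %| n)%N%:R = \sum_(1 <= j < X) F (d * j)%N :> R.
  rewrite (@sum_multiples R) //; last by move=> n Xn; rewrite /F ltnNge Xn.
  rewrite [RHS]big_mkcond; apply: eq_big_nat => n /andP[_ nX].
  by rewrite /F nX; case: (d %| n)%N.
apply: (@le_trans _ _ (X %/ d)%:R); last first.
  by rewrite ler_pdivlMr ?ltr0n // -natrM ler_nat leq_divM.
have -> : (X %/ d)%:R = \sum_(1 <= j < (X %/ d).+1) (1 : R).
  by rewrite sumr_const_nat subn1.
have H j : F (d * j)%N = F (d * j)%N * (j < (X %/ d).+1)%N%:R.
  rewrite /F; have [dj|] := ltnP (d * j) X; last by rewrite mul0r.
  by rewrite ltnS leq_divRL // mulnC (ltnW dj) mulr1.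
have F1 j : F j <= 1 by rewrite /F; case: (j < X)%N.
have F0 j : 0 <= F j by [].
have [le|ge] := leqP X (X %/ d).+1.
  have [X1|X1] := leqP 1 X; last by rewrite big_geq ?sumr_ge0 // ltnW.
  rewrite [leRHS](big_cat_nat X1 le) /= -[leLHS]addr0 lerD //; last by apply: sumr_ge0.
  by apply: ler_sum => j _.
rewrite [leLHS](big_cat_nat (n := (X %/ d).+1)) //=; last exact: ltnW.
rewrite [X in _ + X]big_nat [X in _ + X]big1 ?addr0; first by apply: ler_sum.
by move=> j /andP[dj _]; rewrite H ltnNge dj mulr0.
Qed.

(** Bounding [gcdn h k] by the sum of all common divisors separates the two variables. *)
Lemma sum_gcd_le (X : nat) :
  \sum_(1 <= h < X) \sum_(1 <= k < X) (gcdn h k)%:R <= X%:R ^+ 2 * harmonic_sum R X.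
Proof.
apply: (@le_trans _ _ (\sum_(1 <= h < X) \sum_(1 <= k < X) \sum_(1 <= g < X)
    g%:R * ((g %| h)%N%:R * (g %| k)%N%:R))).
  rewrite [leLHS]big_nat [leRHS]big_nat; apply: ler_sum => h /andP[h1 hX].
  rewrite [leLHS]big_nat [leRHS]big_nat; apply: ler_sum => k /andP[k1 kX].
  rewrite (bigD1_seq (gcdn h k)) ?iota_uniq //=; last first.
    rewrite mem_index_iota gcdn_gt0 h1 /=; apply: leq_ltn_trans hX.
    by apply: dvdn_leq => //; apply: dvdn_gcdl.
  rewrite dvdn_gcdl dvdn_gcdr !mulr1 lerDl; apply: sumr_ge0 => g _.
  by rewrite !mulr_ge0.
have -> : \sum_(1 <= h < X) \sum_(1 <= k < X) \sum_(1 <= g < X)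
    g%:R * ((g %| h)%N%:R * (g %| k)%N%:R) =
  \sum_(1 <= g < X) g%:R * ((\sum_(1 <= h < X) (g %| h)%N%:R) * (\sum_(1 <= k < X) (g %| k)%N%:R)) :> R.
  under eq_bigr do rewrite exchange_big /=.
  rewrite exchange_big /=; apply: eq_bigr => g _; rewrite big_distrl mulr_sumr /=.
  by apply: eq_bigr => h _; rewrite !mulr_sumr.
rewrite /harmonic_sum mulr_sumr [leLHS]big_nat [leRHS]big_nat; apply: ler_sum => g /andP[g1 gX].
have g0 : 0 < g%:R :> R by rewrite ltr0n.
have S0 : 0 <= \sum_(1 <= h < X) (g %| h)%N%:R :> R by apply: sumr_ge0.
have -> : X%:R ^+ 2 / g%:R = g%:R * ((X%:R / g%:R) * (X%:R / g%:R)) :> R.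
  by field; rewrite gt_eqF.
by apply: ler_wpM2l; [exact: ltW | apply: ler_pM => //; apply: count_multiples].
Qed.


Lemma count_near (Z x r : nat) :
  \sum_(y < Z) (x - y + (y - x) <= r)%N%:R <= r.*2.+1%:R :> R.
Proof.
rewrite -(big_mkord xpredT (fun y => (x - y + (y - x) <= r)%N%:R)) -natr_sum ler_nat.
set P := fun y => (x - y + (y - x) <= r)%N.
have -> : (\sum_(0 <= y < Z) P y = \sum_(0 <= y < Z | P y) 1)%N.
  by rewrite [RHS]big_mkcond; apply: eq_bigr => y _; case: (P y).
rewrite sum1_count -size_filter -[leqRHS](size_iota (x - r) r.*2.+1).
apply: uniq_leq_size; first by rewrite filter_uniq // iota_uniq.
by move=> y; rewrite mem_filter mem_iota /P => /andP[h _]; lia.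
Qed.

(** If [tau x] counts the indices with value [x], a pair of values contributes [tau x * tau y <=
    (tau x ^ 2 + tau y ^ 2) / 2], and each [x] has at most [2 r + 1] neighbours. So closeness costs
    only this factor over equality. *)
Lemma count_close_pairs (I : finType) (v : I -> nat) (r : nat) :
  \sum_p \sum_q (v p - v q + (v q - v p) <= r)%N%:R <=
  r.*2.+1%:R * \sum_p \sum_q (v p == v q)%:R :> R.
Proof.
pose Z := (\max_p v p).+1; have vZ p : (v p < Z)%N by rewrite ltnS leq_bigmax.
pose tau (x : 'I_Z) : R := \sum_p (v p == x :> nat)%:R.
have tau0 x : 0 <= tau x by apply: sumr_ge0.
have expand (f : nat -> nat -> R) : \sum_p \sum_q f (v p) (v q) =
    \sum_(x < Z) \sum_(y < Z) tau x * tau y * f x y.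
  transitivity (\sum_p \sum_q \sum_(x < Z) \sum_(y < Z) (v p == x :> nat)%:R * (v q == y :> nat)%:R * f x y).
    apply: eq_bigr => p _; apply: eq_bigr => q _.
    rewrite (bigD1 (Ordinal (vZ p))) //= [X in _ + X]big1 ?addr0; last first.
      move=> x xp; rewrite big1 // => y _; have -> : (v p == x :> nat) = false; last by rewrite !mul0r.
      by apply: contra_neqF xp => /eqP vx; apply/val_inj.
    rewrite (bigD1 (Ordinal (vZ q))) //= [X in _ + X]big1 ?addr0; last first.
      move=> y yq; have -> : (v q == y :> nat) = false; last by rewrite mulr0 mul0r.
      by apply: contra_neqF yq => /eqP vx; apply/val_inj.
    by rewrite !eqxx !mul1r.
  under eq_bigr do rewrite exchange_big /=.
  rewrite exchange_big /=; apply: eq_bigr => x _.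
  under eq_bigr do rewrite exchange_big /=.
  rewrite exchange_big /=; apply: eq_bigr => y _.
  rewrite /tau [in RHS]big_distrl [in RHS]big_distrl /=; apply: eq_bigr => p _.
  by rewrite big_distrr big_distrl.
rewrite (expand (fun x y => (x - y + (y - x) <= r)%N%:R)).
rewrite (expand (fun x y => (x == y)%:R)).
have diag : \sum_(x < Z) \sum_(y < Z) tau x * tau y * (x == y :> nat)%:R = \sum_(x < Z) tau x ^+ 2.
  apply: eq_bigr => x _; rewrite (bigD1 x) //= big1 ?addr0; first by rewrite eqxx mulr1 expr2.
  by move=> y yx; rewrite (_ : (x == y :> nat) = false) ?mulr0 // eq_sym; apply: negbTE.
rewrite diag.
pose nr (x y : 'I_Z) : R := (x - y + (y - x) <= r)%N%:R.
have nr_sym x y : nr x y = nr y x by rewrite /nr addnC.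
have nr0 x y : 0 <= nr x y by [].
have near : \sum_(x < Z) \sum_(y < Z) tau x ^+ 2 * nr x y <= r.*2.+1%:R * \sum_(x < Z) tau x ^+ 2.
  rewrite mulr_sumr; apply: ler_sum => x _; rewrite -mulr_sumr mulrC.
  by apply: ler_wpM2r; [exact: sqr_ge0 | exact: count_near].
have near' : \sum_(x < Z) \sum_(y < Z) tau y ^+ 2 * nr x y =
    \sum_(x < Z) \sum_(y < Z) tau x ^+ 2 * nr x y.
  rewrite exchange_big /=; apply: eq_bigr => x _; apply: eq_bigr => y _; by rewrite nr_sym.
have : 2 * (\sum_(x < Z) \sum_(y < Z) tau x * tau y * nr x y) <=
    \sum_(x < Z) \sum_(y < Z) tau x ^+ 2 * nr x y + \sum_(x < Z) \sum_(y < Z) tau y ^+ 2 * nr x y.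
  rewrite mulr_sumr -big_split /=; apply: ler_sum => x _.
  rewrite mulr_sumr -big_split /=; apply: ler_sum => y _.
  rewrite -mulrDl mulrA; apply: ler_wpM2r => //.
  have := sqr_ge0 (tau x - tau y); rewrite sqrrB; lra.
rewrite near' -/nr; move: near; lra.
Qed.

(** For fixed [h] and [k], [h * j = k * l] forces [h / gcdn h k] to divide [l], and [l] determines
    [j]. This leaves at most [3 N / H * gcdn h k] pairs, and [sum_gcd_le] averages the gcd. *)
Lemma count_equal_products (H N : nat) : (0 < H)%N -> (0 < N)%N ->
  \sum_(p : 'I_H * 'I_(2 * N)) \sum_(q : 'I_H * 'I_(2 * N))
     ((H + p.1) * p.2.+1 == (H + q.1) * q.2.+1)%N%:R <=
  12 * H%:R * N%:R * harmonic_sum R (2 * H) :> R.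
Proof.
move=> H0 N0.
have HR0 : 0 < H%:R :> R by rewrite ltr0n.
have NR0 : 0 < N%:R :> R by rewrite ltr0n.
pose G h k : R := (gcdn h k)%:R.
have inner (h k : nat) : (0 < h)%N -> (H <= h)%N ->
    \sum_(j < 2 * N) \sum_(l < 2 * N) (h * j.+1 == k * l.+1)%N%:R <= 3 * N%:R / H%:R * G h k.
  move=> h0 Hh; have g0 : (0 < gcdn h k)%N by rewrite gcdn_gt0 h0.
  pose d := (h %/ gcdn h k)%N.
  have dE : (d * gcdn h k = h)%N by rewrite divnK // dvdn_gcdl.
  have d0 : (0 < d)%N by move: h0; rewrite -dE muln_gt0 => /andP[].
  apply: (@le_trans _ _ (\sum_(l < 2 * N) (d %| l.+1)%N%:R)).
    rewrite exchange_big /=; apply: ler_sum => l _.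
    have [dl|dl] := boolP (d %| l.+1)%N; last first.
      rewrite big1 // => j _; case: eqP => // E; case/negP: dl.
      have : (h %| k * l.+1)%N by rewrite -E dvdn_mulr.
      have kE : (k %/ gcdn h k * gcdn h k = k)%N by rewrite divnK // dvdn_gcdr.
      have cop : coprime d (k %/ gcdn h k).
        by rewrite /coprime -(@eqn_pmul2r (gcdn h k)) // muln_gcdl dE kE mul1n.
      by rewrite -{1}dE -{2}kE mulnAC dvdn_pmul2r // Gauss_dvdr.
    have [[j jE]|none] := pselect (exists j : 'I_(2 * N), (h * j.+1 == k * l.+1)%N).
      rewrite (bigD1 j) //= jE big1 ?addr0 // => i ij.
      rewrite -(eqP jE) eqn_pmul2l //; case: eqP => // - [E].
      by case/negP: ij; apply/eqP/val_inj.
    rewrite big1 // => j _; case: (boolP (_ == _)%N) => // E; case: none; by exists j.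
  have -> : \sum_(l < 2 * N) (d %| l.+1)%N%:R = \sum_(1 <= n < (2 * N).+1) (d %| n)%N%:R :> R.
    by rewrite big_add1 /= big_mkord.
  apply: le_trans (count_multiples _ d0) _.
  have dR : d%:R * G h k = h%:R by rewrite /G -natrM dE.
  have dR0 : 0 < d%:R :> R by rewrite ltr0n.
  rewrite ler_pdivrMr //.
  have -> : 3 * N%:R / H%:R * G h k * d%:R = 3 * N%:R * (h%:R / H%:R) by rewrite -dR; ring.
  have l1 : (2 * N).+1%:R <= 3 * N%:R :> R by rewrite -natrM ler_nat; lia.
  have l2 : 1 <= h%:R / H%:R :> R by rewrite ler_pdivlMr // mul1r ler_nat.
  by apply: le_trans l1 _; rewrite ler_peMr // mulr_ge0.
rewrite -(pair_bigA _ (fun (i : 'I_H) (j : 'I_(2 * N)) => \sum_(q : 'I_H * 'I_(2 * N))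
     ((H + i) * j.+1 == (H + q.1) * q.2.+1)%N%:R)) /=.
have -> : \sum_(i < H) \sum_(j < 2 * N) \sum_(q : 'I_H * 'I_(2 * N))
     ((H + i) * j.+1 == (H + q.1) * q.2.+1)%N%:R =
   \sum_(i < H) \sum_(k < H) \sum_(j < 2 * N) \sum_(l < 2 * N)
     ((H + i) * j.+1 == (H + k) * l.+1)%N%:R :> R.
  apply: eq_bigr => i _; rewrite exchange_big /= -(pair_bigA _ (fun (k : 'I_H) (l : 'I_(2 * N)) => \sum_(j < 2 * N)
     ((H + i) * j.+1 == (H + k) * l.+1)%N%:R)) /=.
  by apply: eq_bigr => k _; rewrite exchange_big.
apply: (@le_trans _ _ (\sum_(i < H) \sum_(k < H) 3 * N%:R / H%:R * G (H + i)%N (H + k)%N)).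
  apply: ler_sum => i _; apply: ler_sum => k _; apply: inner; lia.
have -> : \sum_(i < H) \sum_(k < H) 3 * N%:R / H%:R * G (H + i)%N (H + k)%N =
   3 * N%:R / H%:R * \sum_(i < H) \sum_(k < H) G (H + i)%N (H + k)%N.
  by rewrite mulr_sumr; apply: eq_bigr => i _; rewrite mulr_sumr.
have : \sum_(i < H) \sum_(k < H) G (H + i)%N (H + k)%N <=
    \sum_(1 <= h < 2 * H) \sum_(1 <= k < 2 * H) G h k.
  have drop (f : nat -> R) : (forall n, 0 <= f n) ->
      \sum_(i < H) f (H + i)%N <= \sum_(1 <= h < 2 * H) f h.
    move=> f0; rewrite [leRHS](big_cat_nat (n := H)) //=; last by lia.
    have -> : \sum_(H <= i < 2 * H) f i = \sum_(i < H) f (H + i)%N.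
      rewrite -{1}[H]add0n big_addn mul2n -addnn addnK big_mkord.
      by apply: eq_bigr => i _; rewrite addnC.
    by rewrite lerDr sumr_ge0.
  apply: le_trans (drop (fun h => \sum_(1 <= k < 2 * H) G h k) _); last by move=> h; apply: sumr_ge0.
  by apply: ler_sum => i _; apply: drop.
move=> /le_trans /(_ (sum_gcd_le (2 * H))) S.
apply: le_trans (ler_wpM2l _ S) _; first by rewrite divr_ge0 ?mulr_ge0 // ltW.
rewrite natrM le_eqVlt; apply/orP; left; apply/eqP.
by field; rewrite gt_eqF.
Qed.

End Counting.

(** * Second differences of the phases x h / (k + dl) *)

Lemma ler_of_sqr (R : realType) (x y : R) : 0 <= y -> x ^+ 2 <= y ^+ 2 -> x <= y.
Proof.
by move=> y0 xy; rewrite leNgt; apply/negP => yx; have := ltr_pM y0 y0 yx yx; rewrite -!expr2 ltNge xy.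
Qed.

(** As [sqrt 500 < 23], the term [14 / sqrt lam] of the test becomes [322 / sqrt mu]. The bound
    [mu <= 144] absorbs the additive 3 into [36 / sqrt mu], and [322 + 36 = 358]. *)
Lemma second_difference_sqrt (R : realType) (th : nat -> R) (mu Q : R) (a b : nat) :
  0 < mu <= 144 -> (b - a)%:R <= Q ->
  (forall n, (a <= n)%N -> (n.+1 < b)%N ->
    mu / 500 <= (th n.+2 - th n.+1) - (th n.+1 - th n) <= mu) ->
  `|\sum_(a <= n < b) cos (th n)| <= 358 * (Q * Num.sqrt mu + 2 / Num.sqrt mu).
Proof.
move=> /andP[mu0 mu1] bQ Hth; have lam0 : 0 < mu / 500 by lra.
have lmu : mu / 500 <= mu by lra.
apply: le_trans (second_difference_test lam0 lmu Hth) _.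
have muE : mu = 500 * (mu / 500) by lra.
move: (mu / 500) lam0 muE {lmu Hth} => nu nu0 muE.
set s := Num.sqrt mu; have s0 : 0 < s by rewrite sqrtr_gt0.
have s2 : s * s = mu by rewrite -expr2 sqr_sqrtr // ltW.
set q := Num.sqrt nu; have q0 : 0 < q by rewrite sqrtr_gt0.
have q2 : q * q = nu by rewrite -expr2 sqr_sqrtr // ltW.
have s12 : s <= 12.
  by rewrite leNgt; apply/negP => s12; have c : 0 <= 12 :> R by []; have := ltr_pM c c s12 s12; lra.
have sq : s <= 23 * q.
  rewrite leNgt; apply/negP => qs; have q23 : 0 <= 23 * q by lra.
  by have := ltr_pM q23 q23 qs qs; lra.
have b1 : 14 / q + 3 <= 358 / s.
  have : 14 / q <= 322 / s by rewrite ler_pdivrMr // mulrAC ler_pdivlMr //; lra.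
  have : 3 <= 36 / s by rewrite ler_pdivlMr //; lra.
  lra.
have b2 : (b - a)%:R * mu + 2 <= Q * mu + 2 by rewrite lerD2r ler_wpM2r // ltW.
have iq : 0 < q^-1 by rewrite invr_gt0.
have c1 : 0 <= 14 / q + 3 by lra.
have c2 : 0 <= (b - a)%:R * mu + 2 by rewrite addr_ge0 // mulr_ge0 // ltW.
apply: le_trans (ler_pM c2 c1 b2 b1) _.
have -> : (Q * mu + 2) * (358 / s) = 358 * (Q * (mu / s) + 2 / s) by ring.
by rewrite -{1}s2 mulfK // gt_eqF.
Qed.

Lemma inv_second_difference (R : realType) (A : R) : 0 < A ->
  ((A + 2)^-1 - (A + 1)^-1) - ((A + 1)^-1 - A^-1) = 2 / (A * (A + 1) * (A + 2)).
Proof.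
move=> A0; have A1 : 0 < A + 1 by lra.
have A2 : 0 < A + 2 by lra.
by field; rewrite !gt_eqF.
Qed.

Section Phase.
Variable R : realType.
Implicit Types (x dl ph L P : R) (h k m n : nat).

Definition phase x dl h k : R := 2 * pi * (x * h%:R / (k%:R + dl)).

(** Rescaling turns [dl] into the smaller shift [dl / r] of the inner variable, and second
    differences reduce to those of [1 / A]. *)
Lemma phaseM x dl h r n : (0 < r)%N ->
  phase x dl h (r * n) = 2 * pi * x * (h%:R / r%:R) * (n%:R + dl / r%:R)^-1.
Proof.
move=> r0; have rR : 0 < r%:R :> R by rewrite ltr0n.
have -> : n%:R + dl / r%:R = ((r * n)%:R + dl) / r%:R.
  by rewrite natrM; field; rewrite gt_eqF.
rewrite /phase invf_div; move: (_ + dl)^-1 (pi : R) => y p.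
by field; rewrite gt_eqF.
Qed.

Lemma phase_second_difference x dl h r n : (0 < r)%N -> 0 <= dl -> (0 < n)%N ->
  (phase x dl h (r * n.+2) - phase x dl h (r * n.+1)) -
  (phase x dl h (r * n.+1) - phase x dl h (r * n)) =
  4 * pi * x * ((h%:R / r%:R) / ((n%:R + dl / r%:R) * (n%:R + dl / r%:R + 1) * (n%:R + dl / r%:R + 2))).
Proof.
move=> r0 dl0 n0; rewrite !phaseM //; set A := n%:R + dl / r%:R.
have A0 : 0 < A by rewrite ltr_pwDl ?ltr0n // divr_ge0.
have -> : n.+2%:R + dl / r%:R = A + 2 by rewrite /A -!natr1; ring.
have -> : n.+1%:R + dl / r%:R = A + 1 by rewrite /A -!natr1; ring.
have := inv_second_difference A0; set D := A * _ * _.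
move: (A + 2)^-1 (A + 1)^-1 A^-1 D^-1 (h%:R / r%:R) (pi : R) => u v w D' c p E.
transitivity (2 * p * x * c * (u - v - (v - w))); [ring | rewrite E; ring].
Qed.

Lemma cubic_bounds (A Q : R) : 3 / 2 <= Q -> Q <= A -> A <= 2 * Q + 1 ->
  Q ^+ 3 <= A * (A + 1) * (A + 2) <= 125 * Q ^+ 3.
Proof.
move=> Q1 QA AQ; have Q0 : 0 <= Q by lra.
have -> : 125 * Q ^+ 3 = (5 * Q) * (5 * Q) * (5 * Q) by ring.
rewrite !exprS expr0 mulr1 mulrA.
by apply/andP; split; (apply: ler_pM; [| |apply: ler_pM|]); rewrite ?mulr_ge0 //; lra.
Qed.

(** With [Q = P / r] the second difference is of order [mu = 4 pi x h r^2 / P^3]. Here [Q sqrt mu]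
    is of order [sqrt (x h / P)], at most [6 L^5] because [h L^9 <= 2 P], while
    [1 / sqrt mu <= L^6 / r] because [P <= L^10]. The bound [r <= L^4] keeps [mu] below 144. *)
Lemma type_I_inner x L dl ph P h r a b : 2 <= L -> x = L ^+ 19 -> 0 <= dl <= 1 ->
  L ^+ 9 <= 2 * P -> P <= L ^+ 10 -> (0 < h)%N -> h%:R * L ^+ 9 <= 2 * P ->
  (0 < r)%N -> r%:R <= L ^+ 4 ->
  (forall n, (a <= n < b)%N -> P <= (r * n)%:R < 2 * P) ->
  `|\sum_(a <= n < b) cos (phase x dl h (r * n) + ph)| <= 716 * (6 * L ^+ 5 + L ^+ 6 / r%:R).
Proof.
move=> L2 xE /andP[dl0 dl1] LP PL h0 hP r0 rL Hab.
have L0 : 0 < L by lra.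
have Ln k : 0 < L ^+ k by rewrite exprn_gt0.
have rR : 0 < r%:R :> R by rewrite ltr0n.
have hR : 1 <= h%:R :> R by rewrite ler1n.
have P0 : 0 < P by have := Ln 9%N; lra.
have pi2 := pi_ge2 R; have pi4 := pihalf_lt2 R.
have [ba|ab] := leqP b a.
  rewrite big_geq // normr0.
  have : 0 <= L ^+ 6 / r%:R by rewrite divr_ge0 // ltW.
  by have := Ln 5%N; lra.
pose Q := P / r%:R.
have L5 : 32 <= L ^+ 5.
  by have -> : 32 = 2 ^+ 5 :> R; [ring | rewrite ler_pXn2r ?nnegrE //; lra].
have Q1 : 3 / 2 <= Q.
  rewrite /Q ler_pdivlMr //; have : L ^+ 9 = L ^+ 5 * L ^+ 4 by rewrite -exprD.
  have : 32 * L ^+ 4 <= L ^+ 5 * L ^+ 4 by rewrite ler_wpM2r // ltW.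
  by have := Ln 4%N; lra.
have Qr : Q * r%:R = P by rewrite /Q divfK // gt_eqF.
have Hn n : (a <= n < b)%N -> Q <= n%:R < 2 * Q.
  move=> /Hab /andP[]; rewrite natrM -Qr [r%:R * _]mulrC mulrA ler_pM2r // ltr_pM2r //.
  by move=> -> ->.
pose mu := 4 * pi * x * (h%:R / r%:R) / Q ^+ 3.
have Q0 : 0 < Q by lra.
have x0 : 0 < x by rewrite xE.
have c0 : 0 < 4 * pi * x * (h%:R / r%:R).
  by rewrite !mulr_gt0 ?invr_gt0 ?pi_gt0 //; lra.
have Q3 : 0 < Q ^+ 3 by rewrite exprn_gt0.
have mu0 : 0 < mu by rewrite divr_gt0.
have muE : mu = 4 * pi * x * h%:R * r%:R ^+ 2 / P ^+ 3.
  by rewrite /mu -Qr; move: (pi : R) => p; field; rewrite !gt_eqF.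
have xh : x * h%:R <= 2 * L ^+ 10 * P.
  have -> : x * h%:R = L ^+ 10 * (h%:R * L ^+ 9) by rewrite xE; ring.
  have -> : 2 * L ^+ 10 * P = L ^+ 10 * (2 * P) by ring.
  by rewrite ler_wpM2l // ltW.
have pxh : 4 * pi * x * h%:R <= 32 * L ^+ 10 * P.
  have : pi * (x * h%:R) <= 4 * (x * h%:R) by rewrite ler_wpM2r ?mulr_ge0 ?ltW //; lra.
  by lra.
have mu1 : mu <= 144.
  rewrite muE ler_pdivrMr ?exprn_gt0 //.
  have r2 : r%:R ^+ 2 <= L ^+ 8.
    by have -> : L ^+ 8 = (L ^+ 4) ^+ 2; [rewrite -exprM | rewrite ler_pXn2r ?nnegrE // ltW].
  have pxh0 : 0 <= 4 * pi * x * h%:R by rewrite !mulr_ge0 ?pi_ge0 ?(ltW x0).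
  have := ler_pM pxh0 (sqr_ge0 _) pxh r2.
  have P2 : L ^+ 9 * L ^+ 9 <= 2 * P * (2 * P) by apply: ler_pM; rewrite ?(ltW (Ln _)).
  have := ler_wpM2r (ltW P0) P2.
  have -> : 32 * L ^+ 10 * P * L ^+ 8 = 32 * (L ^+ 9 * L ^+ 9 * P) by ring.
  have -> : 2 * P * (2 * P) * P = 4 * P ^+ 3 by ring.
  by have := exprn_gt0 3 P0; lra.
have bQ : (b - a)%:R <= 2 * Q.
  have ib : (a <= b.-1 < b)%N by clear - ab; lia.
  have ia : (a <= a < b)%N by rewrite leqnn.
  have -> : (b - a)%N = (b.-1 - a).+1 by clear - ab; lia.
  have := Hn a ia; have := Hn b.-1 ib.
  by rewrite -[(_ - _).+1%:R]natr1 natrB; [lra | case/andP: ib].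
have mub : 0 < mu <= 144 by rewrite mu0.
apply: le_trans (second_difference_sqrt mub bQ _) _.
  move=> n an nb; have nab : (a <= n < b)%N by rewrite an ltnW.
  have /andP[n1 n2] := Hn _ nab.
  have n0 : (0 < n)%N by rewrite -(ltr0n R); lra.
  have -> : forall p q s : R, p + ph - (q + ph) - (q + ph - (s + ph)) = (p - q) - (q - s).
    by move=> *; ring.
  rewrite phase_second_difference //.
  have A1 : Q <= n%:R + dl / r%:R by rewrite ler_wpDr // divr_ge0.
  have A2 : n%:R + dl / r%:R <= 2 * Q + 1.
    have : dl / r%:R <= 1.
      by rewrite ler_pdivrMr // mul1r; apply: le_trans dl1 _; rewrite ler1n.
    lra.
  have /andP[] := cubic_bounds Q1 A1 A2; set C := (_ * _ * _ : R) => C1 C2.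
  have C0 : 0 < C by apply: lt_le_trans C1.
  rewrite mulrA /mu; apply/andP; split; last first.
    by apply: ler_wpM2l; [exact: ltW | rewrite lef_pV2].
  have iC : (Q ^+ 3)^-1 / 500 <= C^-1.
    have i0 : 0 < (Q ^+ 3)^-1 by rewrite invr_gt0.
    rewrite -[C^-1]mul1r (ler_pdivlMr _ _ C0).
    have := ler_wpM2r (ltW i0) C2; rewrite (mulfK (lt0r_neq0 Q3)); lra.
  by rewrite -mulrA; apply: ler_wpM2l => //; apply: ltW.
set s := Num.sqrt mu; have s0 : 0 < s by rewrite sqrtr_gt0.
have s2 : s ^+ 2 = mu by rewrite sqr_sqrtr // ltW.
have b1 : Q * s <= 6 * L ^+ 5.
  apply: ler_of_sqr; first by rewrite mulr_ge0 ?(ltW (Ln _)).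
  rewrite exprMn s2.
  have -> : Q ^+ 2 * mu = 4 * pi * x * h%:R / P.
    by rewrite /mu -Qr; move: (pi : R) => p; field; rewrite !gt_eqF.
  rewrite ler_pdivrMr //; apply: le_trans pxh _.
  have -> : (6 * L ^+ 5) ^+ 2 * P = 36 * L ^+ 10 * P by ring.
  by have := mulr_gt0 (Ln 10%N) P0; lra.
have b2 : 1 / s <= L ^+ 6 / r%:R.
  rewrite ler_pdivrMr // mulrAC ler_pdivlMr // mul1r.
  apply: ler_of_sqr; first by rewrite mulr_ge0 ?(ltW s0) ?(ltW (Ln _)).
  rewrite exprMn s2 muE.
  have -> : (L ^+ 6) ^+ 2 * (4 * pi * x * h%:R * r%:R ^+ 2 / P ^+ 3) =
     r%:R ^+ 2 * (4 * pi * x * h%:R * L ^+ 12 / P ^+ 3) by rewrite -exprM; ring.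
  rewrite ler_peMr ?sqr_ge0 // ler_pdivlMr ?exprn_gt0 // mul1r.
  have P3 : P ^+ 3 <= L ^+ 30.
    have -> : L ^+ 30 = (L ^+ 10) ^+ 3 by rewrite -exprM.
    by rewrite ler_pXn2r // ?nnegrE ?(ltW P0) ?(ltW (Ln _)).
  apply: le_trans P3 _.
  have -> : 4 * pi * x * h%:R * L ^+ 12 = (pi * h%:R) * (4 * L) * L ^+ 30 by rewrite xE; ring.
  rewrite ler_peMl ?(ltW (Ln _)) //.
  have : 1 * 1 <= pi * h%:R :> R by apply: ler_pM => //; lra.
  rewrite mul1r => ph1; have : 1 * 1 <= pi * h%:R * (4 * L) by apply: ler_pM => //; lra.
  by rewrite mul1r.
lra.
Qed.


Lemma cube_le (eta : R) : 0 <= eta <= 1 -> (1 + eta) * (1 + eta) * (1 + eta) <= 1 + 7 * eta.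
Proof.
move=> /andP[e0 e1]; have h1 : eta * eta <= eta by rewrite ler_piMr.
have h2 : eta * (eta * eta) <= eta by rewrite ler_piMr //; lra.
lra.
Qed.

(** Each of the three factors grows by at most [1 + eta], whose cube is at most [1 + 7 eta]. *)
Lemma cubic_compare (A B M eta : R) : 0 < M -> M <= B -> 0 <= eta <= 1 -> 0 <= A ->
  `|A - B| <= eta * M ->
  A * (A + 1) * (A + 2) <= (1 + 7 * eta) * (B * (B + 1) * (B + 2)).
Proof.
move=> M0 MB e01 A0; rewrite ler_norml => /andP[_ AB]; have /andP[e0 e1] := e01.
have B0 : 0 < B by lra.
have key c : 0 <= c -> A + c <= (1 + eta) * (B + c).
  move=> c0; have : eta * M <= eta * (B + c) by rewrite ler_wpM2l //; lra.
  lra.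
have k0 := key 0 (lexx _); rewrite !addr0 in k0.
apply: (@le_trans _ _ (((1 + eta) * B) * ((1 + eta) * (B + 1)) * ((1 + eta) * (B + 2)))).
  apply: ler_pM; rewrite ?mulr_ge0 ?key //; try lra.
  by apply: ler_pM; rewrite ?key //; lra.
have -> : (1 + eta) * B * ((1 + eta) * (B + 1)) * ((1 + eta) * (B + 2)) =
   ((1 + eta) * (1 + eta) * (1 + eta)) * (B * (B + 1) * (B + 2)) by ring.
by apply: ler_wpM2r; [rewrite !mulr_ge0 //; lra | exact: cube_le].
Qed.

(* [u / PA - u' / PB] stays within a factor two of [(u - u') / PA]: the perturbation coming from
   the shift [dl] is negligible against [u - u' >= 1 / (4 N ^ 2)]. *)
Lemma perturbed_difference (u u' rho w PA PB T : R) :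
  0 < PA -> 0 < PB -> 0 <= u' -> 0 <= w <= 1 -> u - u' = rho -> u' * w <= rho / 2 ->
  PA <= (1 + w) * PB -> PB <= (1 + w) * PA -> 0 < T -> T <= PA <= 125 * T ->
  rho / (250 * T) <= u / PA - u' / PB <= 2 * rho / T.
Proof.
move=> PA0 PB0 u0 /andP[w0 w1] rE uw AB BA T0 /andP[TA AT].
have rho0 : 0 <= rho by have : 0 <= u' * w; [rewrite mulr_ge0 | lra].
have uE : u = rho + u' by lra.
have up : u' / PB <= u' * (1 + w) / PA.
  rewrite ler_pdivrMr // mulrAC ler_pdivlMr // -mulrA ler_wpM2l //; lra.
have lo : u' * (1 - w) / PA <= u' / PB.
  rewrite ler_pdivrMr // mulrAC ler_pdivlMr // -mulrA ler_wpM2l //.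
  have : (1 - w) * PB <= (1 - w) * ((1 + w) * PA) by rewrite ler_wpM2l //; lra.
  have : 0 <= w * w * PA by rewrite !mulr_ge0 // ltW.
  lra.
have iT : PA^-1 <= T^-1 by rewrite lef_pV2.
have iA : (125 * T)^-1 <= PA^-1 by rewrite lef_pV2 ?posrE ?mulr_gt0.
have iA0 : 0 < PA^-1 by rewrite invr_gt0.
apply/andP; split.
  apply: (@le_trans _ _ (rho / 2 * (125 * T)^-1)).
    by rewrite le_eqVlt; apply/orP; left; apply/eqP; field; rewrite gt_eqF.
  apply: (@le_trans _ _ (rho / 2 / PA)); first by rewrite ler_wpM2l //; lra.
  apply: (@le_trans _ _ (u / PA - u' * (1 + w) / PA)); last by rewrite lerD2l lerN2.
  rewrite -mulrBl ler_wpM2r ?(ltW iA0) //; lra.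
apply: (@le_trans _ _ (u / PA - u' * (1 - w) / PA)); first by rewrite lerD2l lerN2.
rewrite -mulrBl; apply: (@le_trans _ _ (2 * rho / PA)); last by rewrite ler_wpM2l //; lra.
rewrite ler_wpM2r ?(ltW iA0) //; lra.
Qed.

(** The origin of 448: with [eta = 2 / (N M)] and [u' <= 4 H / N], the perturbation [7 eta u'] is at
    most [56 H / (N^2 M)]. It must not exceed [1 / (8 N^2)], half of the least possible difference,
    and this is [448 H <= M]. *)
Lemma shifted_ratio (M N H m e e' u u' : R) :
  1 <= N -> 1 <= H -> 448 * H <= M -> M <= m -> m + 2 <= 2 * M ->
  0 <= e <= 2 / N -> 0 <= e' <= 2 / N -> 0 <= u' <= 4 * H / N -> 1 / (4 * N ^+ 2) <= u - u' ->
  (u - u') / (250 * M ^+ 3) <=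
    u / ((m + e) * (m + e + 1) * (m + e + 2)) - u' / ((m + e') * (m + e' + 1) * (m + e' + 2))
    <= 2 * (u - u') / M ^+ 3.
Proof.
move=> N1 H1 HM Mm mM /andP[e0 e1] /andP[e0' e1'] /andP[u0 u1] rho_lo.
have N0 : 0 < N by lra.
have M448 : 448 <= M by clear - HM H1; lra.
have M0 : 0 < M by clear - M448; lra.
have M3 : 0 < M ^+ 3 by rewrite exprn_gt0.
pose eta : R := 2 / (N * M).
have etaM : eta * M = 2 / N by rewrite /eta; field; rewrite !gt_eqF.
have NM0 : 0 < N * M by rewrite mulr_gt0.
have NM448 : 448 <= N * M by have := ler_wpM2r (ltW M0) N1; clear - M448; lra.
have eta0 : 0 <= eta by rewrite divr_ge0 // ltW.
have eta1 : eta <= 1 / 224 by rewrite /eta ler_pdivrMr //; clear - NM448; lra.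
have e01 : 0 <= eta <= 1 by rewrite eta0 /=; clear - eta1; lra.
have N2 : 2 / N <= 2 by rewrite ler_pdivrMr //; clear - N1; lra.
set A := m + e; set B := m + e'.
have MA : M <= A by rewrite /A; clear - Mm e0; lra.
have MB : M <= B by rewrite /B; clear - Mm e0'; lra.
have A0 : 0 < A by apply: lt_le_trans MA.
have B0 : 0 < B by apply: lt_le_trans MB.
have AB : `|A - B| <= eta * M by rewrite etaM /A /B ler_norml; clear - e0 e0' e1 e1'; lra.
have BA : `|B - A| <= eta * M by rewrite distrC.
have cA := cubic_compare M0 MB e01 (ltW A0) AB.
have cB := cubic_compare M0 MA e01 (ltW B0) BA.
have M32 : 3 / 2 <= M by clear - M448; lra.
have AM : A <= 2 * M + 1 by rewrite /A; clear - mM e1 N2; lra.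
have PA := cubic_bounds M32 MA AM.
have PA0 : 0 < A * (A + 1) * (A + 2) by rewrite !mulr_gt0 // addr_gt0.
have PB0 : 0 < B * (B + 1) * (B + 2) by rewrite !mulr_gt0 // addr_gt0.
have w01 : 0 <= 7 * eta <= 1 by clear - eta0 eta1; lra.
have w0 : 0 <= 7 * eta by case/andP: w01.
have u'w : u' * (7 * eta) <= (u - u') / 2.
  apply: le_trans (ler_wpM2r w0 u1) _.
  have -> : 4 * H / N * (7 * eta) = (448 * H / M) * (1 / (8 * N ^+ 2)).
    by rewrite /eta; field; rewrite !gt_eqF.
  have p0 : 0 <= 1 / (8 * N ^+ 2) by rewrite divr_ge0 // mulr_ge0 // sqr_ge0.
  have h1 : 448 * H / M <= 1 by rewrite (ler_pdivrMr _ _ M0) mul1r.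
  have := ler_wpM2r p0 h1.
  have -> : 1 * (1 / (8 * N ^+ 2)) = (1 / (4 * N ^+ 2)) / 2 by field; rewrite gt_eqF.
  move: rho_lo; clear; move: (1 / (4 * N ^+ 2)) (448 * H / M * _) => y z; lra.
exact: (perturbed_difference PA0 PB0 u0 w01 (erefl _) u'w cA cB M3 PA).
Qed.

Lemma type_II_increment x dl (M N H h n h' n' m : nat) :
  0 < x -> 0 <= dl <= 1 -> (448 * H <= M)%N -> (0 < H)%N -> (0 < N)%N ->
  (h' <= 2 * H)%N -> (N < 2 * n)%N -> (N < 2 * n')%N ->
  1 / (4 * N%:R ^+ 2) <= h%:R / n%:R - h'%:R / n'%:R :> R ->
  (M <= m)%N -> (m + 2 <= 2 * M)%N ->
  4 * pi * x * ((h%:R / n%:R - h'%:R / n'%:R) / (250 * M%:R ^+ 3)) <=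
  (phase x dl h (m.+2 * n) - phase x dl h' (m.+2 * n') -
    (phase x dl h (m.+1 * n) - phase x dl h' (m.+1 * n'))) -
  (phase x dl h (m.+1 * n) - phase x dl h' (m.+1 * n') -
    (phase x dl h (m * n) - phase x dl h' (m * n')))
  <= 4 * pi * x * (2 * (h%:R / n%:R - h'%:R / n'%:R) / M%:R ^+ 3).
Proof.
move=> x0 /andP[dl0 dl1] HM H0 N0 h'H n1 n1' rho_lo Mm mM.
have nn0 : (0 < n)%N by clear - n1; lia.
have nn0' : (0 < n')%N by clear - n1'; lia.
have m0 : (0 < m)%N by clear - HM H0 Mm; lia.
have -> : forall p q s t u v : R, p - t - (q - u) - (q - u - (s - v)) =
    (p - q - (q - s)) - (t - u - (u - v)) by move=> *; ring.
rewrite ![(_ * n)%N]mulnC ![(_ * n')%N]mulnC !phase_second_difference // -mulrBr.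
have px0 : 0 <= 4 * pi * x by rewrite !mulr_ge0 ?pi_ge0 ?(ltW x0).
have NR : 0 < N%:R :> R by rewrite ltr0n.
have dln (k : nat) : (N < 2 * k)%N -> 0 <= dl / k%:R <= 2 / N%:R.
  move=> Nk; have k0 : 0 < k%:R :> R by rewrite ltr0n; clear - Nk; lia.
  rewrite divr_ge0 ?(ltW k0) //= ler_pdivrMr // mulrAC ler_pdivlMr //.
  have Nk' : N%:R <= 2 * k%:R :> R by rewrite -natrM ler_nat ltnW.
  have dN : dl * N%:R <= 1 * N%:R by rewrite ler_wpM2r // ltW.
  by clear - Nk' dN; lra.
have N1 : 1 <= N%:R :> R by rewrite ler1n.
have H1 : 1 <= H%:R :> R by rewrite ler1n.
have M448 : 448 * H%:R <= M%:R :> R by rewrite -natrM ler_nat.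
have MmR : M%:R <= m%:R :> R by rewrite ler_nat.
have mMR : m%:R + 2 <= 2 * M%:R :> R by rewrite -natrD -natrM ler_nat.
have nR' : 0 < n'%:R :> R by rewrite ltr0n.
have u'b : 0 <= (h'%:R / n'%:R : R) <= 4 * H%:R / N%:R.
  rewrite divr_ge0 //= (ler_pdivrMr _ _ nR') mulrAC (ler_pdivlMr _ _ NR) -!natrM ler_nat.
  by have := leq_mul h'H (ltnW n1'); clear; lia.
have /andP[lo up] := shifted_ratio N1 H1 M448 MmR mMR (dln n n1) (dln n' n1') u'b rho_lo.
by rewrite !ler_wpM2l.
Qed.

(** The difference [rho] of the two ratios is at least [1 / (4 N^2)], as a positive fraction with
    denominator [n n'], and at most [L^2 / N^2] by the cell condition. Up to a constant, [E] is
    [M sqrt mu] at the largest [rho]; at the smallest, [1 / sqrt mu <= E] follows from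
    [(M N)^4 <= L^40]. The total is [358 * (6 E + 2 E)]. *)
Lemma type_II_inner x L dl (M N H K h n h' n' a b : nat) (E : R) :
  2 <= L -> x = L ^+ 19 -> 0 <= dl <= 1 ->
  L ^+ 9 <= 2 * (M * N)%:R -> (M * N)%:R <= L ^+ 10 ->
  (448 * H <= M)%N -> 32 * L ^+ 3 <= M%:R -> (0 < K)%N -> (H * N)%:R <= K%:R * L ^+ 2 ->
  (0 < h')%N -> (h' <= 2 * H)%N ->
  (N < 2 * n)%N -> (n <= 2 * N)%N -> (N < 2 * n')%N -> (n' <= 2 * N)%N ->
  (h' * n < h * n')%N -> ((h * n' - h' * n) * (N * K) <= H * (n * n'))%N ->
  (M <= a)%N -> (b <= 2 * M)%N ->
  0 < E -> E ^+ 2 * (M * N)%:R ^+ 2 = x * L ^+ 2 * M%:R ->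
  `|\sum_(a <= m < b) cos (phase x dl h (m * n) - phase x dl h' (m * n'))| <= 2864 * E.
Proof.
move=> L2 xE /andP[dl0 dl1] LP PL HM LM K0 HNK h'0 h'H n1 n2 n1' n2' hn cell Ma b2M E0 EE.
have H0 : (0 < H)%N by clear - h'0 h'H; lia.
have M0 : (0 < M)%N by clear - HM H0; lia.
have N0 : (0 < N)%N by clear - n1 n2; lia.
have nn0 : (0 < n)%N by clear - n1; lia.
have nn0' : (0 < n')%N by clear - n1'; lia.
have L0 : 0 < L by lra.
have Ln k : 0 < L ^+ k by rewrite exprn_gt0.
have x0 : 0 < x by rewrite xE.
have pi2 := pi_ge2 R; have pi4 := pihalf_lt2 R.
have MR : 0 < M%:R :> R by rewrite ltr0n.
have NR : 0 < N%:R :> R by rewrite ltr0n.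
have KR : 0 < K%:R :> R by rewrite ltr0n.
have HR : 0 < H%:R :> R by rewrite ltr0n.
have nR : 0 < n%:R :> R by rewrite ltr0n.
have nR' : 0 < n'%:R :> R by rewrite ltr0n.
pose rho : R := h%:R / n%:R - h'%:R / n'%:R.
have rhoE : rho = (h * n' - h' * n)%:R / (n * n')%:R.
  by rewrite /rho natrB ?(ltnW hn) // !natrM; field; rewrite !gt_eqF.
have rho_lo : 1 / (4 * N%:R ^+ 2) <= rho.
  rewrite rhoE; apply: ler_pM; rewrite ?invr_ge0 ?mulr_ge0 ?exprn_ge0 //.
    by rewrite ler1n subn_gt0.
  rewrite lef_pV2 ?posrE ?ltr0n ?muln_gt0 ?nn0 // ?mulr_gt0 ?exprn_gt0 //.
  have -> : 4 * N%:R ^+ 2 = (4 * (N * N))%N%:R :> R by rewrite !natrM expr2.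
  rewrite ler_nat; have := leq_mul n2 n2'; clear; lia.
have rho0 : 0 < rho by apply: lt_le_trans rho_lo; rewrite divr_gt0 // mulr_gt0 // exprn_gt0.
have rho_up : rho <= L ^+ 2 / N%:R ^+ 2.
  apply: (@le_trans _ _ (H%:R / (N * K)%:R)).
    rewrite rhoE ler_pdivrMr ?ltr0n ?muln_gt0 ?nn0 // mulrAC ler_pdivlMr ?ltr0n ?muln_gt0 ?N0 //.
    by rewrite -!natrM ler_nat.
  rewrite ler_pdivrMr ?ltr0n ?muln_gt0 ?N0 // mulrAC ler_pdivlMr ?exprn_gt0 //.
  have := ler_wpM2r (ltW NR) HNK; rewrite !natrM; lra.
pose mu := 4 * pi * x * (2 * rho / M%:R ^+ 3).
have M3 : 0 < M%:R ^+ 3 :> R by rewrite exprn_gt0.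
have px0 : 0 < 4 * pi * x by rewrite !mulr_gt0 // pi_gt0.
have px1 : 4 * pi * x <= 16 * x.
  by rewrite ler_wpM2r ?(ltW x0) //; lra.
have mu0 : 0 < mu by rewrite mulr_gt0 // divr_gt0 // mulr_gt0.
have MNR : 0 < (M * N)%:R :> R by rewrite natrM mulr_gt0.
have MmuE : M%:R ^+ 2 * mu <= 32 * E ^+ 2.
  have -> : M%:R ^+ 2 * mu = 4 * pi * x * (2 * rho / M%:R).
    by rewrite /mu; move: (pi : R) => p; field; rewrite gt_eqF.
  have E2 : E ^+ 2 = x * (L ^+ 2 / N%:R ^+ 2 / M%:R).
    apply: (mulIf (lt0r_neq0 (exprn_gt0 2 MNR))); rewrite EE natrM.
    by field; rewrite !gt_eqF.
  have r1 : rho / M%:R <= L ^+ 2 / N%:R ^+ 2 / M%:R by rewrite ler_wpM2r // invr_ge0 ltW.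
  have r0 : 0 <= 2 * (rho / M%:R) by rewrite mulr_ge0 // divr_ge0 ?ltW.
  rewrite E2; move: (ler_wpM2r r0 px1) (ler_wpM2l (ltW x0) r1).
  rewrite -(mulrA 2 rho); move: (rho / M%:R) (_ / M%:R) => y z; clear; lra.
(* [L^9 <= 2 M N] gives [E^2 <= 4 L^3 M], and then [32 L^3 <= M] keeps [mu] below 144. *)
have E2M : 32 * E ^+ 2 <= 144 * M%:R ^+ 2.
  have e1 : E ^+ 2 * ((M * N)%:R ^+ 2 * 4) <= 4 * (L ^+ 21 * M%:R).
    by rewrite mulrA EE xE le_eqVlt; apply/orP; left; apply/eqP; ring.
  have e2 : L ^+ 18 <= (M * N)%:R ^+ 2 * 4.
    have -> : L ^+ 18 = (L ^+ 9) ^+ 2 by rewrite -exprM.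
    have -> : (M * N)%:R ^+ 2 * 4 = (2 * (M * N)%:R) ^+ 2 :> R by ring.
    by rewrite ler_pXn2r // ?nnegrE ?(ltW (Ln _)) // mulr_ge0.
  have e3 := ler_wpM2l (sqr_ge0 E) e2.
  have e4 : L ^+ 18 * (32 * E ^+ 2) <= L ^+ 18 * (4 * (32 * L ^+ 3) * M%:R).
    have -> : L ^+ 18 * (4 * (32 * L ^+ 3) * M%:R) = 32 * (4 * (L ^+ 21 * M%:R)) by ring.
    by move: (le_trans e3 e1); clear; lra.
  rewrite (ler_pM2l (Ln 18%N)) in e4.
  by move: e4 (ler_wpM2r (ltW MR) LM) (sqr_ge0 (M%:R : R)); clear; lra.
have mu144 : 0 < mu <= 144.
  rewrite mu0 /= -(ler_pM2l (exprn_gt0 2 MR)); apply: le_trans MmuE _.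
  by rewrite [leRHS]mulrC.
have baM : (b - a)%:R <= M%:R :> R by rewrite ler_nat; clear - b2M Ma; lia.
apply: le_trans (second_difference_sqrt mu144 baM _) _.
  move=> m am mb; have mM0 : (M <= m)%N by apply: leq_trans am.
  have mM1 : (m + 2 <= 2 * M)%N by clear - mb b2M; lia.
  have dl01 : 0 <= dl <= 1 by rewrite dl0.
  have -> : mu / 500 = 4 * pi * x * (rho / (250 * M%:R ^+ 3)).
    by rewrite /mu; clear - MR; move: (pi : R) => p; field; rewrite gt_eqF.
  exact: (type_II_increment (h := h) x0 dl01 HM H0 N0 h'H n1 n1' rho_lo mM0 mM1).
set s := Num.sqrt mu; have s0 : 0 < s by rewrite sqrtr_gt0.
have s2 : s ^+ 2 = mu by rewrite sqr_sqrtr // ltW.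
have b1 : M%:R * s <= 6 * E.
  apply: ler_of_sqr; first by rewrite mulr_ge0 ?(ltW E0).
  rewrite !exprMn s2.
  by apply: le_trans MmuE _; move: (sqr_ge0 E); clear; lra.
have b2 : 1 / s <= E.
  rewrite ler_pdivrMr //; apply: ler_of_sqr; first by rewrite mulr_ge0 ?(ltW s0) ?(ltW E0).
  rewrite expr1n exprMn s2.
  have mu_lo : 4 * x <= mu * (N%:R ^+ 2 * M%:R ^+ 3).
    have -> : mu * (N%:R ^+ 2 * M%:R ^+ 3) = pi * (2 * x) * (rho * (4 * N%:R ^+ 2)).
      by rewrite /mu; move: (pi : R) => p; field; rewrite gt_eqF.
    have r1 : 1 <= rho * (4 * N%:R ^+ 2).
      by rewrite -ler_pdivrMr ?mulr_gt0 ?exprn_gt0.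
    have : 2 * (2 * x) <= pi * (2 * x) by rewrite ler_wpM2r // mulr_ge0 // ltW.
    have : pi * (2 * x) * 1 <= pi * (2 * x) * (rho * (4 * N%:R ^+ 2)).
      by rewrite ler_wpM2l // !mulr_ge0 ?pi_ge0 ?(ltW x0).
    lra.
  have P4 : (M * N)%:R ^+ 4 <= L ^+ 40.
    have -> : L ^+ 40 = (L ^+ 10) ^+ 4 by rewrite -exprM.
    by rewrite ler_pXn2r // ?nnegrE ?(ltW (Ln _)).
  have T0 : 0 < N%:R ^+ 2 * M%:R ^+ 3 * (M * N)%:R ^+ 2 :> R by rewrite !mulr_gt0 ?exprn_gt0.
  rewrite -(ler_pM2r T0) mul1r.
  have -> : E ^+ 2 * mu * (N%:R ^+ 2 * M%:R ^+ 3 * (M * N)%:R ^+ 2) =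
     (E ^+ 2 * (M * N)%:R ^+ 2) * (mu * (N%:R ^+ 2 * M%:R ^+ 3)) by ring.
  have -> : N%:R ^+ 2 * M%:R ^+ 3 * (M * N)%:R ^+ 2 = M%:R * (M * N)%:R ^+ 4 :> R.
    by rewrite natrM; ring.
  have F0 : 0 <= E ^+ 2 * (M * N)%:R ^+ 2 by rewrite mulr_ge0 ?sqr_ge0.
  apply: le_trans (ler_wpM2l F0 mu_lo); rewrite EE xE.
  have -> : L ^+ 19 * L ^+ 2 * M%:R * (4 * L ^+ 19) = M%:R * (4 * L ^+ 40) by ring.
  by rewrite ler_wpM2l ?(ltW MR) //; move: (Ln 40%N) P4; clear; lra.
by clear - b1 b2; lra.
Qed.

End Phase.

(** * Bilinear sums *)

(** The ceiling of [D / n], for positive [n]. *)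
Definition cdiv (D n : nat) : nat := (D + n.-1) %/ n.

Lemma ltn_cdiv (D n m : nat) : (0 < n)%N -> (m * n < D)%N = (m < cdiv D n)%N.
Proof. move=> n0; rewrite /cdiv leq_divRL //; rewrite mulSn; lia. Qed.

Lemma sum_indicator_interval (R : realType) (g : nat -> R) (M M2 lo hi : nat) :
  (M <= lo)%N -> (hi <= M2)%N ->
  \sum_(M <= m < M2) (lo <= m < hi)%N%:R * g m = \sum_(lo <= m < hi) g m.
Proof.
move=> Mlo hiM; have [hl|lh] := leqP hi lo.
  rewrite [RHS]big_geq // big1 // => m _.
  have -> : (lo <= m < hi)%N = false by lia.
  by rewrite mul0r.
rewrite (big_cat_nat (n := lo)) //=; last by lia.
rewrite [X in _ + X](big_cat_nat (n := hi)) //=; last by lia.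
rewrite big_nat big1 ?add0r; last first.
  move=> m mlo; have -> : (lo <= m < hi)%N = false by lia.
  by rewrite mul0r.
rewrite [X in _ + X]big_nat [X in _ + X]big1 ?addr0; last first.
  move=> m mlo; have -> : (lo <= m < hi)%N = false by lia.
  by rewrite mul0r.
by apply: eq_big_nat => m mlo; rewrite mlo mul1r.
Qed.

(** Cut-offs on [m * n] and [m * n'] merely shorten the range of [m] to a subinterval, so they do
    not disturb the second-difference test. *)
Lemma window_interval (R : realType) (M M2 D1 D2 n n' : nat) : (0 < n)%N -> (0 < n')%N ->
  exists lo hi : nat, [/\ (M <= lo)%N, (hi <= M2)%N & forall g : nat -> R,
    \sum_(M <= m < M2) ((D1 <= m * n < D2)%N%:R * (D1 <= m * n' < D2)%N%:R) * g m =
    \sum_(lo <= m < hi) g m].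
Proof.
move=> n0 n0'; exists (maxn M (maxn (cdiv D1 n) (cdiv D1 n'))).
exists (minn M2 (minn (cdiv D2 n) (cdiv D2 n'))); split; [lia | lia | move=> g].
rewrite -(@sum_indicator_interval R g M M2); [|lia|lia].
apply: eq_big_nat => m mM; congr (_ * _); rewrite -natrM mulnb; congr ((_ : bool)%:R).
have := ltn_cdiv D1 m n0; have := ltn_cdiv D2 m n0.
have := ltn_cdiv D1 m n0'; have := ltn_cdiv D2 m n0'; lia.
Qed.

Section TypeII.
Variable R : realType.

(** Comparing ratios means comparing [h n'] with [h' n]. Exchanging [n] and [n'] turns this into a
    comparison of [h n] with [h' n'], each a function of one index, as the counting lemmas
    require. *)
Lemma count_swap (H N : nat) (f : nat -> nat -> R) :
  \sum_(p : 'I_H * 'I_N) \sum_(q : 'I_H * 'I_N) f ((H + p.1) * q.2.+1)%N ((H + q.1) * p.2.+1)%N =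
  \sum_(p : 'I_H * 'I_N) \sum_(q : 'I_H * 'I_N) f ((H + p.1) * p.2.+1)%N ((H + q.1) * q.2.+1)%N.
Proof.
have unpair (F : 'I_H -> 'I_N -> 'I_H -> 'I_N -> R) :
    \sum_(p : 'I_H * 'I_N) \sum_(q : 'I_H * 'I_N) F p.1 p.2 q.1 q.2 =
    \sum_(i < H) \sum_(j < N) \sum_(k < H) \sum_(l < N) F i j k l.
  rewrite -(pair_bigA _ (fun (i : 'I_H) (j : 'I_N) =>
    \sum_(q : 'I_H * 'I_N) F i j q.1 q.2)) /=.
  apply: eq_bigr => i _; apply: eq_bigr => j _.
  by rewrite -(pair_bigA _ (fun (k : 'I_H) (l : 'I_N) => F i j k l)).
rewrite (unpair (fun i j k l => f ((H + i) * l.+1)%N ((H + k) * j.+1)%N)).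
rewrite (unpair (fun i j k l => f ((H + i) * j.+1)%N ((H + k) * l.+1)%N)).
apply: eq_bigr => i _; rewrite exchange_big /= [RHS]exchange_big /=; apply: eq_bigr => k _.
by rewrite exchange_big.
Qed.

(** [(h * N * K) %/ (n * H)] is the integral part of [h / n] measured in units of [H / (N K)]. A
    common cell thus puts the ratios within [H / (N K)], hence [h n'] and [h' n] within [4 H N / K].
    Equal products get the trivial bound [M]; for the others the two ratios can be exchanged by
    symmetry. *)
Lemma type_II_pair (x L dl ph : R) (M N H K D1 D2 h n h' n' : nat) (E B : R) :
  2 <= L -> x = L ^+ 19 -> 0 <= dl <= 1 ->
  L ^+ 9 <= 2 * (M * N)%:R -> (M * N)%:R <= L ^+ 10 ->
  (448 * H <= M)%N -> 32 * L ^+ 3 <= M%:R -> (0 < K)%N -> (H * N)%:R <= K%:R * L ^+ 2 ->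
  (0 < H)%N -> (H <= h < 2 * H)%N -> (H <= h' < 2 * H)%N ->
  (0 < n <= 2 * N)%N -> (0 < n' <= 2 * N)%N ->
  (M * N <= D1)%N ->
  ((N < 2 * n)%N -> (N < 2 * n')%N ->
    ((h * N * K) %/ (n * H) = (h' * N * K) %/ (n' * H))%N) ->
  0 < E -> E ^+ 2 * (M * N)%:R ^+ 2 = x * L ^+ 2 * M%:R -> 2864 * E <= B ->
  `|\sum_(M <= m < 2 * M) ((D1 <= m * n < D2)%N%:R * (D1 <= m * n' < D2)%N%:R) *
      cos (phase x dl h (m * n) + ph - (phase x dl h' (m * n') + ph))|
  <= M%:R * (h * n' == h' * n)%N%:R +
     B * (h * n' - h' * n + (h' * n - h * n') <= 4 * (H * N) %/ K)%N%:R.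
Proof.
move=> L2 xE dl01 LP PL HM LM K0 HNK H0 /andP[hH h2] /andP[hH' h2'] /andP[n0 n2] /andP[n0' n2'] D1P cell E0 EE EB.
have B0 : 0 <= B by clear - E0 EB; lra.
have rhs0 (u v : bool) : 0 <= M%:R * (u%:R : R) + B * v%:R.
  by rewrite addr_ge0 // mulr_ge0.
(* For [2 k <= N] the window is empty, since [m k < M N <= D1]. *)
have zero (k : nat) (G : nat -> R) : (2 * k <= N)%N ->
    (forall m, (m < 2 * M)%N -> ~~ (D1 <= m * k < D2)%N -> G m = 0) ->
    \sum_(M <= m < 2 * M) G m = 0.
  move=> kN G0; rewrite big_nat big1 // => m /andP[_ mM]; apply: G0 => //.
  rewrite negb_and -ltnNge; apply/orP; left; apply: leq_trans D1P.
  have : (2 * (m * k) < 2 * (M * N))%N.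
    have M0 : (0 < M)%N by clear - mM; lia.
    case: (posnP k) => [-> | k0].
      by rewrite muln0 muln0 !muln_gt0 M0 /=; clear - n0 n2; lia.
    have : (m * (2 * k) < 2 * M * (2 * k))%N by rewrite ltn_pmul2r // muln_gt0.
    have : (M * (2 * k) <= M * N)%N by rewrite leq_mul2l kN orbT.
    by clear; lia.
  by rewrite ltn_pmul2l.
have [nN|nN] := leqP (2 * n) N.
  rewrite (zero n) ?normr0 // => m _ /negbTE ->; by rewrite !mul0r.
have [nN'|nN'] := leqP (2 * n') N.
  rewrite (zero n') ?normr0 // => m _ /negbTE ->; by rewrite mulr0 mul0r.
have {}cell := cell nN nN'.
have [lo [hi [Mlo hiM win]]] := @window_interval R M (2 * M) D1 D2 n n' n0 n0'.
rewrite win.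
under eq_bigr do rewrite opprD addrACA subrr addr0.
have [eqv|neq] := eqVneq (h * n')%N (h' * n)%N.
  rewrite mulr1; apply: le_trans (norm_sum_cos (fun m => phase x dl h (m * n) - phase x dl h' (m * n')) lo hi) _.
  apply: (@le_trans _ _ M%:R); last by rewrite lerDl mulr_ge0.
  by rewrite ler_nat; clear - Mlo hiM; lia.
rewrite mulr0 add0r.
have close (k l k' l' : nat) : (0 < l)%N -> (0 < l')%N ->
    ((k * N * K) %/ (l * H) = (k' * N * K) %/ (l' * H))%N ->
    ((k * l' - k' * l) * (N * K) <= H * (l * l'))%N.
  move=> l0 l0' kl; clear - l0 l0' kl H0.
  have a1 := leq_divM (k' * N * K) (l' * H).
  have a2 : (k * N * K < ((k * N * K) %/ (l * H)).+1 * (l * H))%N by rewrite ltn_ceil // muln_gt0 l0.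
  rewrite kl in a2; move: (_ %/ _)%N a1 a2 => q a1 a2.
  rewrite mulnBl leq_subLR.
  have b1 : (k * N * K * l' <= q.+1 * (l * H) * l')%N by rewrite leq_mul2r (ltnW a2) orbT.
  have b2 : (q * (l' * H) * l <= k' * N * K * l)%N by rewrite leq_mul2r a1 orbT.
  lia.
have near (k l k' l' : nat) : (l <= 2 * N)%N -> (l' <= 2 * N)%N -> (0 < N)%N ->
    ((k * l' - k' * l) * (N * K) <= H * (l * l'))%N -> (k * l' - k' * l <= 4 * (H * N) %/ K)%N.
  move=> lN lN' N0 kl; clear - lN lN' N0 kl K0; rewrite leq_divRL //.
  rewrite -(@leq_pmul2r N) //.
  have : (H * (l * l') <= H * (2 * N * (2 * N)))%N by rewrite leq_mul2l leq_mul ?orbT.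
  lia.
have N0 : (0 < N)%N by clear - n0 n2; lia.
have rR : (h * n' - h' * n + (h' * n - h * n') <= 4 * (H * N) %/ K)%N.
  have c1 := near _ _ _ _ n2 n2' N0 (close _ _ _ _ n0 n0' cell).
  have c2 := near _ _ _ _ n2' n2 N0 (close _ _ _ _ n0' n0 (esym cell)).
  by clear - c1 c2; lia.
rewrite rR mulr1.
have [hn|hn] := ltnP (h' * n) (h * n').
  apply: (le_trans (@type_II_inner R x L dl M N H K h n h' n' lo hi E _ _ _ _ _ _ _ _ _ _ _ _ _ _ _ _ _ _ _ _ _)) => //.
  - by clear - hH' H0; lia.
  - exact: ltnW.
  - exact: close.
have {neq}hn : (h * n' < h' * n)%N by rewrite ltn_neqAle neq.
under eq_bigr do rewrite -cosN opprB.
apply: (le_trans (@type_II_inner R x L dl M N H K h' n' h n lo hi E _ _ _ _ _ _ _ _ _ _ _ _ _ _ _ _ _ _ _ _ _)) => //.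
- by clear - hH H0; lia.
- exact: ltnW.
- exact: close.
Qed.

(** After [cauchy_cells] the equal products contribute about [M^2 K H N], controlled by [V]. The
    other pairs sharing a cell number about [(H N)^2 / K] and contribute [M E (H N)^2], controlled
    by [W]. Up to powers of [l] both are [O(H^2 L^18)]. *)
Lemma type_II_sum (x L dl ph l : R) (M N H D1 D2 : nat) (a b c : nat -> R) :
  2 <= L -> x = L ^+ 19 -> 0 <= dl <= 1 ->
  L ^+ 9 <= 2 * (M * N)%:R -> (M * N)%:R <= L ^+ 10 ->
  (448 * H <= M)%N -> 32 * L ^+ 3 <= M%:R -> L ^+ 2 <= 4 * N%:R -> (N <= 2 * M)%N ->
  (0 < H)%N -> (0 < N)%N -> (M * N <= D1)%N ->
  1 <= l -> harmonic_sum R (2 * H) <= 2 * l ->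
  (forall h, `|c h| <= 1) -> (forall m, (M <= m < 2 * M)%N -> `|a m| <= l) ->
  (forall n, (0 < n <= 2 * N)%N -> `|b n| <= l) ->
  `|\sum_(i < H) c (H + i)%N * \sum_(M <= m < 2 * M) a m * \sum_(j < 2 * N) b j.+1 *
     ((D1 <= m * j.+1 < D2)%N%:R * cos (phase x dl (H + i) (m * j.+1) + ph))|
  <= 3000 * l ^+ 3 * H%:R * L ^+ 9.
Proof.
move=> L2 xE dl01 LP PL HM LM L4N N2M H0 N0 D1P l1 harm c1 al bl.
have L0 : 0 < L by clear - L2; lra.
have Ln k : 0 < L ^+ k by rewrite exprn_gt0.
have M0 : (0 < M)%N by clear - HM H0; lia.
have MR : 0 < M%:R :> R by rewrite ltr0n.
have NR : 0 < N%:R :> R by rewrite ltr0n.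
have HR : 0 < H%:R :> R by rewrite ltr0n.
have HR1 : 1 <= H%:R :> R by rewrite ler1n.
have x0 : 0 < x by rewrite xE.
have l0 : 0 < l by clear - l1; lra.
have MNR : 0 < (M * N)%:R :> R by rewrite natrM mulr_gt0.
pose E : R := Num.sqrt (x * L ^+ 2 * M%:R) / (M * N)%:R.
have xLM : 0 < x * L ^+ 2 * M%:R by rewrite !mulr_gt0.
have E0 : 0 < E by rewrite divr_gt0 // sqrtr_gt0.
have EE : E ^+ 2 * (M * N)%:R ^+ 2 = x * L ^+ 2 * M%:R.
  by rewrite -exprMn divfK ?gt_eqF // sqr_sqrtr // ltW.
have [B BE] : exists B, B = 2864 * E by exists (2864 * E).
have B0 : 0 <= B by clear - BE E0; lra.
pose y : R := (H * N)%:R / L ^+ 2.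
have y0 : 0 <= y by rewrite divr_ge0 // ltW.
have yE : y * L ^+ 2 = (H * N)%:R by rewrite divfK // gt_eqF.
pose K := (Num.truncn y).+1.
have /andP[K1 K2] := truncn_itv y0.
have HNK : (H * N)%:R <= K%:R * L ^+ 2 by rewrite -yE ler_wpM2r // ltW.
(* The hypothesis [L^2 <= 4 N] absorbs the rounding up of [K]. *)
have KL : K%:R * L ^+ 2 <= 5 * (H%:R * N%:R).
  have k1 : K%:R <= y + 1 by rewrite /K -natr1 lerD2r.
  have := ler_wpM2r (ltW (Ln 2%N)) k1; rewrite mulrDl yE natrM mul1r.
  have := ler_wpM2r (ltW NR) HR1; clear - L4N; lra.
have K0 : (0 < K)%N by [].
have KR : 0 < K%:R :> R by rewrite ltr0n.
pose hh (p : 'I_H * 'I_(2 * N)) : nat := (H + p.1)%N.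
pose nn (p : 'I_H * 'I_(2 * N)) : nat := p.2.+1.
(* When [N < 2 n] the ratio is below [4 H / N], so the cell index is below [4 K + 1]. For smaller
   [n], [inord] may fall back on cell 0, but such indices have an empty window. *)
pose kap (p : 'I_H * 'I_(2 * N)) : 'I_(4 * K).+1 := inord ((hh p * N * K) %/ (nn p * H)).
pose be (p : 'I_H * 'I_(2 * N)) (m : nat) : R :=
  c (hh p) * b (nn p) * (D1 <= m * nn p < D2)%N%:R.
pose th (p : 'I_H * 'I_(2 * N)) (m : nat) : R := phase x dl (hh p) (m * nn p) + ph.
set T := (X in `|X|).
have TE : T = \sum_(M <= m < 2 * M) a m * \sum_p be p m * cos (th p m).
  rewrite /T; under eq_bigr do rewrite mulr_sumr.
  rewrite exchange_big /=; apply: eq_bigr => m _.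
  rewrite -(pair_bigA _ (fun (i : 'I_H) (j : 'I_(2 * N)) => be (i, j) m * cos (th (i, j) m))) /=.
  rewrite mulr_sumr; apply: eq_bigr => i _; rewrite !mulr_sumr; apply: eq_bigr => j _.
  by rewrite /be /th /hh /nn /=; ring.
have hhH p : (H <= hh p < 2 * H)%N by have := ltn_ord p.1; rewrite /hh; clear; lia.
have nnN p : (0 < nn p <= 2 * N)%N by rewrite /nn /=.
pose eqc p q : R := (hh p * nn q == hh q * nn p)%N%:R.
pose nrc p q : R := (hh p * nn q - hh q * nn p + (hh q * nn p - hh p * nn q) <= 4 * (H * N) %/ K)%N%:R.
have pair p q : kap p == kap q ->
    `|\sum_(M <= m < 2 * M) be p m * be q m * cos (th p m - th q m)| <=
    l ^+ 2 * (M%:R * eqc p q + B * nrc p q).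
  move=> /eqP kpq.
  pose C := c (hh p) * b (nn p) * (c (hh q) * b (nn q)).
  have -> : \sum_(M <= m < 2 * M) be p m * be q m * cos (th p m - th q m) =
     C * \sum_(M <= m < 2 * M) ((D1 <= m * nn p < D2)%N%:R * (D1 <= m * nn q < D2)%N%:R) *
      cos (phase x dl (hh p) (m * nn p) + ph - (phase x dl (hh q) (m * nn q) + ph)).
    rewrite mulr_sumr; apply: eq_bigr => m _; rewrite /be /th /C; ring.
  have Cl : `|C| <= l ^+ 2.
    have cb r : `|c (hh r) * b (nn r)| <= l.
      by rewrite normrM -[l]mul1r; apply: ler_pM => //; apply: bl.
    by rewrite normrM expr2; apply: ler_pM.
  rewrite normrM; apply: ler_pM => //.
  apply: (@type_II_pair x L dl ph M N H K D1 D2 (hh p) (nn p) (hh q) (nn q) E B) => //; last by rewrite BE.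
  move=> n1 n1'.
  have bound r : (N < 2 * nn r)%N -> ((hh r * N * K) %/ (nn r * H) < (4 * K).+1)%N.
    move=> n1r; have /andP[_ hr] := hhH r; clear - n1r hr H0.
    have nH : (0 < nn r * H)%N by rewrite muln_gt0 H0.
    rewrite ltn_divLR //.
    have : (hh r * (N * K) <= 2 * H * (2 * nn r * K))%N.
      by rewrite leq_mul ?(ltnW hr) // leq_mul // ltnW.
    by move: nH; move: (hh r) (nn r) K => u v k; clear; lia.
  by move: (congr1 (@nat_of_ord _) kpq); rewrite /kap !inordK ?bound.
have Ssum : T ^+ 2 <= (M%:R * l ^+ 2) * ((4 * K).+1%:R *
    (l ^+ 2 * (M%:R * (\sum_p \sum_q eqc p q) + B * (\sum_p \sum_q nrc p q)))).
  rewrite TE; apply: le_trans (cauchy_cells kap _ _ _ _ _) _.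
  apply: ler_pM.
  - by apply: sumr_ge0 => m _; apply: sqr_ge0.
  - by rewrite mulr_ge0 // sumr_ge0 // => p _; rewrite sumr_ge0.
  - have -> : M%:R * l ^+ 2 = \sum_(M <= m < 2 * M) l ^+ 2.
      by rewrite sumr_const_nat mul2n -addnn addnK mulr_natl.
    rewrite [leLHS]big_nat [leRHS]big_nat; apply: ler_sum => m mM.
    by rewrite -[a m ^+ 2]real_normK ?num_real // ler_pXn2r // ?nnegrE ?(ltW l0) // al.
  - rewrite ler_wpM2l //.
    have -> : l ^+ 2 * (M%:R * (\sum_p \sum_q eqc p q) + B * (\sum_p \sum_q nrc p q)) =
       \sum_p \sum_q l ^+ 2 * (M%:R * eqc p q + B * nrc p q).
      rewrite !mulr_sumr -big_split mulr_sumr; apply: eq_bigr => p _ /=.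
      rewrite !mulr_sumr -big_split mulr_sumr; by apply: eq_bigr => q _.
    apply: ler_sum => p _.
    rewrite [leRHS](bigID (fun q => kap p == kap q)) /= -[leLHS]addr0 lerD //.
      by apply: ler_sum => q; apply: pair.
    apply: sumr_ge0 => q _; rewrite mulr_ge0 ?exprn_ge0 ?(ltW l0) // addr_ge0 ?mulr_ge0  //.
have S0 : \sum_p \sum_q eqc p q <= 24 * l * (H%:R * N%:R).
  rewrite /eqc /hh /nn (@count_swap H (2 * N) (fun u v => (u == v)%:R)).
  apply: le_trans (count_equal_products R H0 N0) _.
  have h12 : 0 <= 12 * H%:R * N%:R :> R by rewrite !mulr_ge0.
  by apply: le_trans (ler_wpM2l h12 harm) _; clear; lra.
(* With [r] the integral part of [4 H N / K], multiplying by [K] cancels the denominator: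
   [(2 r + 1) K <= 10 H N]. *)
have Sr : (\sum_p \sum_q nrc p q) * K%:R <= 10 * (H%:R * N%:R) * (24 * l * (H%:R * N%:R)).
  rewrite /nrc /hh /nn (@count_swap H (2 * N) (fun u v => (u - v + (v - u) <= 4 * (H * N) %/ K)%N%:R)).
  have S1 := count_close_pairs R (fun p : 'I_H * 'I_(2 * N) => (H + p.1) * p.2.+1)%N (4 * (H * N) %/ K).
  move: S0; rewrite /eqc /hh /nn (@count_swap H (2 * N) (fun u v => (u == v)%:R)) => S0'.
  apply: le_trans (ler_wpM2r (ltW KR) S1) _; rewrite mulrAC; apply: ler_pM => //.
    by apply: sumr_ge0 => p _; apply: sumr_ge0.
  have t1 := leq_divM (4 * (H * N)) K.
  have t1R : (4 * (H * N) %/ K)%:R * K%:R <= 4 * (H%:R * N%:R) :> R by rewrite -!natrM ler_nat.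
  have t2 : K%:R <= 2 * (H%:R * N%:R) :> R.
    have two0 : 0 <= 2 :> R by [].
    have L4 : 2 * 2 <= L ^+ 2 by rewrite expr2; apply: ler_pM.
    have k4 := ler_wpM2l (ltW KR) L4.
    have hn0 := mulr_gt0 HR NR.
    by move: KL k4 hn0; move: (H%:R * N%:R : R) (K%:R : R) (L ^+ 2) => v w z; clear; lra.
  rewrite -[_.*2.+1%:R]natr1 -mul2n natrM.
  move: t1R t2; move: ((_ %/ _)%:R : R) => u; move: (H%:R * N%:R : R) (K%:R : R) => v w; clear; lra.
have HN0 : 0 < H%:R * N%:R :> R by rewrite mulr_gt0.
have P2 : (M * N)%:R = M%:R * N%:R :> R by rewrite natrM.
(* The square of the left side is [N (M N) L^21], and [N <= 2 M] bounds [N] by [sqrt (2 M N)], of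
   order [L^5]. *)
have W : M%:R * E * N%:R ^+ 2 <= 3 / 2 * L ^+ 18.
  have N5 : N%:R <= 3 / 2 * L ^+ 5.
    apply: ler_of_sqr; first by rewrite mulr_ge0 // ltW.
    have n2 : N%:R ^+ 2 <= 2 * (M * N)%:R :> R.
      rewrite -natrX -natrM ler_nat expnS expn1; clear - N2M.
      have := leq_mul N2M (leqnn N); lia.
    have -> : (3 / 2 * L ^+ 5) ^+ 2 = 9 / 4 * L ^+ 10 by field.
    by have := Ln 10%N; clear - n2 PL; lra.
  apply: ler_of_sqr; first by rewrite mulr_ge0 // ltW.
  have -> : (M%:R * E * N%:R ^+ 2) ^+ 2 = N%:R * (M * N)%:R * L ^+ 21.
    transitivity (N%:R ^+ 2 * (E ^+ 2 * (M * N)%:R ^+ 2)); first by rewrite P2; ring.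
    by rewrite EE xE P2; ring.
  have -> : (3 / 2 * L ^+ 18) ^+ 2 = 9 / 4 * L ^+ 15 * L ^+ 21 by field.
  apply: ler_wpM2r; first exact: ltW.
  have := ler_pM (ltW NR) (ltW MNR) N5 PL.
  have -> : 3 / 2 * L ^+ 5 * L ^+ 10 = 3 / 2 * L ^+ 15 by ring.
  by have := Ln 15%N; clear; lra.
have V : M%:R ^+ 2 * K%:R * (H%:R * N%:R) <= 5 * H%:R ^+ 2 * L ^+ 18.
  rewrite -(ler_pM2r (Ln 2%N)).
  have g0 : 0 <= M%:R ^+ 2 * (H%:R * N%:R) :> R by rewrite mulr_ge0 ?sqr_ge0 // ltW.
  have := ler_wpM2l g0 KL.
  have PP : (M%:R * N%:R) ^+ 2 <= L ^+ 20.
    by rewrite -P2 (exprM L 10 2) ler_pXn2r // ?nnegrE ?(ltW MNR) ?(ltW (Ln _)).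
  have := ler_wpM2l (sqr_ge0 (H%:R : R)) PP.
  move: (M%:R : R) (H%:R : R) (N%:R : R) (K%:R : R) => m h n k; clear; lra.
have Se0 : 0 <= \sum_p \sum_q eqc p q by apply: sumr_ge0 => p _; apply: sumr_ge0.
have Sn0 : 0 <= \sum_p \sum_q nrc p q by apply: sumr_ge0 => p _; apply: sumr_ge0.
have K5 : (4 * K).+1%:R <= 5 * K%:R :> R by rewrite -natrM ler_nat; clear - K0; lia.
have G0 : 0 <= l ^+ 3 * (H%:R * L ^+ 9).
  by rewrite mulr_ge0 ?exprn_ge0 ?(ltW l0) // mulr_ge0 // ltW.
apply: ler_of_sqr; first by clear - G0; lra.
rewrite real_normK ?num_real //; apply: le_trans Ssum _.
move: (\sum_p \sum_q eqc p q) (\sum_p \sum_q nrc p q) Se0 Sn0 S0 Sr => Se Sn Se0 Sn0 S0 Sr.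
have step1 : (4 * K).+1%:R * (M%:R * Se + B * Sn) <=
    5 * (24 * l * (M%:R * K%:R * (H%:R * N%:R))) + 5 * (240 * l * (B * (H%:R * N%:R) ^+ 2)).
  have u0 : 0 <= M%:R * Se + B * Sn by rewrite addr_ge0 ?mulr_ge0.
  apply: le_trans (ler_wpM2r u0 K5) _.
  have mk0 : 0 <= M%:R * K%:R :> R by rewrite mulr_ge0.
  have := ler_wpM2l mk0 S0; have := ler_wpM2l B0 Sr.
  move: (M%:R : R) (H%:R : R) (N%:R : R) (K%:R : R) => m h n k; clear; lra.
have Ml0 : 0 <= M%:R * l ^+ 2 * l ^+ 2 by rewrite !mulr_ge0 ?exprn_ge0 ?(ltW l0).
have -> : M%:R * l ^+ 2 * ((4 * K).+1%:R * (l ^+ 2 * (M%:R * Se + B * Sn))) =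
   M%:R * l ^+ 2 * l ^+ 2 * ((4 * K).+1%:R * (M%:R * Se + B * Sn)) by ring.
apply: le_trans (ler_wpM2l Ml0 step1) _.
have l5 : 0 <= l ^+ 5 by rewrite exprn_ge0 // ltW.
have V5 := ler_wpM2l l5 V.
have lH : 0 <= l ^+ 5 * H%:R ^+ 2 by rewrite mulr_ge0 // sqr_ge0.
have W5 := ler_wpM2l lH W.
have l6 : l ^+ 5 * (H%:R ^+ 2 * L ^+ 18) <= l ^+ 6 * (H%:R ^+ 2 * L ^+ 18).
  apply: ler_wpM2r; first by rewrite mulr_ge0 ?sqr_ge0 // ltW.
  by rewrite [leRHS]exprS ler_peMl.
have z0 : 0 <= l ^+ 5 * (H%:R ^+ 2 * L ^+ 18) by rewrite mulr_ge0 // mulr_ge0 ?sqr_ge0 // ltW.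
rewrite BE; move: V5 W5 l6 z0.
move: (M%:R : R) (H%:R : R) (N%:R : R) (K%:R : R) => m h n k; clear; lra.
Qed.

End TypeII.

(** * Dyadic blocks *)

Lemma window_interval1 (R : realType) (Z D1 D2 r : nat) : (0 < r)%N ->
  exists lo hi : nat, [/\ (1 <= lo)%N, (hi <= Z)%N,
    forall j, (lo <= j < hi)%N -> (D1 <= r * j < D2)%N & forall g : nat -> R,
    \sum_(1 <= j < Z) (D1 <= r * j < D2)%N%:R * g j = \sum_(lo <= j < hi) g j].
Proof.
move=> r0; exists (maxn 1 (cdiv D1 r)), (minn Z (cdiv D2 r)).
have c j := (mulnC r j, ltn_cdiv D1 j r0, ltn_cdiv D2 j r0).
split; [lia | lia | move=> j jl | move=> g].
  by have [[e1 e2] e3] := c j; move: e2 e3; rewrite e1; lia.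
rewrite -(@sum_indicator_interval R g 1 Z); [|lia|lia].
apply: eq_big_nat => m mM; congr (_ * _); congr ((_ : bool)%:R).
by have [[e1 e2] e3] := c m; move: e2 e3; rewrite e1; lia.
Qed.

Lemma ln2_ge_half (R : realType) : 1 / 2 <= ln 2 :> R.
Proof.
have := @le_ln1Dx R (- (1 / 2)); have -> : 1 + - (1 / 2) = 2^-1 :> R by field.
by rewrite lnV ?posrE // => /(_ ltac:(lra)); lra.
Qed.

(** Lets every count of dyadic scales be charged to one factor [2 * l]. *)
Lemma log2_bound (R : realType) (i : nat) (l : R) : ln (2 * (2 ^ i)%:R) <= l -> i.+1%:R <= 2 * l.
Proof.
have -> : ln (2 * (2 ^ i)%:R) = i.+1%:R * ln 2 :> R by rewrite natrX -exprS lnXn // mulr_natl.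
by have := ler_wpM2l (ler0n R i.+1) (ln2_ge_half R); lra.
Qed.

Section Blocks.
Variable R : realType.
Variables (x L dl ph l : R) (i : nat).
Let P : nat := 2 ^ i.
Hypotheses (L20 : 20 <= L) (xE : x = L ^+ 19) (dl01 : 0 <= dl <= 1).
Hypotheses (LP : L ^+ 9 <= P%:R) (PL : P%:R <= L ^+ 10).
Hypotheses (l1 : 1 <= l) (lnP : ln (2 * P%:R) <= l).

Let V := Num.truncn (L ^+ 2).
Let Z := (2 * P)%N.

(** The indicator provides both vanishing properties that [vaughan] asks of its weight, with
    [Z = 2 P] and [V < P]. *)
Definition block_wave (h d : nat) : R :=
  (P <= d < 2 * P)%N%:R * cos (phase x dl h d + ph).

Let Ln k : 0 < L ^+ k. Proof. by rewrite exprn_gt0 // (lt_le_trans _ L20). Qed.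
Let l0 : 0 < l. Proof. exact: lt_le_trans l1. Qed.
Let P0 : (0 < P)%N. Proof. by rewrite expn_gt0. Qed.
Let PR : 0 < P%:R :> R. Proof. by rewrite ltr0n. Qed.
Let L2 : 2 <= L. Proof. by move: L20; lra. Qed.
Let LP2 : L ^+ 9 <= 2 * P%:R.
Proof. by move: LP PR; move: (P%:R : R) => p; lra. Qed.

Let VL : V%:R <= L ^+ 2. Proof. by rewrite /V truncn_le ltW. Qed.

Let ln_le (k : nat) : (0 < k < Z)%N -> 0 <= ln (k%:R : R) <= l.
Proof.
move=> /andP[k0 kZ]; rewrite ln_ge0 ?ler1n //=; apply: le_trans lnP.
rewrite ler_ln ?posrE ?ltr0n // -?natrM ?ltr0n ?muln_gt0 ?P0 // ler_nat; exact: ltnW.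
Qed.

Let harm (k : nat) : (0 < k)%N -> (k < Z)%N -> harmonic_sum R k.+1 <= 2 * l.
Proof.
move=> k0 kZ; apply: le_trans (harmonic_sum_le R k0) _.
have := ln_le (k := k); rewrite k0 kZ => /(_ isT) /andP[_]; move: l1; lra.
Qed.

Let VZ : (V ^ 2 < P)%N.
Proof.
rewrite -(ltr_nat R) natrX; apply: lt_le_trans LP.
apply: (@le_lt_trans _ _ ((L ^+ 2) ^+ 2)); first by rewrite ler_pXn2r // ?nnegrE ?(ltW (Ln _)).
by rewrite -exprM ltr_eXn2l //; move: L20; lra.
Qed.

Let V1 : (0 < V)%N.
Proof. by rewrite truncn_gt0 exprn_ege1 //; move: L20; lra. Qed.

Let VZ1 : (V < P)%N. Proof. by apply: leq_ltn_trans VZ; rewrite expnS expn1 leq_pmulr. Qed.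

Let VZ2 : (V < Z)%N. Proof. by apply: leq_trans VZ1 _; rewrite /Z leq_pmull. Qed.

(** [abel_ineq] with lower bound 0 removes the increasing weight, which will be [ln] or the constant
    [l]. *)
Lemma type_I_sum (h r : nat) (w : nat -> R) :
  (0 < h)%N -> h%:R * L ^+ 9 <= 2 * P%:R -> (0 < r)%N -> r%:R <= L ^+ 4 ->
  (forall n, (0 < n < Z)%N -> 0 <= w n <= l) -> (forall n, (0 < n)%N -> w n <= w n.+1) ->
  `|\sum_(1 <= k < Z) w k * block_wave h (r * k)| <= l * (716 * (6 * L ^+ 5 + L ^+ 6 / r%:R)).
Proof.
move=> h0 hP r0 rL w0 wm.
have [lo [hi [lo1 hiZ inw win]]] := @window_interval1 R Z P (2 * P) r r0.
have -> : \sum_(1 <= k < Z) w k * block_wave h (r * k) =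
   \sum_(lo <= k < hi) w k * cos (phase x dl h (r * k) + ph).
  by rewrite -win; apply: eq_bigr => k _; rewrite /block_wave; ring.
set G := 716 * _.
have sub c : (lo <= c <= hi)%N -> `|\sum_(c <= n < hi) cos (phase x dl h (r * n) + ph)| <= G.
  move=> /andP[lc _]; apply: (@type_I_inner R x L dl ph P%:R h r c hi) => // n /andP[cn nhi].
  have := inw n; rewrite nhi (leq_trans lc cn) => /(_ isT).
  by rewrite -natrM ler_nat ltr_nat.
have G0 : 0 <= G.
  have : 0 <= L ^+ 6 / r%:R by rewrite divr_ge0 // ltW.
  by rewrite /G; move: (Ln 5%N); lra.
have := @abel_ineq R w (fun k => cos (phase x dl h (r * k) + ph)) hi G l lo 0 G0 (ltW l0).
rewrite mul0r !subr0; apply => // n.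
  by move=> /andP[ln nh]; apply: w0; rewrite (leq_trans nh hiZ) andbT (leq_trans lo1 ln).
by move=> ln _; apply: wm; apply: leq_trans ln.
Qed.

(** Up to [L^4] outer pairs at [6 L^5] each make the main term [L^9]; the terms [L^6 / r] add up to
    [L^6] times logarithms. *)
Lemma type_I_total (h : nat) : (0 < h)%N -> h%:R * L ^+ 9 <= 2 * P%:R ->
  `|\sum_(1 <= m < V.+1) moebius R m * \sum_(1 <= k < Z) ln k%:R * block_wave h (m * k)
    - \sum_(1 <= m < V.+1) \sum_(1 <= c < V.+1)
        moebius R m * vonMangoldt R c * \sum_(1 <= j < Z) block_wave h (m * c * j)|
  <= 140 * 100 * l ^+ 4 * L ^+ 9.
Proof.
move=> h0 hP.
have VV : L ^+ 2 * L ^+ 2 = L ^+ 4 by rewrite -exprD.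
have L24 : L ^+ 2 <= L ^+ 4 by rewrite ler_weXn2l //; move: L20; lra.
have lnm (n : nat) : (0 < n)%N -> ln (n%:R : R) <= ln (n.+1%:R : R).
  by move=> n0; rewrite ler_ln ?posrE ?ltr0n // ler_nat.
have Hsum : \sum_(1 <= m < V.+1) m%:R^-1 <= 2 * l := harm V1 VZ2.
have [G GE] : exists G : R, G = 716 by exists 716.
have G0 : 0 <= G by rewrite GE; lra.
have cst (y : R) : \sum_(1 <= m < V.+1) y = V%:R * y by rewrite sumr_const_nat subn1 mulr_natl.
have T1 : `|\sum_(1 <= m < V.+1) moebius R m * \sum_(1 <= k < Z) ln k%:R * block_wave h (m * k)|
   <= l * (G * (6 * L ^+ 5 * L ^+ 2 + L ^+ 6 * (2 * l))).
  apply: le_trans (ler_norm_sum _ _ _) _.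
  apply: (@le_trans _ _ (\sum_(1 <= m < V.+1) l * (G * (6 * L ^+ 5 + L ^+ 6 / m%:R)))).
    rewrite [leLHS]big_nat [leRHS]big_nat; apply: ler_sum => m /andP[m1 mV].
    rewrite normrM -[leRHS]mul1r; apply: ler_pM => //; first exact: moebius_abs.
    rewrite GE; apply: type_I_sum => //.
    by apply: le_trans L24; apply: le_trans VL; rewrite ler_nat -ltnS.
  rewrite -!mulr_sumr big_split /= cst -mulr_sumr.
  apply: ler_wpM2l; first exact: ltW.
  apply: ler_wpM2l => //; apply: lerD.
    by rewrite mulrC ler_wpM2l // mulr_ge0 // ltW.
  by rewrite ler_wpM2l // ltW.
have T2 : `|\sum_(1 <= m < V.+1) \sum_(1 <= c < V.+1)
        moebius R m * vonMangoldt R c * \sum_(1 <= j < Z) block_wave h (m * c * j)|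
   <= l * (l * (G * (6 * L ^+ 5 * L ^+ 4 + L ^+ 6 * ((2 * l) * (2 * l))))).
  apply: le_trans (ler_norm_sum _ _ _) _.
  apply: (@le_trans _ _ (\sum_(1 <= m < V.+1) \sum_(1 <= c < V.+1)
     l * (l * (G * (6 * L ^+ 5 + L ^+ 6 * (m%:R^-1 * c%:R^-1)))))).
    rewrite [leLHS]big_nat [leRHS]big_nat; apply: ler_sum => m /andP[m1 mV].
    apply: le_trans (ler_norm_sum _ _ _) _.
    rewrite [leLHS]big_nat [leRHS]big_nat; apply: ler_sum => c /andP[c1 cV].
    rewrite normrM; apply: ler_pM => //.
      rewrite normrM -[leRHS]mul1r; apply: ler_pM => //; first exact: moebius_abs.
      rewrite ger0_norm ?vonMangoldt_ge0 //; apply: le_trans (vonMangoldt_le_ln R c1) _.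
      have cZ : (0 < c < Z)%N by rewrite c1; apply: leq_ltn_trans VZ2; rewrite -ltnS.
      by case/andP: (ln_le cZ).
    (* The sum without weight is written with the constant weight [l], which [type_I_sum]
       accepts. *)
    have -> : \sum_(1 <= j < Z) block_wave h (m * c * j) =
       l^-1 * \sum_(1 <= j < Z) l * block_wave h (m * c * j).
      by rewrite -mulr_sumr mulKf // gt_eqF.
    have mc0 : (0 < m * c)%N by rewrite muln_gt0 m1 c1.
    have mcL : (m * c)%:R <= L ^+ 4.
      rewrite natrM -VV; apply: ler_pM => //; apply: le_trans VL; by rewrite ler_nat -ltnS.
    have ll : 0 <= l <= l by rewrite (ltW l0) lexx.
    have := @type_I_sum h (m * c) (fun=> l) h0 hP mc0 mcL (fun _ _ => ll) (fun _ _ => lexx l).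
    rewrite -GE natrM invfM => HI.
    rewrite normrM ger0_norm ?invr_ge0 ?(ltW l0) // mulrC ler_pdivrMr //.
    rewrite [leRHS]mulrAC; apply: le_trans HI _.
    have q0 : 0 <= G * (6 * L ^+ 5 + L ^+ 6 * (m%:R^-1 * c%:R^-1)).
      have i0 : 0 <= L ^+ 6 * (m%:R^-1 * c%:R^-1).
        by rewrite mulr_ge0 ?(ltW (Ln _)) // mulr_ge0 ?invr_ge0.
      by rewrite mulr_ge0 // addr_ge0 // mulr_ge0 ?(ltW (Ln _)).
    by rewrite -mulrA ler_wpM2l ?(ltW l0) // ler_peMl.
  have -> : \sum_(1 <= m < V.+1) \sum_(1 <= c < V.+1)
     l * (l * (G * (6 * L ^+ 5 + L ^+ 6 * (m%:R^-1 * c%:R^-1)))) =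
     l * (l * (G * (V%:R * (V%:R * (6 * L ^+ 5)) + L ^+ 6 *
       ((\sum_(1 <= m < V.+1) m%:R^-1) * (\sum_(1 <= c < V.+1) c%:R^-1))))).
    rewrite -(cst (6 * L ^+ 5)) -cst big_distrl mulr_sumr -big_split /= !mulr_sumr.
    apply: eq_bigr => m _; rewrite !mulr_sumr -big_split /= !mulr_sumr.
    by apply: eq_bigr => c _.
  have Hs0 : 0 <= \sum_(1 <= m < V.+1) m%:R^-1 :> R by apply: sumr_ge0 => m _; rewrite invr_ge0.
  rewrite !ler_wpM2l ?(ltW l0) //; apply: lerD.
    have -> : V%:R * (V%:R * (6 * L ^+ 5)) = 6 * L ^+ 5 * (V%:R * V%:R) by ring.
    have c6 : 0 <= 6 * L ^+ 5 by move: (Ln 5%N); lra.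
    by apply: ler_wpM2l => //; rewrite -VV; apply: ler_pM.
  by rewrite ler_wpM2l ?(ltW (Ln _)) //; apply: ler_pM.
have lk k : (k <= 4)%N -> l ^+ k <= l ^+ 4 by move=> k4; rewrite ler_weXn2l.
have Lk k : (k <= 9)%N -> L ^+ k <= L ^+ 9.
  by move=> k9; rewrite ler_weXn2l //; move: L20; lra.
have lL k k' : (k <= 4)%N -> (k' <= 9)%N -> l ^+ k * L ^+ k' <= l ^+ 4 * L ^+ 9.
  by move=> k4 k9; apply: ler_pM; [rewrite exprn_ge0 // ltW | exact: ltW | exact: lk | exact: Lk].
apply: le_trans (ler_normB _ _) _; apply: le_trans (lerD T1 T2) _.
have X0 : 0 <= l ^+ 4 * L ^+ 9 by apply/ltW/mulr_gt0; [exact: exprn_gt0 | exact: Ln].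
move: X0 (lL 1 7 isT isT) (lL 2 6 isT isT) (lL 2 9 isT isT) (lL 4 6 isT isT).
by rewrite GE; lra.
Qed.

Let ln_leZ (k : nat) : (0 < k <= Z)%N -> 0 <= ln (k%:R : R) <= l.
Proof.
move=> /andP[k0 kZ]; rewrite ln_ge0 ?ler1n //=; apply: le_trans lnP.
by rewrite ler_ln ?posrE ?ltr0n // -?natrM ?ltr0n ?muln_gt0 ?P0 // ler_nat.
Qed.

Lemma dyadic_split (f : nat -> R) (a b : nat) : (a <= b)%N ->
  \sum_(2 ^ a <= m < 2 ^ b) f m = \sum_(a <= e < b) \sum_(2 ^ e <= m < 2 * 2 ^ e) f m.
Proof.
elim: b => [|b IH]; first by rewrite leqn0 => /eqP ->; rewrite !big_geq.
rewrite leq_eqVlt => /predU1P[-> | ]; first by rewrite !big_geq.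
rewrite ltnS => ab; rewrite big_nat_recr //= -IH // -expnS.
by rewrite -big_cat_nat //= leq_exp2l.
Qed.

(** When [M <= m < 2 M] and [M N = P], only [k < 2 N] meets the block. The condition on [i0] ensures
    [N <= 2 M], so Cauchy-Schwarz goes over the longer variable. *)
Lemma type_II_dyadic (a b c : nat -> R) (H i0 : nat) :
  (0 < H)%N -> H%:R * L ^+ 9 <= P%:R -> (i <= 2 * i0 + 1)%N -> (i0 <= i)%N ->
  (forall h, `|c h| <= 1) -> (forall m, (0 < m <= Z)%N -> `|a m| <= l) ->
  (forall n, (0 < n <= Z)%N -> `|b n| <= l) -> (forall n, (n <= V)%N -> b n = 0) ->
  `|\sum_(j < H) c (H + j)%N * \sum_(2 ^ i0 <= m < Z) a m *
      \sum_(1 <= k < Z) b k * block_wave (H + j) (m * k)|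
  <= i.+1%:R * (3000 * l ^+ 3 * H%:R * L ^+ 9).
Proof.
move=> H0 HL i0i i0le c1 al bl b0.
have ZE : Z = (2 ^ i.+1)%N by rewrite /Z /P expnS.
set T := (X in `|X|).
have TE : T = \sum_(i0 <= e < i.+1) \sum_(j < H) c (H + j)%N * \sum_(2 ^ e <= m < 2 * 2 ^ e) a m *
      \sum_(1 <= k < Z) b k * block_wave (H + j) (m * k).
  rewrite exchange_big /=; apply: eq_bigr => j _; rewrite -mulr_sumr; congr (_ * _).
  by rewrite -dyadic_split ?(leqW i0le) // -ZE.
have Hh0 : 0 <= 3000 * l ^+ 3 * H%:R * L ^+ 9.
  have : 0 <= l ^+ 3 * (H%:R * L ^+ 9).
    by rewrite mulr_ge0 ?exprn_ge0 ?(ltW l0) // mulr_ge0 // ltW.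
  lra.
have HR1 : H%:R <= L.
  have h9 : H%:R * L ^+ 9 <= L * L ^+ 9 by rewrite -exprS; apply: le_trans PL.
  by move: h9; rewrite ler_pM2r.
rewrite TE; apply: le_trans (ler_norm_sum _ _ _) _.
apply: (@le_trans _ _ (\sum_(i0 <= e < i.+1) (3000 * l ^+ 3 * H%:R * L ^+ 9))); last first.
  by rewrite sumr_const_nat -[leLHS]mulr_natl; apply: ler_wpM2r => //; rewrite ler_nat leq_subr.
rewrite [leLHS]big_nat [leRHS]big_nat; apply: ler_sum => e /andP[ie ei].
pose M := (2 ^ e)%N; pose N := (2 ^ (i - e))%N.
have MN : (M * N)%N = P by rewrite /M /N /P -expnD subnKC.
have N0 : (0 < N)%N by rewrite expn_gt0.
have M0 : (0 < M)%N by rewrite expn_gt0.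
have NZ : (2 * N <= Z)%N by rewrite /Z -MN leq_mul2l /= leq_pmull.
have MZ : (2 * M <= Z)%N by rewrite /Z -MN leq_mul2l /= leq_pmulr.
have -> : \sum_(j < H) c (H + j)%N * \sum_(2 ^ e <= m < 2 * 2 ^ e) a m *
      \sum_(1 <= k < Z) b k * block_wave (H + j) (m * k) =
   \sum_(j < H) c (H + j)%N * \sum_(M <= m < 2 * M) a m * \sum_(q < 2 * N) b q.+1 *
     ((P <= m * q.+1 < 2 * P)%N%:R * cos (phase x dl (H + j) (m * q.+1) + ph)).
  apply: eq_bigr => j _; congr (_ * _); apply: eq_big_nat => m /andP[Mm _]; congr (_ * _).
  have van k : (2 * N <= k)%N -> b k * block_wave (H + j) (m * k) = 0.
    move=> Nk; rewrite /block_wave; have -> : (m * k < 2 * P)%N = false.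
      apply/negbTE; rewrite -leqNgt -MN.
      have -> : (2 * (M * N) = M * (2 * N))%N by rewrite mulnCA.
      exact: leq_mul.
    by rewrite andbF mul0r mulr0.
  have N1 : (1 <= 2 * N)%N by rewrite muln_gt0.
  rewrite (big_cat_nat N1 NZ) /= [X in _ + X]big_nat [X in _ + X]big1 ?addr0; last first.
    by move=> k /andP[Nk _]; apply: van.
  have -> : \sum_(q < 2 * N) b q.+1 * ((P <= m * q.+1 < 2 * P)%N%:R *
      cos (phase x dl (H + j) (m * q.+1) + ph)) =
    \sum_(1 <= k < (2 * N).+1) b k * block_wave (H + j) (m * k).
    by rewrite big_add1 /= big_mkord.
  by rewrite big_nat_recr //= van // addr0.
(* If [4 N < L^2], every second variable is at most [2 N <= V], where the coefficient [b]
   vanishes. *)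
have [LN|LN] := leP (L ^+ 2) (4 * N%:R); last first.
  rewrite big1 ?normr0 // => j _; rewrite big1 ?mulr0 // => m _; rewrite big1 ?mulr0 // => q _.
  rewrite b0 ?mul0r // /V truncn_ge_nat ?(ltW (Ln _)) //.
  have : q.+1%:R <= 2 * N%:R :> R by rewrite -natrM ler_nat ltn_ord.
  have : 0 < N%:R :> R by rewrite ltr0n.
  by move: LN; lra.
have MR : 0 < M%:R :> R by rewrite ltr0n.
(* Use of [L >= 20]: [2 M^2 >= L^9] and [L^3 >= 8000] give [M >= 32 L^3], and then [H <= L] gives
   [M >= 448 H]. *)
have L3 : 400 * 20 <= L ^+ 3.
  have -> : L ^+ 3 = L * L * L by rewrite !exprS expr0 mulr1 mulrA.
  have L400 : 20 * 20 <= L * L by apply: ler_pM.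
  have c20 : 0 <= 20 :> R by lra.
  have c400 : 0 <= 20 * 20 :> R by lra.
  by have := ler_pM c400 c20 L400 L20; lra.
have M2 : L ^+ 9 <= 2 * M%:R ^+ 2.
  apply: le_trans LP _; rewrite -natrX -natrM ler_nat /P /M -expnM -expnS leq_exp2l //.
  by move: i0i ie; clear; lia.
have M32 : 32 * L ^+ 3 <= M%:R.
  apply: ler_of_sqr; first exact: ltW.
  have -> : (32 * L ^+ 3) ^+ 2 = 1024 * (L ^+ 6) by ring.
  have := ler_wpM2l (ltW (Ln 6%N)) L3; rewrite -exprD; move: M2 (Ln 6%N); lra.
have M448 : (448 * H <= M)%N.
  rewrite -(ler_nat R) natrM; apply: le_trans M32.
  have L14 : 14 * L <= L ^+ 3.
    have -> : L ^+ 3 = (L * L) * L by rewrite !exprS expr0 mulr1 mulrA.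
    have L400 : 20 * 20 <= L * L by apply: ler_pM.
    by rewrite ler_wpM2r //; [move: L20; lra | move: L400; lra].
  by move: L14 HR1; lra.
rewrite -MN; apply: (@type_II_sum R x L dl ph l M N H (M * N) (2 * (M * N)) a b c) => //.
- by rewrite MN.
- by rewrite MN.
- by rewrite /N /M -expnS leq_exp2l //; move: i0i ie; clear; lia.
- have -> : (2 * H = (2 * H).-1.+1)%N by rewrite prednK // muln_gt0.
  apply: harm; first by move: H0; clear; lia.
  have : (H <= P)%N.
    rewrite -(ler_nat R); apply: le_trans HL; rewrite ler_peMr // exprn_ege1 //; move: L20; lra.
  by rewrite /Z; move: P H0; clear => p; lia.
- by move=> m /andP[m1 m2]; apply: al; rewrite (leq_trans M0 m1) (leq_trans (ltnW m2) MZ).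
- by move=> n /andP[n1 n2]; apply: bl; rewrite n1 (leq_trans n2 NZ).
Qed.

(** The bilinear region is cut at [m = Y], near [sqrt P]. For [m >= Y] Cauchy-Schwarz runs over [m];
    for [m < Y] the condition [m k >= P] forces [k >= 2 ^ i./2] and the roles are exchanged, with
    the cut coefficient [a']. Both coefficients vanish up to [V], so either can belong to the short
    variable. The factor [c] is left arbitrary in order to carry signs. *)
Lemma block_bound (c : nat -> R) (H : nat) :
  (0 < H)%N -> H%:R * L ^+ 9 <= P%:R -> (forall h, `|c h| <= 1) ->
  `|\sum_(j < H) c (H + j)%N * \sum_(1 <= d < Z) vonMangoldt R d * block_wave (H + j) d|
  <= 320 * 100 * l ^+ 4 * H%:R * L ^+ 9.
Proof.
move=> H0 HL c1.
have ZE : Z = (2 ^ i.+1)%N by rewrite /Z /P expnS.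
have bwZ h n : (Z <= n)%N -> block_wave h n = 0.
  by move=> Zn; rewrite /block_wave [(n < _)%N]ltnNge Zn andbF mul0r.
have bwP h n : (n < P)%N -> block_wave h n = 0.
  by move=> nP; rewrite /block_wave leqNgt nP mul0r.
have bwV h n : (n <= V)%N -> block_wave h n = 0.
  by move=> nV; apply: bwP; apply: leq_ltn_trans VZ1.
pose a m : R := if (V < m)%N then moebius R m else 0.
pose b := vonMangoldt_tail R V.
have il : i.+1%:R <= 2 * l := log2_bound lnP.
have a1 m : (0 < m <= Z)%N -> `|a m| <= l.
  move=> _; rewrite /a; case: ifP => _; last by rewrite normr0 ltW.
  by apply: le_trans l1; apply: moebius_abs.
have b1 n : (0 < n <= Z)%N -> `|b n| <= l.
  move=> nZ; have /andP[n0 _] := nZ; have /andP[t0 t1] := vonMangoldt_tail_bound R V n0.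
  by rewrite ger0_norm //; apply: le_trans t1 _; case/andP: (ln_leZ nZ).
pose TI h := \sum_(1 <= m < V.+1) moebius R m * \sum_(1 <= k < Z) ln k%:R * block_wave h (m * k)
    - \sum_(1 <= m < V.+1) \sum_(1 <= c < V.+1)
        moebius R m * vonMangoldt R c * \sum_(1 <= j < Z) block_wave h (m * c * j).
pose Y := (2 ^ uphalf i)%N.
have Y1 : (1 <= Y)%N by rewrite expn_gt0.
have YZ : (Y <= Z)%N by rewrite ZE leq_exp2l // uphalf_half; clear; lia.
pose a' m : R := if (m < Y)%N then a m else 0.
pose TA h := \sum_(2 ^ uphalf i <= m < Z) a m * \sum_(1 <= k < Z) b k * block_wave h (m * k).
pose TB h := \sum_(2 ^ i./2 <= m < Z) b m * \sum_(1 <= k < Z) a' k * block_wave h (m * k).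
have dec h : \sum_(1 <= d < Z) vonMangoldt R d * block_wave h d = TI h + (TB h + TA h).
  rewrite (@vaughan R Z V (block_wave h) (bwZ h) (bwV h) V VZ2 VZ2) -/(TI h); congr (_ + _).
  transitivity (\sum_(1 <= m < Z) a m * \sum_(1 <= k < Z) b k * block_wave h (m * k)).
    have VZ' : (V.+1 <= Z)%N by exact: VZ2.
    rewrite [RHS](big_cat_nat (n := V.+1)) //=.
    rewrite [X in X + _]big_nat [X in X + _]big1 ?add0r; last first.
      by move=> m /andP[_ mV]; rewrite /a ltnNge -ltnS mV mul0r.
    apply: eq_big_nat => m /andP[Vm _]; rewrite /a Vm mulr_sumr.
    by apply: eq_bigr => k _; rewrite mulrA.
  rewrite (big_cat_nat Y1 YZ) /=; congr (_ + _).
  transitivity (\sum_(1 <= m < Z) \sum_(1 <= k < Z) b k * (a' m * block_wave h (k * m))).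
    rewrite [RHS](big_cat_nat Y1 YZ) /= [X in _ + X]big_nat [X in _ + X]big1 ?addr0.
      apply: eq_big_nat => m /andP[_ mY]; rewrite mulr_sumr; apply: eq_bigr => k _.
      by rewrite /a' mY [(m * k)%N]mulnC; ring.
    move=> m /andP[Ym _]; rewrite big1 // => k _.
    by rewrite /a' ltnNge Ym mul0r mulr0.
  rewrite exchange_big /=.
  have h1 : (1 <= 2 ^ i./2)%N by rewrite expn_gt0.
  have h2 : (2 ^ i./2 <= Z)%N by rewrite ZE leq_exp2l //; clear; lia.
  rewrite (big_cat_nat h1 h2) /= [X in X + _]big_nat [X in X + _]big1 ?add0r.
    by apply: eq_bigr => k _; rewrite mulr_sumr.
  move=> k /andP[_ ki]; rewrite big1 // => m _; rewrite /a'; case: ifP => mY; last by rewrite mul0r mulr0.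
  rewrite bwP ?mulr0 //.
  have -> : P = (2 ^ i./2 * Y)%N.
    rewrite /P /Y -expnD; congr (_ ^ _)%N; rewrite uphalf_half; have := odd_double_half i; clear; lia.
  by apply: ltn_mul.
have cTI : `|\sum_(j < H) c (H + j)%N * TI (H + j)%N| <= H%:R * (140 * 100 * l ^+ 4 * L ^+ 9).
  apply: le_trans (ler_norm_sum _ _ _) _.
  rewrite -[H in H%:R]card_ord mulr_natl -sumr_const; apply: ler_sum => j _.
  rewrite normrM -[leRHS]mul1r; apply: ler_pM => //; apply: type_I_total.
    by rewrite addn_gt0 H0.
  have : (H + j)%:R <= 2 * H%:R :> R by rewrite -natrM ler_nat; have := ltn_ord j; clear; lia.
  move=> /(fun h => ler_wpM2r (ltW (Ln 9%N)) h); move: HL; lra.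
have iu : (i <= 2 * uphalf i + 1)%N by rewrite uphalf_half; have := odd_double_half i; clear; lia.
have iu' : (uphalf i <= i)%N by clear; lia.
have ih : (i <= 2 * i./2 + 1)%N by have := odd_double_half i; clear; lia.
have ih' : (i./2 <= i)%N by clear; lia.
have cTA := type_II_dyadic H0 HL iu iu' c1 a1 b1 (@vonMangoldt_tail_small R V).
have a'1 n : (0 < n <= Z)%N -> `|a' n| <= l.
  by move=> nZ; rewrite /a'; case: ifP => _; [exact: a1 | rewrite normr0 ltW].
have a'0 n : (n <= V)%N -> a' n = 0.
  by move=> nV; rewrite /a' /a [(V < n)%N]ltnNge nV /=; case: ifP.
have cTB := type_II_dyadic H0 HL ih ih' c1 b1 a'1 a'0.
have -> : \sum_(j < H) c (H + j)%N * \sum_(1 <= d < Z) vonMangoldt R d * block_wave (H + j) d =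
  \sum_(j < H) c (H + j)%N * TI (H + j)%N + (\sum_(j < H) c (H + j)%N * TB (H + j)%N +
  \sum_(j < H) c (H + j)%N * TA (H + j)%N).
  by rewrite -!big_split /=; apply: eq_bigr => j _; rewrite dec !mulrDr.
have K0 : 0 <= 3000 * l ^+ 3 * H%:R * L ^+ 9.
  have : 0 <= l ^+ 3 * (H%:R * L ^+ 9).
    by rewrite mulr_ge0 ?exprn_ge0 ?(ltW l0) // mulr_ge0 // ltW.
  lra.
have ilK := ler_wpM2r K0 il.
apply: le_trans (ler_normD _ _) _.
have := ler_normD (\sum_(j < H) c (H + j)%N * TB (H + j)%N) (\sum_(j < H) c (H + j)%N * TA (H + j)%N).
move: cTI; move: (le_trans cTA ilK) (le_trans cTB ilK); rewrite -/(TA _) -/(TB _).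
have -> : 2 * l * (3000 * l ^+ 3 * H%:R * L ^+ 9) = 60 * 100 * (l ^+ 4 * H%:R * L ^+ 9) by ring.
have -> : H%:R * (140 * 100 * l ^+ 4 * L ^+ 9) = 140 * 100 * (l ^+ 4 * H%:R * L ^+ 9) by ring.
have -> : 320 * 100 * l ^+ 4 * H%:R * L ^+ 9 = 320 * 100 * (l ^+ 4 * H%:R * L ^+ 9) by ring.
have : 0 <= l ^+ 4 * H%:R * L ^+ 9.
  by apply: mulr_ge0; [apply: mulr_ge0 => //; rewrite exprn_ge0 // ltW | exact: ltW].
move: (l ^+ 4 * H%:R * L ^+ 9) => q; lra.
Qed.

End Blocks.

(** * Sawtooth sums over one dyadic block *)

Lemma saw_total_bound (R : realType) (l u hs w s1 s2 : R) :
  1 <= l -> 0 <= u -> 0 <= hs <= 2 * l -> 0 <= w <= 2 * l * u -> 0 <= s2 ->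
  s1 <= 2 * l * (320 * 100 * l ^+ 4 * u) -> s2 <= 2 * l * (320 * 100 * l ^+ 4 * u) ->
  s1 + 32 * hs * (w + 2 * s2) <= 200 * 200 * 300 * l ^+ 6 * u.
Proof.
move=> l1 u0 /andP[hs0 hs1] /andP[w0 w1] s20 t1 t2.
have l0 : 0 <= l by apply: le_trans l1.
have ws0 : 0 <= w + 2 * s2 by clear - w0 s20; lra.
have ws : w + 2 * s2 <= 2 * l * u + 2 * (2 * l * (320 * 100 * l ^+ 4 * u)) by clear - w1 t2; lra.
have := ler_pM hs0 ws0 hs1 ws.
have e1 : l ^+ 5 * u <= l ^+ 6 * u by rewrite ler_wpM2r // ler_weXn2l.
have e2 : l ^+ 2 * u <= l ^+ 6 * u by rewrite ler_wpM2r // ler_weXn2l.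
have e0 : 0 <= l ^+ 6 * u by rewrite mulr_ge0 // exprn_ge0.
by move: t1 e0 e1 e2; clear; lra.
Qed.

Section BlockSaw.
Variables (R : realType) (x L dl l : R) (i : nat).
Hypotheses (L20 : 20 <= L) (xE : x = L ^+ 19) (dl01 : 0 <= dl <= 1).
Hypotheses (LP : L ^+ 9 <= (2 ^ i)%:R) (PL : (2 ^ i)%:R <= L ^+ 10).
Hypotheses (l1 : 1 <= l) (lnP : ln (2 * (2 ^ i)%:R) <= l).
Let P := (2 ^ i)%N.
Let Ln k : 0 < L ^+ k. Proof. by rewrite exprn_gt0 // (lt_le_trans _ L20). Qed.
Let P0 : (0 < P)%N. Proof. by rewrite expn_gt0. Qed.
Let PR : 0 < P%:R :> R. Proof. by rewrite ltr0n. Qed.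
Let l0 : 0 < l. Proof. exact: lt_le_trans l1. Qed.

Let S ph h : R := \sum_(P <= d < 2 * P) vonMangoldt R d * cos (phase x dl h d + ph).

(** Choosing [c h] as the sign of the inner sum lets [block_bound] control absolute values over a
    dyadic range of [h]. The weight [1 / h <= 1 / H] cancels its factor [H], so all [J] ranges cost
    the same. *)
Lemma dyadic_wave_sum (ph : R) (J : nat) : (2 ^ J)%:R * L ^+ 9 <= 2 * P%:R ->
  \sum_(1 <= h < 2 ^ J) `|S ph h| / h%:R <= J%:R * (320 * 100 * l ^+ 4 * L ^+ 9).
Proof.
move=> JP; rewrite -[1%N](expn0 2) dyadic_split //.
have -> : J%:R * (320 * 100 * l ^+ 4 * L ^+ 9) = \sum_(0 <= e < J) (320 * 100 * l ^+ 4 * L ^+ 9).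
  by rewrite sumr_const_nat subn0 -[RHS]mulr_natl.
rewrite [leLHS]big_nat [leRHS]big_nat; apply: ler_sum => e /andP[_ eJ].
set H := (2 ^ e)%N; have H0 : (0 < H)%N by rewrite expn_gt0.
have HR : 0 < H%:R :> R by rewrite ltr0n.
have HL : H%:R * L ^+ 9 <= P%:R.
  have : (2 * H)%:R <= (2 ^ J)%:R :> R by rewrite ler_nat /H -expnS leq_exp2l.
  by move=> /(fun h => ler_wpM2r (ltW (Ln 9%N)) h); rewrite natrM; move: JP; lra.
pose c h := Num.sg (S ph h).
have c1 h : `|c h| <= 1 by rewrite /c normr_sg; case: (_ != 0).
have := @block_bound R x L dl ph l i L20 xE dl01 LP PL l1 lnP c H H0 HL c1.
have -> : \sum_(j < H) c (H + j)%N *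
     (\sum_(1 <= d < 2 * 2 ^ i) vonMangoldt R d * block_wave x dl ph i (H + j) d) =
  \sum_(j < H) `|S ph (H + j)%N|.
  apply: eq_bigr => j _; rewrite normrEsg -/(c _); congr (_ * _).
  rewrite /S -(@sum_indicator_interval R (fun d => vonMangoldt R d * cos (phase x dl (H + j) d + ph)) 1 (2 * P)) //.
  by apply: eq_bigr => d _; rewrite /block_wave; ring.
rewrite ger0_norm ?sumr_ge0 // => HB.
have -> : \sum_(H <= h < 2 * H) `|S ph h| / h%:R = \sum_(j < H) `|S ph (H + j)%N| / (H + j)%:R.
  rewrite -{1}[H]add0n big_addn mul2n -addnn addnK big_mkord.
  by apply: eq_bigr => j _; rewrite addnC.
apply: (@le_trans _ _ ((\sum_(j < H) `|S ph (H + j)%N|) / H%:R)).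
  rewrite mulr_suml; apply: ler_sum => j _; rewrite ler_wpM2l // lef_pV2 ?posrE ?ltr0n ?addn_gt0 ?H0 //.
  by rewrite ler_nat leq_addr.
by rewrite ler_pdivrMr // [leRHS]mulrAC.
Qed.

(** Two demands fix the degree [Hm] near [P / L^9]: the frequency 0 term, at most [P l / Hm], must
    be [O(l L^9)], and [dyadic_wave_sum] needs [2 ^ J * L^9 <= 2 P]. Being one less than a power of
    two, [Hm] makes the frequencies a union of full dyadic ranges. The phases [- pi / 2] and 0 give
    the sine and the cosine sums. *)
Lemma block_saw : `|\sum_(P <= d < 2 * P) vonMangoldt R d * saw (x / (d%:R + dl))|
  <= 200 * 200 * 300 * l ^+ 6 * L ^+ 9.
Proof.
pose y : R := 2 * P%:R / L ^+ 9.
have yE : y * L ^+ 9 = 2 * P%:R by rewrite divfK // gt_eqF.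
have y2 : 2 <= y by rewrite ler_pdivlMr // ler_wpM2l.
have y0 : 0 <= y by lra.
have /andP[q1 q2] := truncn_itv y0; set q := Num.truncn y in q1 q2.
have q_ge2 : (2 <= q)%N by rewrite truncn_ge_nat.
have q0 : (0 < q)%N by apply: leq_trans q_ge2.
pose J := trunc_log 2 q.
have /andP[j1 j2] : (2 ^ J <= q < 2 ^ J.+1)%N by apply: trunc_log_bounds.
have JP : (2 ^ J)%:R * L ^+ 9 <= 2 * P%:R.
  by rewrite -yE ler_wpM2r ?(ltW (Ln _)) //; apply: le_trans q1; rewrite ler_nat.
have J1 : (1 <= J)%N.
  by rewrite lt0n; apply/eqP => J0; move: j2; rewrite J0 expn1 ltnNge q_ge2.
have JE : (2 ^ J = (2 ^ J).-1.+1)%N by rewrite prednK // expn_gt0.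
set Hm := (2 ^ J).-1 in JE.
have Hm0 : (0 < Hm)%N.
  have : (2 ^ 1 <= 2 ^ J)%N by rewrite leq_exp2l.
  by rewrite JE expn1.
have L9 : 1 <= L ^+ 9 by rewrite exprn_ege1 //; move: L20; lra.
have JZ : (2 ^ J)%:R <= 2 * P%:R :> R.
  by apply: le_trans JP; rewrite ler_peMr.
have Jl : J%:R <= 2 * l.
  apply: le_trans (log2_bound lnP); rewrite ler_nat.
  by move: JZ; rewrite -natrM ler_nat /P -expnS leq_exp2l.
have harm : harmonic_sum R Hm.+1 <= 2 * l.
  apply: le_trans (harmonic_sum_le R Hm0) _.
  have : ln (Hm%:R : R) <= ln (2 * P%:R).
    rewrite ler_ln ?posrE ?ltr0n ?mulr_gt0 //; apply: le_trans JZ.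
    by rewrite ler_nat JE.
  by move: lnP l1; rewrite -/P; lra.
have harm0 : 0 <= harmonic_sum R Hm.+1 by apply: sumr_ge0 => k _; rewrite invr_ge0.
have [dl0 dl1] := andP dl01.
have x0 : 0 < x by rewrite xE.
have yd0 d : 0 <= x / (d%:R + dl) by rewrite divr_ge0 ?(ltW x0) // addr_ge0.
have := @saw_weighted_sum R Hm P (2 * P) (fun d => vonMangoldt R d) (fun d => x / (d%:R + dl)) Hm0
  (fun d => vonMangoldt_ge0 R d) yd0.
rewrite -JE => Hsaw; apply: le_trans Hsaw _.
have Esin : \sum_(1 <= h < 2 ^ J) `|\sum_(P <= d < 2 * P) vonMangoldt R d *
     sin (2 * pi * h%:R * (x / (d%:R + dl)))| / h%:R = \sum_(1 <= h < 2 ^ J) `|S (- (pi / 2)) h| / h%:R.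
  apply: eq_bigr => h _; congr (`|_| / _); apply: eq_bigr => d _; congr (_ * _).
  by rewrite cosBpihalf /phase; congr sin; ring.
have Ecos : \sum_(1 <= h < 2 ^ J) `|\sum_(P <= d < 2 * P) vonMangoldt R d *
     cos (2 * pi * h%:R * (x / (d%:R + dl)))| / h%:R = \sum_(1 <= h < 2 ^ J) `|S 0 h| / h%:R.
  apply: eq_bigr => h _; congr (`|_| / _); apply: eq_bigr => d _; congr (_ * _).
  by rewrite addr0 /phase; congr cos; ring.
rewrite Esin Ecos.
have T1 := dyadic_wave_sum (- (pi / 2)) JP; have T2 := dyadic_wave_sum 0 JP.
have K0 : 0 <= l ^+ 4 * L ^+ 9 by apply: mulr_ge0; [rewrite exprn_ge0 // ltW | exact: ltW].
have K1 : 0 <= 320 * 100 * l ^+ 4 * L ^+ 9 by lra.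
have JK := ler_wpM2r K1 Jl.
have Wb : (\sum_(P <= d < 2 * P) vonMangoldt R d) / Hm%:R <= 2 * l * L ^+ 9.
  have HR : 0 < Hm%:R :> R by rewrite ltr0n.
  rewrite ler_pdivrMr //.
  have W1 : \sum_(P <= d < 2 * P) vonMangoldt R d <= P%:R * l.
    have -> : P%:R * l = \sum_(P <= d < 2 * P) l.
      by rewrite sumr_const_nat mul2n -addnn addnK mulr_natl.
    rewrite [leLHS]big_nat [leRHS]big_nat; apply: ler_sum => d /andP[Pd dP].
    have d0 : (0 < d)%N by apply: leq_trans Pd.
    apply: le_trans (vonMangoldt_le_ln R d0) _; apply: le_trans lnP.
    rewrite ler_ln ?posrE ?ltr0n ?mulr_gt0 //.
    by rewrite -natrM ler_nat ltnW.
  apply: le_trans W1 _.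
  have H2 : P%:R <= 2 * Hm%:R * L ^+ 9.
    have : y <= 4 * Hm%:R.
      apply: le_trans (ltW q2) _; rewrite -natrM ler_nat.
      apply: (leq_trans j2); rewrite expnS; have := JE; have := Hm0; clear; lia.
    by move=> /(fun h => ler_wpM2r (ltW (Ln 9%N)) h); rewrite yE; lra.
  by have := ler_wpM2l (ltW l0) H2; lra.
have S20 : 0 <= \sum_(1 <= h < 2 ^ J) `|S 0 h| / h%:R by apply: sumr_ge0 => h _; rewrite divr_ge0.
have W0 : 0 <= (\sum_(P <= d < 2 * P) vonMangoldt R d) / Hm%:R.
  by rewrite divr_ge0 // sumr_ge0 // => d _; apply: vonMangoldt_ge0.
rewrite -JE in harm harm0.
move: (le_trans T1 JK) (le_trans T2 JK) Wb S20 W0 harm0 harm.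
set s1 := \sum_(1 <= h < _) `|S _ h| / _; set s2 := \sum_(1 <= h < _) `|S 0 h| / _.
move=> T1' T2' Wb S20 W0 harm0 harm.
by apply: saw_total_bound => //; [exact: ltW | rewrite harm0 | rewrite W0].
Qed.

End BlockSaw.

(** * From the floor sum to sawtooth sums *)

Section FloorSum.
Variables (R : realType) (x : R).
Hypothesis x1 : 1 <= x.

Let t (n : nat) : nat := Num.truncn (x / n%:R).

Let x0 : 0 <= x. Proof. by apply: le_trans x1. Qed.

(** Both conditions mean [d * n <= x]. *)
Let t_ge (d n : nat) : (0 < d)%N -> (0 < n)%N -> (d <= t n)%N = (n <= t d)%N.
Proof.
move=> d0 n0; rewrite !truncn_ge_nat ?divr_ge0 //.
by rewrite !ler_pdivlMr ?ltr0n // mulrC.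
Qed.

Let count_t (d : nat) : (0 < d)%N ->
  \sum_(1 <= n < (Num.truncn x).+1) (d <= t n)%N%:R = (t d)%:R :> R.
Proof.
move=> d0; have tX : (t d <= Num.truncn x)%N.
  apply: le_truncn; rewrite ler_pdivrMr ?ltr0n // ler_peMr // ler1n //.
have -> : (t d)%:R = \sum_(1 <= n < (t d).+1) (1 : R) by rewrite sumr_const_nat subn1.
rewrite -(@sum_indicator_interval R (fun=> 1) 1 (Num.truncn x).+1) //.
by apply: eq_big_nat => n /andP[n1 _]; rewrite t_ge // mulr1 n1 ltnS.
Qed.

(** The indicator of [t n = d] is a difference of two threshold indicators, whose sums over [n] are
    [t d] and [t d.+1] by the symmetry of [d * n <= x]. *)
Lemma floor_sum_split (f : nat -> R) (B : nat) : f 0%N = 0 -> (0 < B)%N ->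
  \sum_(1 <= n < (Num.truncn x).+1) f (t n) =
  \sum_(1 <= d < B) f d * ((t d)%:R - (t d.+1)%:R) +
  \sum_(1 <= n < (Num.truncn x).+1) (B <= t n)%N%:R * f (t n).
Proof.
move=> f0 B0; have point n : f (t n) =
    \sum_(1 <= d < B) f d * ((d <= t n)%N%:R - (d.+1 <= t n)%N%:R) + (B <= t n)%N%:R * f (t n).
  have term d : (1 <= d < B)%N -> f d * ((d <= t n)%N%:R - (d.+1 <= t n)%N%:R) =
      (if d == t n then f d else 0).
    move=> _; case: (ltngtP d (t n)) => [dt|dt|->]; first by rewrite subrr mulr0.
      by rewrite subrr mulr0.
    by rewrite subr0 mulr1.
  rewrite (eq_big_nat _ _ term); have [Bt|tB] := leqP B (t n).
    rewrite mul1r big_nat big1 ?add0r // => d /andP[_ dB].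
    by rewrite ltn_eqF // (leq_trans dB).
  rewrite mul0r addr0; case: (posnP (t n)) => [tn0|tn0].
    by rewrite tn0 f0 big_nat big1 // => d /andP[d1 _]; rewrite gtn_eqF.
  rewrite (bigD1_seq (t n)) ?iota_uniq ?mem_index_iota ?tn0 //= eqxx big1 ?addr0 // => d /negbTE -> //.
rewrite (eq_bigr _ (fun n _ => point n)) big_split /=; congr (_ + _).
rewrite exchange_big /=; apply: eq_big_nat => d /andP[d1 _].
by rewrite -mulr_sumr sumrB !count_t.
Qed.

(** By the same symmetry at most [x / B] indices [n] have [t n >= B]. *)
Lemma floor_sum_large (f : nat -> R) (B : nat) (l : R) : (0 < B)%N -> 0 <= l ->
  (forall d, (0 < d)%N -> d%:R <= x -> 0 <= f d <= l) ->
  0 <= \sum_(1 <= n < (Num.truncn x).+1) (B <= t n)%N%:R * f (t n) <= l * (x / B%:R).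
Proof.
move=> B0 l0 fl; have term n : (0 < n)%N -> 0 <= (B <= t n)%N%:R * f (t n) <= (B <= t n)%N%:R * l.
  move=> n0; have [Bt|tB] := leqP B (t n); last by rewrite !mul0r lexx.
  rewrite !mul1r; apply: fl; first exact: leq_trans Bt.
  apply: le_trans (_ : x / n%:R <= _); first by rewrite /t truncn_le divr_ge0.
  by rewrite ler_pdivrMr ?ltr0n // ler_peMr // ler1n.
apply/andP; split.
  by rewrite big_nat; apply: sumr_ge0 => n /andP[n1 _]; case/andP: (term _ n1).
apply: (@le_trans _ _ (\sum_(1 <= n < (Num.truncn x).+1) (B <= t n)%N%:R * l)).
  rewrite [leLHS]big_nat [leRHS]big_nat; apply: ler_sum => n /andP[n1 _].
  by case/andP: (term _ n1).
by rewrite -mulr_suml count_t // mulrC ler_wpM2l // truncn_le divr_ge0.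
Qed.

(** Writing [d%:R + 0] keeps both sawtooth values in the shape [x / (d + dl)], with [dl] equal to 0
    or 1. *)
Lemma truncn_saw (d : nat) : (0 < d)%N ->
  (t d)%:R - (t d.+1)%:R = x / (d%:R * (d%:R + 1)) - (saw (x / (d%:R + 0)) - saw (x / (d%:R + 1))).
Proof.
move=> d0; have dR : 0 < d%:R :> R by rewrite ltr0n.
have d1 : 0 < d%:R + 1 :> R by rewrite addr_gt0.
have -> : x / (d%:R * (d%:R + 1)) = x / d%:R - x / (d%:R + 1) by field; rewrite !gt_eqF.
by rewrite addr0 /saw /t -natr1; ring.
Qed.

Lemma saw_bound (y : R) : 0 <= y -> `|saw y| <= 1 / 2.
Proof.
move=> /truncn_itv /andP[]; rewrite /saw -natr1 ler_norml.
move: (_%:R : R) => z; lra.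
Qed.

End FloorSum.

(** The tail is compared with the telescoping series of [F d = (ln d + 1) / d], whose decrements are
    at least [ln d / (d (d + 1))] because [d * ln (1 + 1 / d) <= 1]. *)
Lemma vonMangoldt_series_tail (R : realType) (B : nat) : (0 < B)%N ->
  0 <= \big[+%R/0]_(1 <= d <oo) (vonMangoldt R d / (d%:R * (d%:R + 1)))
     - \sum_(1 <= d < B) vonMangoldt R d / (d%:R * (d%:R + 1)) <= (ln B%:R + 1) / B%:R.
Proof.
move=> B0; set a := fun d : nat => vonMangoldt R d / (d%:R * (d%:R + 1)).
have a0 d : 0 <= a d by rewrite divr_ge0 ?vonMangoldt_ge0 // mulr_ge0 // addr_ge0.
pose F (d : nat) : R := (ln d%:R + 1) / d%:R.
have aF d : (0 < d)%N -> a d <= F d - F d.+1.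
  move=> d0; have dR : 0 < d%:R :> R by rewrite ltr0n.
  have dR1 : 0 < d%:R + 1 :> R by rewrite addr_gt0.
  have ln1 : d%:R * (ln (d%:R + 1) - ln d%:R) <= 1 :> R.
    rewrite -ln_div ?posrE // mulrC -ler_pdivlMr //.
    have -> : (d%:R + 1) / d%:R = 1 + 1 / d%:R :> R by field; rewrite gt_eqF.
    apply: le_ln1Dx; apply: lt_trans (_ : 0 < _); first by rewrite oppr_lt0.
    by rewrite divr_gt0.
  have -> : F d - F d.+1 = (ln d%:R + 1 - d%:R * (ln (d%:R + 1) - ln d%:R)) / (d%:R * (d%:R + 1)).
    rewrite /F -natr1; move: (ln _) (ln _) => u v; field; by rewrite !gt_eqF.
  rewrite ler_wpM2r ?invr_ge0 ?mulr_ge0 ?(ltW dR1) //.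
  by have := vonMangoldt_le_ln R d0; lra.
have F0 d : (0 < d)%N -> 0 <= F d by move=> d0; rewrite divr_ge0 // addr_ge0 // ln_ge0 // ler1n.
have cv := @vonMangoldt_series_cvg R.
have up n : (B <= n)%N -> \sum_(1 <= d < n) a d <= \sum_(1 <= d < B) a d + F B.
  move=> Bn; rewrite (big_cat_nat B0 Bn) /= lerD2l.
  apply: (@le_trans _ _ (\sum_(B <= d < n) (F d - F d.+1))).
    rewrite [leLHS]big_nat [leRHS]big_nat; apply: ler_sum => d /andP[Bd _]; apply: aF; exact: leq_trans Bd.
  have -> : \sum_(B <= d < n) (F d - F d.+1) = - \sum_(B <= d < n) (F d.+1 - F d).
    by rewrite -sumrN; apply: eq_bigr => d _; rewrite opprB.
  by rewrite telescope_sumr // opprB lerBlDr lerDl F0 // (leq_trans B0).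
have lo n : (B <= n)%N -> \sum_(1 <= d < B) a d <= \sum_(1 <= d < n) a d.
  by move=> Bn; rewrite [leRHS](big_cat_nat B0 Bn) /= lerDl sumr_ge0.
rewrite subr_ge0 lerBlDl; apply/andP; split.
  by apply: limr_ge => //; exists B => // n /= Bn; apply: lo.
by apply: limr_le => //; exists B => // n /= Bn; apply: up.
Qed.

(** * Assembling the ranges of values of [[x/n]] *)

Section MainEstimate.
Variables (R : realType) (x L l : R).
Hypotheses (L20 : 20 <= L) (xE : x = L ^+ 19) (l1 : 1 <= l) (lE : ln x <= l).

Let Ln k : 0 < L ^+ k. Proof. by rewrite exprn_gt0 // (lt_le_trans _ L20). Qed.
Let l0 : 0 < l. Proof. exact: lt_le_trans l1. Qed.
Let L1 : 1 <= L. Proof. by apply: le_trans L20; lra. Qed.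
Let x1 : 1 <= x. Proof. by rewrite xE exprn_ege1. Qed.
Let x0 : 0 < x. Proof. exact: lt_le_trans x1. Qed.

Let ln_bound (k : nat) : (0 < k)%N -> k%:R <= x -> 0 <= ln (k%:R : R) <= l.
Proof.
move=> k0 kx; rewrite ln_ge0 ?ler1n //=; apply: le_trans lE.
by rewrite ler_ln ?posrE ?ltr0n.
Qed.

Let Lambda_bound (k : nat) : (0 < k)%N -> k%:R <= x -> 0 <= vonMangoldt R k <= l.
Proof.
move=> k0 kx; rewrite vonMangoldt_ge0 /=; apply: le_trans (vonMangoldt_le_ln R k0) _.
by case/andP: (ln_bound k0 kx).
Qed.

(** The values [d < A], those from [B] on and the tail of the series cost 2, 2 and 4 times [l L^9],
    which makes the 8. Between [A] and [B] there are at most [2 l] dyadic blocks with two sawtooth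
    sums each; hence [4 * (200 * 200 * 300)] and the seventh power of [l]. *)
Lemma main_estimate :
  `|\sum_(1 <= n < (Num.truncn x).+1) vonMangoldt R (Num.truncn (x / n%:R))
    - x * \big[+%R/0]_(1 <= d <oo) (vonMangoldt R d / (d%:R * (d%:R + 1)))|
  <= (4 * (200 * 200 * 300) + 8) * (l ^+ 7 * L ^+ 9).
Proof.
have [G GE] : exists G : R, G = 200 * 200 * 300 by exists (200 * 200 * 300).
have L10x : 2 * L ^+ 10 <= x.
  have L9 : 2 <= L ^+ 9 by apply: le_trans (_ : L <= _); [move: L20; lra | rewrite -[leLHS]expr1 ler_weXn2l].
  by rewrite xE (exprD L 9 10); apply: ler_wpM2r => //; apply: ltW.
have LL9 : 20 * L ^+ 9 <= L ^+ 10 by rewrite (exprS L 9) ler_wpM2r // ltW.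
have pw (y : R) : 1 <= y -> exists k : nat, (2 ^ k)%:R <= y < 2 * (2 ^ k)%:R.
  move=> y1; exists (trunc_log 2 (Num.truncn y)).
  have y0 : 0 <= y by lra.
  have /andP[t1 t2] := truncn_itv y0.
  have q0 : (0 < Num.truncn y)%N by rewrite truncn_gt0.
  have /andP[k1 k2] := trunc_log_bounds (isT : (1 < 2)%N) q0.
  apply/andP; split; first by apply: le_trans t1; rewrite ler_nat.
  by apply: lt_le_trans t2 _; rewrite -natrM ler_nat -expnS.
have [kA /andP[A1 A2]] := pw (L ^+ 9) (exprn_ege1 9 L1).
have [iB /andP[B1 B2]] := pw (L ^+ 10) (exprn_ege1 10 L1).
(* [A] is the next power of two above [L^9], so that already the first block has [P >= L^9]; [B] is
   at most [L^10], so that the last has [P <= L^10]. *)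
pose iA := kA.+1; pose A := (2 ^ iA)%N; pose B := (2 ^ iB)%N.
have AE : A%:R = 2 * (2 ^ kA)%:R :> R by rewrite /A /iA expnS natrM.
have AL : L ^+ 9 <= A%:R by rewrite AE ltW.
have AL2 : A%:R <= 2 * L ^+ 9 by rewrite AE; move: A1; lra.
have A0 : (0 < A)%N by rewrite expn_gt0.
have B0 : (0 < B)%N by rewrite expn_gt0.
have BR : 0 < B%:R :> R by rewrite ltr0n.
have iAB : (iA <= iB)%N.
  rewrite -(@leq_exp2l 2) // -(ler_nat R) -/A -/B; apply: le_trans AL2 _.
  by move: B2 LL9 (Ln 9); rewrite -/B; lra.
have AB : (A <= B)%N by rewrite leq_exp2l.
have Bx : B%:R <= x by move: B1 L10x (Ln 10); rewrite -/B; lra.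
pose a d := vonMangoldt R d / (d%:R * (d%:R + 1)).
pose D d := saw (x / (d%:R + 0)) - saw (x / (d%:R + 1)).
have f0 : vonMangoldt R 0 = 0 by [].
have := @floor_sum_split R x x1 (vonMangoldt R) B f0 B0.
have := floor_sum_large x1 B0 (ltW l0) Lambda_bound.
set E := (X in 0 <= X <= _) => EB ->.
have -> : \sum_(1 <= d < B) vonMangoldt R d *
     ((Num.truncn (x / d%:R))%:R - (Num.truncn (x / d.+1%:R))%:R) =
   x * \sum_(1 <= d < B) a d - \sum_(1 <= d < B) vonMangoldt R d * D d.
  rewrite mulr_sumr -sumrB; apply: eq_big_nat => d /andP[d1 _].
  by rewrite truncn_saw // /a /D; ring.
have tail := vonMangoldt_series_tail R B0.
have Dsmall : `|\sum_(1 <= d < A) vonMangoldt R d * D d| <= 2 * L ^+ 9 * l.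
  apply: le_trans (ler_norm_sum _ _ _) _.
  apply: (@le_trans _ _ (\sum_(1 <= d < A) l)); last first.
    rewrite sumr_const_nat -[leLHS]mulr_natl ler_wpM2r ?(ltW l0) //.
    by apply: le_trans AL2; rewrite ler_nat leq_subr.
  rewrite [leLHS]big_nat [leRHS]big_nat; apply: ler_sum => d /andP[d1 dA].
  have dx : d%:R <= x by apply: le_trans Bx; rewrite ler_nat ltnW // (leq_trans dA).
  have /andP[La0 La1] := Lambda_bound d1 dx.
  rewrite normrM (ger0_norm La0) -[leRHS]mulr1; apply: ler_pM => //.
  have s1 : `|saw (x / (d%:R + 0))| <= 1 / 2 :> R.
    by apply: saw_bound; rewrite divr_ge0 ?(ltW x0) // addr_ge0.
  have s2 : `|saw (x / (d%:R + 1))| <= 1 / 2 :> R.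
    by apply: saw_bound; rewrite divr_ge0 ?(ltW x0) // addr_ge0.
  by apply: le_trans (ler_normB _ _) _; lra.
have L2B : 2 * B%:R <= x by move: B1 L10x; rewrite -/B; lra.
have X0 : 0 <= G * l ^+ 6 * L ^+ 9.
  rewrite -mulrA GE; have : 0 <= l ^+ 6 * L ^+ 9.
    by apply: mulr_ge0; [rewrite exprn_ge0 // ltW | exact: ltW].
  lra.
have Dlarge : `|\sum_(A <= d < B) vonMangoldt R d * D d| <= iB%:R * (2 * (G * l ^+ 6 * L ^+ 9)).
  rewrite /A /B dyadic_split //; apply: le_trans (ler_norm_sum _ _ _) _.
  apply: (@le_trans _ _ (\sum_(iA <= i < iB) 2 * (G * l ^+ 6 * L ^+ 9))); last first.
    rewrite sumr_const_nat -[leLHS]mulr_natl; apply: ler_wpM2r; first by rewrite mulr_ge0.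
    by rewrite ler_nat leq_subr.
  rewrite [leLHS]big_nat [leRHS]big_nat; apply: ler_sum => i /andP[iAi iiB].
  have LP : L ^+ 9 <= (2 ^ i)%:R by apply: le_trans AL _; rewrite ler_nat leq_exp2l.
  have PB : 2 * (2 ^ i)%:R <= B%:R :> R by rewrite -natrM -expnS ler_nat leq_exp2l.
  have P0 : 0 < (2 ^ i)%:R :> R by rewrite ltr0n expn_gt0.
  have PL : (2 ^ i)%:R <= L ^+ 10 by move: B1 PB; rewrite -/B; lra.
  have lnP : ln (2 * (2 ^ i)%:R) <= l.
    by apply: le_trans lE; rewrite ler_ln ?posrE ?mulr_gt0 // (le_trans PB).
  have d0 : 0 <= (0 : R) <= 1 by rewrite lexx ler01.
  have d1 : 0 <= (1 : R) <= 1 by rewrite lexx ler01.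
  have b0 := block_saw L20 xE d0 LP PL l1 lnP.
  have b1 := block_saw L20 xE d1 LP PL l1 lnP.
  have -> : \sum_(2 ^ i <= m < 2 * 2 ^ i) vonMangoldt R m * D m =
     \sum_(2 ^ i <= m < 2 * 2 ^ i) vonMangoldt R m * saw (x / (m%:R + 0)) -
     \sum_(2 ^ i <= m < 2 * 2 ^ i) vonMangoldt R m * saw (x / (m%:R + 1)).
    by rewrite -sumrB; apply: eq_bigr => m _; rewrite /D mulrBr.
  apply: le_trans (ler_normB _ _) _; move: b0 b1; rewrite -GE; lra.
have iBl : iB%:R <= 2 * l.
  apply: (@le_trans _ _ iB.+1%:R); first by rewrite ler_nat.
  apply: log2_bound; apply: le_trans lE; rewrite ler_ln ?posrE ?mulr_gt0 //.
have Dl2 : iB%:R * (2 * (G * l ^+ 6 * L ^+ 9)) <= 4 * G * (l ^+ 7 * L ^+ 9).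
  have Y0 : 0 <= 2 * (G * l ^+ 6 * L ^+ 9) by rewrite mulr_ge0.
  apply: le_trans (ler_wpM2r Y0 iBl) _.
  by rewrite le_eqVlt; apply/orP; left; apply/eqP; ring.
have xB : x / B%:R <= 2 * L ^+ 9.
  rewrite ler_pdivrMr // xE (exprD L 9 10).
  have := ler_wpM2l (ltW (Ln 9)) (ltW B2); rewrite -/B; lra.
have lnB : ln (B%:R : R) <= l by case/andP: (ln_bound B0 Bx).
have xB0 : 0 <= x / B%:R by rewrite divr_ge0 // ltW.
have xtail : x * ((ln B%:R + 1) / B%:R) <= 4 * (l * L ^+ 9).
  have -> : x * ((ln B%:R + 1) / B%:R) = (ln B%:R + 1) * (x / B%:R) by ring.
  have q : ln B%:R + 1 <= 2 * l by move: lnB l1; lra.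
  have q0 : 0 <= ln (B%:R : R) + 1 by rewrite addr_ge0 // ln_ge0 // ler1n.
  apply: le_trans (ler_pM q0 xB0 q xB) _.
  by rewrite le_eqVlt; apply/orP; left; apply/eqP; ring.
have EB2 : l * (x / B%:R) <= 2 * (l * L ^+ 9).
  by have := ler_wpM2l (ltW l0) xB; lra.
have l7 : l * L ^+ 9 <= l ^+ 7 * L ^+ 9.
  by rewrite ler_wpM2r ?(ltW (Ln _)) // -[leLHS]expr1 ler_weXn2l.
have A1' : (1 <= A)%N by [].
have Dsplit : \sum_(1 <= d < B) vonMangoldt R d * D d =
  \sum_(1 <= d < A) vonMangoldt R d * D d + \sum_(A <= d < B) vonMangoldt R d * D d.
  by rewrite (big_cat_nat A1' AB).
rewrite Dsplit -GE.
move: EB tail; set SB := \sum_(1 <= d < B) a d; set SL := \big[+%R/0]_(1 <= d <oo) _.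
move=> /andP[E0 E1] /andP[t0 t1].
have t0' : 0 <= x * (SL - SB) by rewrite mulr_ge0 // ltW.
have t1' := ler_wpM2l (ltW x0) t1.
move: Dsmall (le_trans Dlarge Dl2); set s1 := \sum_(1 <= d < A) _; set s2 := \sum_(A <= d < B) _.
rewrite !ler_norml => /andP[u1 u2] /andP[v1 v2].
rewrite -/E; move: E0 (le_trans E1 EB2) t0' (le_trans t1' xtail) l7 u1 u2 v1 v2.
move: (l ^+ 7 * L ^+ 9) (SL : R) (SB : R) (s1 : R) (s2 : R) (E : R) => q p r u v w.
move=> e0 e1 w0 w1 l7 u1 u2 v1 v2.
by apply/andP; split; clear - e0 e1 w0 w1 l7 u1 u2 v1 v2; lra.
Qed.

End MainEstimate.

(** [ln x] is [k / eps] times the logarithm of [x ^ (eps / k)], and a logarithm is smaller than its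
    argument. *)
Lemma ln_pow_le (R : realType) (eps x : R) (k : nat) : 0 < eps -> 1 <= x -> (0 < k)%N ->
  ln x ^+ k <= (k%:R / eps) ^+ k * x `^ eps.
Proof.
move=> e0 x1 k0; have kR : 0 < k%:R :> R by rewrite ltr0n.
have xp : 0 < x `^ (eps / k%:R) by rewrite powR_gt0 // (lt_le_trans _ x1).
have -> : x `^ eps = (x `^ (eps / k%:R)) ^+ k.
  by rewrite -powR_mulrn ?powR_ge0 // -powRrM divfK // gt_eqF.
rewrite -exprMn ler_pXn2r // ?nnegrE ?ln_ge0 //; last first.
  by rewrite mulr_ge0 ?(ltW xp) // divr_ge0 // ltW.
have -> : ln x = k%:R / eps * ln (x `^ (eps / k%:R)).
  by rewrite ln_powR; field; rewrite !gt_eqF.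
by rewrite ler_wpM2l ?divr_ge0 ?(ltW e0) // ltW // ln_sublinear.
Qed.

Theorem theorem1p1 (R : realType) (eps : R) (eps_gt0 : 0 < eps) :
  exists2 C : R, 0 < C & \forall x \near +oo_R,
    `| \sum_(1 <= n < (Num.truncn x).+1) vonMangoldt R (Num.truncn (x / n%:R))
       - x * \big[+%R/0]_(1 <= d <oo)
               (vonMangoldt R d / (d%:R * (d%:R + 1))) |
    <= C * x `^ (9 / 19 + eps).
Proof.
(* The factor [(7 / eps) ^ 7] is the price of replacing [ln x ^ 7] by [x ^ eps]. *)
exists ((4 * (200 * 200 * 300) + 8) * (7 / eps) ^+ 7).
  have c0 : 0 < 4 * (200 * 200 * 300) + 8 :> R by lra.
  have d0 : 0 < (7 / eps) ^+ 7 by rewrite exprn_gt0 // divr_gt0.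
  exact: mulr_gt0.
near=> x.
have x20 : 20 ^+ 19 <= x by near: x; apply: nbhs_pinfty_ge; rewrite num_real.
have x1 : 1 <= x by apply: le_trans x20; rewrite exprn_ege1 //; lra.
have x0 : 0 < x by apply: lt_le_trans x1.
pose L := x `^ (1 / 19).
have L0 : 0 < L by rewrite powR_gt0.
have xE : x = L ^+ 19.
  by rewrite -powR_mulrn ?powR_ge0 // -powRrM mul1r mulVf ?powRr1 ?(ltW x0) // pnatr_eq0.
have L9 : L ^+ 9 = x `^ (9 / 19).
  by rewrite -powR_mulrn ?powR_ge0 // -powRrM; congr (_ `^ _); field.
have L20 : 20 <= L.
  rewrite leNgt; apply/negP => Llt; move: x20; rewrite {1}xE leNgt => /negP; apply.
  by rewrite ltr_pXn2r // ?nnegrE ?(ltW L0) //; lra.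
have l1 : 1 <= ln x.
  have Lx : L <= x by rewrite xE -[leLHS]expr1 ler_weXn2l //; move: L20; lra.
  have : ln (2 * 2) <= ln x.
    by rewrite ler_ln ?posrE ?mulr_gt0 //; move: L20 Lx; lra.
  by rewrite lnM ?posrE //; have := ln2_ge_half R; lra.
apply: le_trans (main_estimate L20 xE l1 (lexx _)) _.
have -> : x `^ (9 / 19 + eps) = L ^+ 9 * x `^ eps.
  by rewrite L9 powRD // (gt_eqF x0) implybT.
have := ln_pow_le eps_gt0 x1 (isT : (0 < 7)%N).
move=> /(ler_wpM2r (ltW (exprn_gt0 9 L0))) h.
have c0 : 0 <= 4 * (200 * 200 * 300) + 8 :> R by lra.
apply: le_trans (ler_wpM2l c0 h) _.
by rewrite le_eqVlt; apply/orP; left; apply/eqP; ring.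
Unshelve. all: by end_near.
Qed.
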